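(* Let $1\le\alpha<2$ and $p>2$. Let $L,R$ be non-negative random variables such that $\mathbb{P}\{L>0\}+\mathbb{P}\{R>0\}>1$, $\mathbb{E}[L^\alpha+R^\alpha]=1$ and $\mathbb{E}[L^p+R^p]<1$. Let $\bar\mu_0$ be a Borel probability measure on $\mathbb{R}$ with distribution function $F_0$, satisfying the following. (a) If $1<\alpha<2$: $\lim_{x\to+\infty}x^\alpha(1-F_0(x))=c_0^+<+\infty$, $\lim_{x\to-\infty}|x|^\alpha F_0(x)=c_0^-<+\infty$ and $\int_{\mathbb{R}}v\,\bar\mu_0(dv)=0$. (b) If $\alpha=1$: $\lim_{x\to-\infty}|x|F_0(x)=\lim_{x\to+\infty}x[1-F_0(x)]=c_0\in[0,+\infty)$ and $\lim_{\rho\to+\infty}\int_{(-\rho,\rho)}x\,dF_0(x)=\gamma_0$ with $-\infty<\gamma_0<+\infty$. Let $(\mu_t)_{t\ge 0}$ be the solution of the kinetic equation with initial datum $\bar\mu_0$ and let $\mu_\infty$ be the corresponding steady state. Assume $d_p(\bar\mu_0,\mu_\infty)<+\infty$. Put $K_2(p)=\max\{\varphi(2),\varphi(p)\}$. Then there exists a constant $C_p=C_p(\bar\mu_0)<+\infty$ such that, for every $t\ge 0$, $$d_p(\mu_t,\mu_\infty)\le \begin{cases} C_p\, e^{-t|K_2(p)|} & \text{if } \varphi(p)\neq\varphi(2),\\ C_p\,t\, e^{-t|K_2(p)|} & \text{if } \varphi(p)=\varphi(2).\end{cases}$$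
   Context: Notation: $\mathcal{S}(s)=\mathbb{E}[L^s+R^s]-1$ and $\varphi(q)=\mathcal{S}(q)/q$ for $q>0$. Solution: given a Borel probability measure $\bar\mu_0$ on $\mathbb{R}$, the solution of the kinetic equation with initial datum $\bar\mu_0$ is the unique family $(\mu_t)_{t\ge0}$ of probability measures on $\mathbb{R}$ whose Fourier–Stieltjes transforms $\hat\mu_t(\xi)=\int e^{i\xi v}\mu_t(dv)$ satisfy $\partial_t\hat\mu_t(\xi)+\hat\mu_t(\xi)=\mathbb{E}[\hat\mu_t(L\xi)\hat\mu_t(R\xi)]$ for $t>0$, $\xi\in\mathbb{R}$, with $\hat\mu_0(\xi)=\int e^{i\xi v}\bar\mu_0(dv)$. Equivalently $\mu_t=\sum_{n\ge0}e^{-t}(1-e^{-t})^n\rho_n$, where $\rho_0=\bar\mu_0$ and, for $n\ge1$, $\rho_n=\frac1n\sum_{j=0}^{n-1}Q^+(\rho_j,\rho_{n-1-j})$, $Q^+(\mu,\nu)$ being the law of $LX+RY$ with $X\sim\mu$, $Y\sim\nu$ and $X,Y,(L,R)$ independent. Mixing measure: $\nu_\alpha$ is the unique probability measure on $[0,+\infty)$ with $\int v\,\nu_\alpha(dv)=1$ whose Fourier–Stieltjes transform satisfies $\hat\nu_\alpha(\xi)=\mathbb{E}[\hat\nu_\alpha(L^\alpha\xi)\hat\nu_\alpha(R^\alpha\xi)]$ for all $\xi\in\mathbb{R}$. Steady state: $\mu_\infty$ is the probability measure on $\mathbb{R}$ (the weak limit of $\mu_t$ as $t\to+\infty$) given as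 follows. If $1<\alpha<2$, $$\int e^{i\xi v}\mu_\infty(dv)=\int_{[0,+\infty)}e^{-\lambda m|\xi|^\alpha[1-i\beta\tan(\pi\alpha/2)\operatorname{sign}\xi]}\nu_\alpha(dm),$$ where $\lambda=\frac{(c_0^++c_0^-)\pi}{2\Gamma(\alpha)\sin(\pi\alpha/2)}$ and $\beta=\frac{c_0^+-c_0^-}{c_0^++c_0^-}$ (with $\beta=0$ if $c_0^++c_0^-=0$). If $\alpha=1$, $\int e^{i\xi v}\mu_\infty(dv)=\int_{[0,+\infty)}e^{m(i\gamma_0\xi-c_0\pi|\xi|)}\nu_1(dm)$. Wasserstein distance of order $p>0$: $d_p(\mu_1,\mu_2)=\inf_m\big(\int_{\mathbb{R}^2}|x-y|^p m(dx\,dy)\big)^{\min(1,1/p)}$, the infimum being over all couplings $m$ of $\mu_1,\mu_2$; it may be $+\infty$.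
   Formalization: In the case φ(p)=φ(2), the factor t in the bound is replaced by max(1,t), since the printed bound C_p t e^{-t|K_2(p)|} fails at t=0 (it would force d_p(μ̄_0,μ_∞)=0); for t≥1 the bound is as printed. *)

(* Defs.v *)
From HB Require Import structures.
From mathcomp Require Import all_boot all_order all_algebra.
From mathcomp Require Import all_classical all_reals all_analysis.
From mathcomp Require Import complex.

Set Implicit Arguments.
Unset Strict Implicit.
Unset Printing Implicit Defensive.

Import Order.TTheory GRing.Theory Num.Theory.
Import numFieldNormedType.Exports.

Local Open Scope classical_set_scope.
Local Open Scope ring_scope.
Local Open Scope complex_scope.

Notation probR R := (probability (measurableTypeR R) R).

(* Euler's Gamma function, for a > 0. *)
Definition gamma_fun (R : realType) (a : R) : R :=
  \int[@lebesgue_measure R]_(x in `]0, +oo[) (x `^ (a - 1) * expR (- x)).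

Definition cexp (R : realType) (z : R[i]) : R[i] :=
  (expR (complex.Re z) * cos (complex.Im z))
  +i* (expR (complex.Re z) * sin (complex.Im z)).

(* Used below only for bounded measurable f and finite mu, where both real
   integrals are finite. *)
Definition cintegral (d : measure_display) (T : measurableType d)
    (R : realType) (mu : {measure set T -> \bar R}) (D : set T)
    (f : T -> R[i]) : R[i] :=
  (\int[mu]_(x in D) complex.Re (f x)) +i* (\int[mu]_(x in D) complex.Im (f x)).

Definition fourier (R : realType) (mu : probR R) (xi : R) : R[i] :=
  cintegral mu setT (fun v => cexp (0 +i* (xi * v))).

Definition distribution_function (R : realType) (mu : probR R) (x : R) : R :=
  fine (mu `]-oo, x]%classic).

Definition is_coupling (R : realType) (mu1 mu2 : probR R)
    (m : probability (measurableTypeR R * measurableTypeR R)%type R) : Prop :=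
  forall A : set (measurableTypeR R), measurable A ->
    m (A `*` setT) = mu1 A /\ m (setT `*` A) = mu2 A.

Definition wasserstein (R : realType) (p : R) (mu1 mu2 : probR R) : \bar R :=
  ereal_inf [set ((\int[m]_z (`|z.1 - z.2| `^ p)%:E) `^ (Num.min 1 p^-1)%R)%E
            | m in is_coupling mu1 mu2].

Definition S_fun (d : measure_display) (Omega : measurableType d)
    (R : realType) (P : probability Omega R) (L Rr : {RV P >-> R}) (s : R) : R :=
  fine 'E_P[fun w => L w `^ s + Rr w `^ s] - 1.

Definition phi (d : measure_display) (Omega : measurableType d)
    (R : realType) (P : probability Omega R) (L Rr : {RV P >-> R}) (q : R) : R :=
  S_fun L Rr q / q.

(* The time derivative of the complex-valued transform is taken componentwise.
   The equation only constrains t > 0; right-continuity at 0 is what makes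
   mu 0 the initial value of the evolution. Values of mu at t < 0 are junk. *)
Definition is_kinetic_solution (d : measure_display) (Omega : measurableType d)
    (R : realType) (P : probability Omega R) (L Rr : {RV P >-> R})
    (mu0 : probR R) (mu : R -> probR R) : Prop :=
  let rhs (t xi : R) : R[i] :=
    cintegral P setT
      (fun w => fourier (mu t) (L w * xi) * fourier (mu t) (Rr w * xi))
    - fourier (mu t) xi in
  [/\ forall xi : R, fourier (mu 0) xi = fourier mu0 xi,
      forall xi : R,
        complex.Re (fourier (mu t) xi) @[t --> 0^'+]
          --> complex.Re (fourier (mu 0) xi) /\
        complex.Im (fourier (mu t) xi) @[t --> 0^'+]
          --> complex.Im (fourier (mu 0) xi) &
      forall t xi : R, 0 < t ->
        is_derive t 1 (fun s : R => complex.Re (fourier (mu s) xi))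
          (complex.Re (rhs t xi)) /\
        is_derive t 1 (fun s : R => complex.Im (fourier (mu s) xi))
          (complex.Im (rhs t xi))].

Definition is_mixing_measure (d : measure_display) (Omega : measurableType d)
    (R : realType) (P : probability Omega R) (L Rr : {RV P >-> R})
    (alpha : R) (nu : probR R) : Prop :=
  [/\ nu `[0, +oo[%classic = 1%E,
      (\int[nu]_(v in `[0%R, +oo[) v%:E = 1)%E &
      forall xi : R, fourier nu xi =
        cintegral P setT (fun w => fourier nu (L w `^ alpha * xi) *
                                   fourier nu (Rr w `^ alpha * xi))].

Definition stable_lambda (R : realType) (alpha cp cm : R) : R :=
  (cp + cm) * pi / (2 * gamma_fun alpha * sin (pi * alpha / 2)).

Definition stable_beta (R : realType) (cp cm : R) : R :=
  if cp + cm == 0 then 0 else (cp - cm) / (cp + cm).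

(* cp, cm only matter for 1 < alpha < 2, and c, gamma only for alpha = 1. *)
Definition is_steady_state (R : realType) (alpha cp cm c gamma : R)
    (nu muinf : probR R) : Prop :=
  (1 < alpha < 2 -> forall xi : R, fourier muinf xi =
     cintegral nu `[0, +oo[%classic (fun m => cexp
       (- (stable_lambda alpha cp cm * m * `|xi| `^ alpha)%:C *
         (1 +i* (- (stable_beta cp cm * tan (pi * alpha / 2) * Num.sg xi)))))) /\
  (alpha = 1 -> forall xi : R, fourier muinf xi =
     cintegral nu `[0, +oo[%classic (fun m => cexp
       (m%:C * ((- (c * pi * `|xi|)) +i* (gamma * xi))))).

Definition initial_condition (R : realType) (alpha cp cm c gamma : R)
    (mu0 : probR R) : Prop :=
  let F0 := distribution_function mu0 in
  (1 < alpha < 2 ->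
     [/\ x `^ alpha * (1 - F0 x) @[x --> +oo] --> cp,
         `|x| `^ alpha * F0 x @[x --> -oo] --> cm &
         (\int[mu0]_v v%:E = 0)%E]) /\
  (alpha = 1 ->
     [/\ 0 <= c,
         `|x| * F0 x @[x --> -oo] --> c,
         x * (1 - F0 x) @[x --> +oo] --> c &
         \int[mu0]_(x in `]- rho, rho[) x @[rho --> +oo] --> gamma]).

(* Main.v *)
Require Import Defs.
From HB Require Import structures.
From mathcomp Require Import all_boot all_order all_algebra.
From mathcomp Require Import all_classical all_reals all_analysis.
From mathcomp Require Import measurable_realfun complex ring lra.

(** The proof is by coupling.  Finiteness of the distance provides a coupling
    [m_0] of the initial law and the steady state whose displacement [x - y] has
    a finite moment of order [p].  Running the collision dynamics on the plane,
    with the same coefficients [L] and [Rr] for both coordinates, produces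
    probability measures [m_t], the Wild sums issued from [m_0].  Their first
    marginal solves the kinetic equation and therefore is [mu t]: the expansion
    of a solution in powers of [1 - exp (- t)] has the Wild coefficients, with a
    geometric remainder ([cvg_wild_expansion]), and laws on the line are
    determined by their Fourier transforms ([fourier_inj]).  Their second
    marginal stays [muinf], which is a fixed point of the gain operator
    ([steady_fixed_point]).  Hence the distance to be estimated is at most the
    [p]-th root of the moment of order [p] of the displacement under [m_t].

    The displacement is a linear statistic, so it undergoes the same dynamics.
    It has mean zero under [m_0] ([coupling_centered]).  For [alpha > 1] both
    marginals are centered.  For [alpha = 1] neither marginal need have a mean;
    instead the imaginary parts of both transforms have the slope [gamma] at the
    origin, and the difference of these slopes is the mean displacement
    ([coupling_mean_difference]).  For the initial law this rests on the balance
    of the two tails ([sine_slope]).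

    Since centering is preserved, a sum of two independent displacements
    satisfies [|x + y| ^ p <= |x| ^ p + |y| ^ p + O (|x| ^ (p - 2) y ^ 2 +
    x ^ 2 |y| ^ (p - 2))] in expectation ([powR_add_bound], [gain_moment]).  The
    second moment then decays like [exp (t S(2))], and the moment [A] of order
    [p] satisfies [A' <= S(p) A + c B s], where [s] is the second moment and [B]
    the moment of order [p - 2].  Young's inequality with a free parameter
    [delta] bounds [B s] by [delta A + delta ^ (- (p - 2) / 2) s ^ (p / 2)], and
    a choice of [delta] depending on time gives the rate [S(p)], the rate
    [p S(2) / 2], or their common value with a power of [t], according to the
    sign of [p S(2) / 2 - S(p)] ([growth_gt0], [growth_eq0], [growth_lt0],
    [wild_cost]).  Dividing by [p] turns these into the rates [phi(p)] and
    [phi(2)], both negative by convexity of [S] ([S_fun_2_lt0]). *)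

Set Implicit Arguments.
Unset Strict Implicit.
Unset Printing Implicit Defensive.

Import Order.TTheory GRing.Theory Num.Theory.
Import numFieldNormedType.Exports.

Local Open Scope classical_set_scope.
Local Open Scope ring_scope.
(** * Real-valued expectations *)

Section bounded_measurable.
Context (R : realType).

Definition bounded_measurable d (T : measurableType d) (f : T -> R) :=
  measurable_fun setT f /\ exists M : R, forall x, `|f x| <= M.

Definition integrableR d (T : measurableType d)
    (m : {measure set T -> \bar R}) (f : T -> R) :=
  m.-integrable setT (EFin \o f).

Lemma bmM d (T : measurableType d) (f g : T -> R) :
  bounded_measurable f -> bounded_measurable g ->
  bounded_measurable (fun x => f x * g x).
Proof.
move=> [mf [M hM]] [mg [N hN]]; split; first exact: measurable_funM.
exists (M * N) => x; rewrite normrM; exact: ler_pM.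
Qed.

Lemma bmD d (T : measurableType d) (f g : T -> R) :
  bounded_measurable f -> bounded_measurable g ->
  bounded_measurable (fun x => f x + g x).
Proof.
move=> [mf [M hM]] [mg [N hN]]; split; first exact: measurable_funD.
exists (M + N) => x; apply: le_trans (ler_normD _ _) _; exact: lerD.
Qed.

Lemma bm_cst d (T : measurableType d) (a : R) :
  bounded_measurable (fun _ : T => a).
Proof. by split; [exact: measurable_cst|exists `|a|]. Qed.

Lemma bmZ d (T : measurableType d) (a : R) (f : T -> R) :
  bounded_measurable f -> bounded_measurable (fun x => a * f x).
Proof. by move=> bf; apply: bmM => //; exact: bm_cst. Qed.

Lemma bmN d (T : measurableType d) (f : T -> R) :
  bounded_measurable f -> bounded_measurable (fun x => - f x).
Proof.
move=> [mf [M hM]]; split; first exact: measurableT_comp.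
by exists M => x; rewrite normrN.
Qed.

Lemma bmB d (T : measurableType d) (f g : T -> R) :
  bounded_measurable f -> bounded_measurable g ->
  bounded_measurable (fun x => f x - g x).
Proof. by move=> bf bg; apply: bmD => //; exact: bmN. Qed.

Lemma bm_comp d (T : measurableType d) d' (T' : measurableType d')
    (f : T' -> R) (g : T -> T') :
  bounded_measurable f -> measurable_fun setT g ->
  bounded_measurable (fun x => f (g x)).
Proof.
move=> [mf [M hM]] mg; split; first exact: measurableT_comp.
by exists M.
Qed.

Lemma measurable_cos : measurable_fun setT (@cos R).
Proof. by apply: continuous_measurable_fun; exact: continuous_cos. Qed.

Lemma measurable_sin : measurable_fun setT (@sin R).
Proof. by apply: continuous_measurable_fun; exact: continuous_sin. Qed.

Lemma norm_cos_le1 (x : R) : `|cos x| <= 1.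
Proof. by rewrite ler_norml cos_geN1 cos_le1. Qed.

Lemma norm_sin_le1 (x : R) : `|sin x| <= 1.
Proof. by rewrite ler_norml sin_geN1 sin_le1. Qed.

Lemma bm_cos d (T : measurableType d) (g : T -> R) :
  measurable_fun setT g -> bounded_measurable (fun x => cos (g x)).
Proof.
move=> mg; apply: (bm_comp (f := @cos R)) => //; split.
  exact: measurable_cos.
by exists 1; exact: norm_cos_le1.
Qed.

Lemma bm_sin d (T : measurableType d) (g : T -> R) :
  measurable_fun setT g -> bounded_measurable (fun x => sin (g x)).
Proof.
move=> mg; apply: (bm_comp (f := @sin R)) => //; split.
  exact: measurable_sin.
by exists 1; exact: norm_sin_le1.
Qed.

Section expectation_of_a_probability.
Context d (T : measurableType d) (m : probability T R).
Implicit Types f g : T -> R.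

Lemma bm_integrable f : bounded_measurable f -> integrableR m f.
Proof.
move=> [mf [M hM]]; apply: measurable_bounded_integrable => //.
  by apply: le_lt_trans (probability_le1 m measurableT) _; rewrite ltry.
exists M; split; first exact: num_real.
by move=> N MN x _ /=; apply: le_trans (hM x) (ltW MN).
Qed.

Lemma intD f g : integrableR m f -> integrableR m g ->
  \int[m]_x (f x + g x) = \int[m]_x f x + \int[m]_x g x.
Proof. exact: RintegralD. Qed.

Lemma intB f g : integrableR m f -> integrableR m g ->
  \int[m]_x (f x - g x) = \int[m]_x f x - \int[m]_x g x.
Proof. exact: RintegralB. Qed.

Lemma intZ a f : integrableR m f ->
  \int[m]_x (a * f x) = a * \int[m]_x f x.
Proof. exact: RintegralZl. Qed.

Lemma int_cst a : \int[m]_x a = a.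
Proof. rewrite Rintegral_cst// [X in _ * fine X](_ : _ = 1%E) ?mulr1//.
exact: probability_setT. Qed.

Lemma int_le f g : integrableR m f -> integrableR m g ->
  (forall x, f x <= g x) -> \int[m]_x f x <= \int[m]_x g x.
Proof. by move=> *; exact: le_Rintegral. Qed.

Lemma int_ext f g : f =1 g -> \int[m]_x f x = \int[m]_x g x.
Proof. by move=> fg; apply: eq_Rintegral => x _; exact: fg. Qed.

Lemma integrableR_measurable f : integrableR m f -> measurable_fun setT f.
Proof. by move=> /measurable_int /measurable_EFinP. Qed.

Lemma integrableR_le f g : measurable_fun setT f -> integrableR m g ->
  (forall x, `|f x| <= `|g x|) -> integrableR m f.
Proof.
move=> mf ig fg; apply: le_integrable ig => //; first exact/measurable_EFinP.
by move=> x _; rewrite /= lee_fin.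
Qed.

Lemma integrableRD f g : integrableR m f -> integrableR m g ->
  integrableR m (fun x => f x + g x).
Proof.
move=> intf intg; have := integrableD measurableT intf intg.
by apply: eq_integrable.
Qed.

Lemma integrableRZ a f : integrableR m f -> integrableR m (fun x => a * f x).
Proof.
move=> intf; have := integrableZl measurableT a intf.
by apply: eq_integrable.
Qed.

Lemma integrableRB f g : integrableR m f -> integrableR m g ->
  integrableR m (fun x => f x - g x).
Proof.
move=> intf intg; have := integrableB measurableT intf intg.
by apply: eq_integrable.
Qed.

Lemma integrableR_norm f : integrableR m f -> integrableR m (fun x => `|f x|).
Proof. exact: integrable_norm. Qed.

Lemma int_norm_le f : integrableR m f ->
  `|\int[m]_x f x| <= \int[m]_x `|f x|.
Proof. exact: le_normr_Rintegral. Qed.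

Lemma EFin_int f : integrableR m f ->
  (\int[m]_x f x)%:E = (\int[m]_x (f x)%:E)%E.
Proof. by move=> intf; rewrite /Rintegral fineK//; exact: integrable_fin_num. Qed.

Lemma ge0_integrableR f : measurable_fun setT f -> (forall x, 0 <= f x) ->
  (\int[m]_x (f x)%:E < +oo)%E -> integrableR m f.
Proof.
move=> mf f0 fy; apply/integrableP; split; first exact/measurable_EFinP.
by under eq_integral do rewrite /= ger0_norm//.
Qed.

Lemma int_norm_bound f M : measurable_fun setT f -> (forall x, `|f x| <= M) ->
  `|\int[m]_x f x| <= M.
Proof.
move=> mf fM; have bf : bounded_measurable f by split => //; exists M.
apply: le_trans (int_norm_le (bm_integrable bf)) _.
rewrite -[leRHS]int_cst; apply: int_le => //.
  by apply: integrableR_norm; exact: bm_integrable.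
exact/bm_integrable/bm_cst.
Qed.

Lemma int_dominated_cvg (f_ : nat -> T -> R) f g :
  (forall n, measurable_fun setT (f_ n)) ->
  (forall x, f_ n x @[n --> \oo] --> f x) ->
  integrableR m g -> (forall n x, `|f_ n x| <= g x) ->
  \int[m]_x f_ n x @[n --> \oo] --> \int[m]_x f x.
Proof.
move=> mf cf ig fg.
have ge0 x : 0 <= g x by apply: le_trans (fg 0%N x).
have gfn n : integrableR m (f_ n).
  by apply: integrableR_le ig _ => // x; rewrite [leRHS]ger0_norm.
have [] := @dominated_convergence _ _ _ m setT measurableT
  (fun n => EFin \o f_ n) (EFin \o f) (EFin \o g).
- by move=> n; exact/measurable_EFinP.
- apply/measurable_EFinP; apply: (measurable_fun_cvg (h := f_)) => //.
- by apply: aeW => x _; apply: cvg_EFin; [exact: nearW|exact: cf].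
- exact: ig.
- by apply: aeW => x n _; rewrite /= lee_fin.
move=> intf _; rewrite -(EFin_int intf) => /fine_cvgP[_]; exact.
Qed.

Lemma int_bounded_cvg (f_ : nat -> T -> R) f M :
  (forall n, measurable_fun setT (f_ n)) ->
  (forall x, f_ n x @[n --> \oo] --> f x) ->
  (forall n x, `|f_ n x| <= M) ->
  \int[m]_x f_ n x @[n --> \oo] --> \int[m]_x f x.
Proof.
move=> mf cf fM; apply: (int_dominated_cvg (g := fun _ => M)) => //.
exact/bm_integrable/bm_cst.
Qed.

End expectation_of_a_probability.

Section product_of_probabilities.
Context d1 d2 (T1 : measurableType d1) (T2 : measurableType d2).
Variables (m1 : probability T1 R) (m2 : probability T2 R).

Lemma bm_section (f : T1 * T2 -> R) x : bounded_measurable f ->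
  bounded_measurable (fun y => f (x, y)).
Proof. by move=> bf; apply: bm_comp => //; exact: measurable_pair1. Qed.

Lemma bm_fubini (f : T1 * T2 -> R) : bounded_measurable f ->
  bounded_measurable (fun x => \int[m2]_y f (x, y)).
Proof.
move=> bf; have bI := bm_integrable (m1 \x m2)%E bf.
split.
  have := measurable_fubini_F bI.
  rewrite /fubini_F => h.
  apply: (measurableT_comp (f := @fine R)) h.
exact: fine_measurable.
case: (bf) => _ [M hM]; exists M => x; apply: int_norm_bound => //.
by case: (bm_section x bf).
Qed.

Lemma int_fubini (f : T1 * T2 -> R) : bounded_measurable f ->
  \int[(m1 \x m2)%E]_z f z = \int[m1]_x \int[m2]_y f (x, y).
Proof.
move=> bf; have bI := bm_integrable (m1 \x m2)%E bf.
rewrite /Rintegral; congr fine; rewrite -integral12_prod_meas1//.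
apply: eq_integral => x _; rewrite /fubini_F -EFin_int//.
by apply: bm_integrable; exact: bm_section.
Qed.

Lemma integrableR_prod (f : T1 -> R) (g : T2 -> R) :
  integrableR m1 f -> integrableR m2 g ->
  integrableR (m1 \x m2)%E (fun z => f z.1 * g z.2).
Proof.
move=> intf intg.
have mfg : measurable_fun setT (fun z : T1 * T2 => f z.1 * g z.2).
  apply: measurable_funM.
    by apply: measurableT_comp => //; exact: integrableR_measurable intf.
  by apply: measurableT_comp => //; exact: integrableR_measurable intg.
apply/(integrable12ltyP m1 m2); first exact/measurable_EFinP.
have ig := integrableR_norm intg.
under eq_integral => x _.
  under eq_integral => y _ do rewrite /= normrM EFinM.
  rewrite ge0_integralZl//; last first.
    apply/measurable_EFinP; exact: integrableR_measurable ig.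
  rewrite -(EFin_int ig) -EFinM mulrC.
  over.
rewrite /= -EFin_int ?ltry//.
exact/integrableRZ/integrableR_norm.
Qed.

Lemma int_prod (f : T1 -> R) (g : T2 -> R) :
  integrableR m1 f -> integrableR m2 g ->
  \int[(m1 \x m2)%E]_z (f z.1 * g z.2) = \int[m1]_x f x * \int[m2]_y g y.
Proof.
move=> intf intg; have ifg := integrableR_prod intf intg.
rewrite /Rintegral -integral12_prod_meas1//=.
rewrite /fubini_F /=.
under eq_integral => x _.
  under eq_integral => y _ do rewrite EFinM.
  rewrite integralZl// -(EFin_int intg) -EFinM mulrC.
  over.
rewrite /= -EFin_int; last exact: integrableRZ.
by rewrite /= intZ// mulrC.
Qed.

End product_of_probabilities.

Section image_of_a_probability.
Context d1 d2 (T1 : measurableType d1) (T2 : measurableType d2).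
Variables (m : probability T1 R) (X : {mfun T1 >-> T2}).

Lemma integrableR_image (f : T2 -> R) : measurable_fun setT f ->
  integrableR m (f \o X) -> integrableR (distribution m X) f.
Proof.
move=> mf /integrableP[_ fy]; apply/integrableP; split.
  exact/measurable_EFinP.
rewrite ge0_integral_distribution//.
by apply/measurable_EFinP; exact: measurableT_comp.
Qed.

Lemma int_image (f : T2 -> R) : measurable_fun setT f ->
  integrableR m (f \o X) ->
  \int[distribution m X]_y f y = \int[m]_x f (X x).
Proof.
move=> mf fi; rewrite /Rintegral integral_distribution//.
exact/measurable_EFinP.
Qed.

End image_of_a_probability.

End bounded_measurable.

(** * Laws on the line are determined by their Fourier transforms *)

Section fourier_uniqueness.
Context (R : realType).
Implicit Types (m : probR R) (f g h : R -> R).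

Definition cos_transform m (xi : R) : R := \int[m]_v cos (xi * v).
Definition sin_transform m (xi : R) : R := \int[m]_v sin (xi * v).

Lemma fourierE m xi :
  fourier m xi = (cos_transform m xi +i* sin_transform m xi)%C.
Proof.
by rewrite /fourier /cintegral /cexp /=; congr (_ +i* _)%C;
  apply: int_ext => v /=; rewrite expR0 mul1r.
Qed.

Definition smoothstep (y : R) : R := (3 * y - y ^+ 3) / 2.

Lemma iter_smoothstepN k (y : R) :
  iter k smoothstep (- y) = - iter k smoothstep y.
Proof.
elim: k => [//|k IH]; rewrite !iterS IH /smoothstep.
by field.
Qed.

Lemma iter_smoothstep0 k : iter k smoothstep (0 : R) = 0.
Proof.
elim: k => [//|k IH]; rewrite iterS IH /smoothstep.
by field.
Qed.

(** Both [1 - smoothstep z = (1 - z) ^ 2 (2 + z) / 2] and the monotonicity of the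
    iteration on the unit interval come from factoring the cubic. *)
Lemma iter_smoothstep_bounds (y : R) k : 0 <= y <= 1 ->
  y <= iter k smoothstep y <= 1 /\
  1 - iter k smoothstep y <= (1 - y / 2) ^+ k.
Proof.
move=> /andP[y0 y1]; elim: k => [|k [/andP[IH1 IH2] IH3]].
  by rewrite /= expr0 lexx y1; split => //; lra.
rewrite iterS exprS; set z := iter k smoothstep y in IH1 IH2 IH3 *.
have E : smoothstep z = z + z * (1 - z) * (1 + z) / 2.
  by rewrite /smoothstep; field.
have E2 : 1 - smoothstep z = (1 - (z + z ^+ 2) / 2) * (1 - z).
  by rewrite /smoothstep; field.
have z0 : 0 <= z by lra.
have h1 : 0 <= z * (1 - z) * (1 + z) by rewrite !mulr_ge0//; lra.
have h2 : 0 <= (1 - z) ^+ 2 * (2 + z) by rewrite mulr_ge0 ?sqr_ge0//; lra.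
have E3 : 1 - smoothstep z = (1 - z) ^+ 2 * (2 + z) / 2.
  by rewrite /smoothstep; field.
split; first by apply/andP; split; lra.
have z2 : 0 <= z ^+ 2 by exact: sqr_ge0.
rewrite E2; apply: le_trans (_ : _ <= (1 - y / 2) * (1 - z)) _.
  by apply: ler_wpM2r; lra.
by apply: ler_wpM2l => //; lra.
Qed.

(** The cubic has the attracting fixed points -1 and 1 and the repelling
    fixed point 0, so that its iterates turn a sine into a square wave. *)
Lemma cvg_iter_smoothstep (y : R) : `|y| <= 1 ->
  iter k smoothstep y @[k --> \oo] --> Num.sg y.
Proof.
have pos (z : R) : 0 < z <= 1 -> iter k smoothstep z @[k --> \oo] --> (1 : R).
  move=> /andP[z0 z1].
  have zz : 0 <= z <= 1 by rewrite ltW.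
  have : (1 - z / 2) ^+ k @[k --> \oo] --> (0 : R).
    by apply: cvg_expr; rewrite ger0_norm; lra.
  move=> c; apply: (@squeeze_cvgr _ _ _ _ (fun k => 1 - (1 - z / 2) ^+ k)
    (fun=> 1)).
  - apply: nearW => k; have [/andP[a b] c'] := iter_smoothstep_bounds k zz.
    by rewrite b andbT; lra.
  - by rewrite -[X in _ --> X]subr0; apply: cvgB => //; exact: cvg_cst.
  - exact: cvg_cst.
move=> /ler_normlP[y1 y2]; have [y0|y0|->] := ltgtP y 0.
- rewrite ltr0_sg//.
  rewrite (_ : (fun k => _) = (fun k => - iter k smoothstep (- y))); last first.
    by apply/funext => k; rewrite iter_smoothstepN opprK.
  by apply: cvgN; apply: pos; apply/andP; split; lra.
- by rewrite gtr0_sg//; apply: pos; apply/andP; split; lra.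
- rewrite sgr0; under eq_fun do rewrite iter_smoothstep0; exact: cvg_cst.
Qed.

Section equal_transforms.
Variables m1 m2 : probR R.
Hypothesis cos12 : forall xi, cos_transform m1 xi = cos_transform m2 xi.
Hypothesis sin12 : forall xi, sin_transform m1 xi = sin_transform m2 xi.

(** The functions whose weighted transforms agree: a vector space on which the
    trigonometric functions act by multiplication. *)
Definition agree f := bounded_measurable f /\ forall xi,
  \int[m1]_v (f v * cos (xi * v)) = \int[m2]_v (f v * cos (xi * v)) /\
  \int[m1]_v (f v * sin (xi * v)) = \int[m2]_v (f v * sin (xi * v)).

(** The multipliers of that vector space: unlike it, they visibly form an
    algebra. *)
Definition multiplier f :=
  bounded_measurable f /\ forall h, agree h -> agree (fun v => f v * h v).

Lemma bm_cosM xi : bounded_measurable (fun v : R => cos (xi * v)).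
Proof. by apply: bm_cos; exact: mulrl_measurable. Qed.

Lemma bm_sinM xi : bounded_measurable (fun v : R => sin (xi * v)).
Proof. by apply: bm_sin; exact: mulrl_measurable. Qed.

Local Hint Resolve bm_cosM bm_sinM : core.

Lemma agree_lin a b f g : agree f -> agree g ->
  agree (fun v => a * f v + b * g v).
Proof.
move=> [bf hf] [bg hg]; split; first by apply: bmD; exact: bmZ.
move=> xi; have [f1 f2] := hf xi; have [g1 g2] := hg xi.
have aux (m : probR R) k : bounded_measurable k ->
    \int[m]_v ((a * f v + b * g v) * k v) =
    a * (\int[m]_v (f v * k v)) + b * (\int[m]_v (g v * k v)).
  move=> bk.
  rewrite -!intZ; [|by apply: bm_integrable; exact: bmM..].
  rewrite -intD; [|by apply: bm_integrable; apply: bmZ; exact: bmM..].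
  by apply: int_ext => v; rewrite mulrDl !mulrA.
split.
  by rewrite !(aux _ _ (bm_cosM xi)) f1 g1.
by rewrite !(aux _ _ (bm_sinM xi)) f2 g2.
Qed.

Lemma agree_ext f g : f =1 g -> agree f -> agree g.
Proof. by move=> /funext ->. Qed.

Lemma agree1 : agree (fun=> 1).
Proof.
split; first exact: bm_cst.
move=> xi; split; under int_ext do rewrite mul1r.
  by under [RHS]int_ext do rewrite mul1r; exact: cos12.
by under [RHS]int_ext do rewrite mul1r; exact: sin12.
Qed.

Lemma multiplier_ext f g : f =1 g -> multiplier f -> multiplier g.
Proof. by move=> /funext ->. Qed.

Lemma multiplierD f g : multiplier f -> multiplier g ->
  multiplier (fun v => f v + g v).
Proof.
move=> [bf hf] [bg hg]; split; first exact: bmD.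
move=> h ah; apply: agree_ext (agree_lin 1 1 (hf _ ah) (hg _ ah)) => v.
by rewrite !mul1r mulrDl.
Qed.

Lemma multiplierM f g : multiplier f -> multiplier g ->
  multiplier (fun v => f v * g v).
Proof.
move=> [bf hf] [bg hg]; split; first exact: bmM.
by move=> h ah; apply: agree_ext (hf _ (hg _ ah)) => v; rewrite mulrA.
Qed.

Lemma multiplier_cst a : multiplier (fun=> a).
Proof.
split; first exact: bm_cst.
move=> h ah; apply: agree_ext (agree_lin a 0 ah ah) => v.
by rewrite mul0r addr0.
Qed.

Lemma multiplierZ a f : multiplier f -> multiplier (fun v => a * f v).
Proof. by move=> mf; apply: multiplierM => //; exact: multiplier_cst. Qed.

Lemma multiplier_int f : multiplier f -> \int[m1]_v f v = \int[m2]_v f v.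
Proof.
move=> [_ /(_ _ agree1)[_ /(_ 0)[+ _]]].
have aux (m : probR R) :
    \int[m]_v (f v * 1 * cos (0 * v)) = \int[m]_v f v.
  by apply: int_ext => v; rewrite mul0r cos0 !mulr1.
by rewrite !aux.
Qed.

Let int_product_to_sum (m : probR R) (g h k1 k2 k : R -> R) a :
  bounded_measurable h -> bounded_measurable k1 -> bounded_measurable k2 ->
  (forall v, g v * k v = 2^-1 * (k1 v + a * k2 v)) ->
  \int[m]_v (g v * h v * k v) =
  2^-1 * (\int[m]_v (h v * k1 v) + a * \int[m]_v (h v * k2 v)).
Proof.
move=> bh b1 b2 E.
have i1 := bm_integrable m (bmM bh b1); have i2 := bm_integrable m (bmM bh b2).
rewrite -intZ// -intD//; last exact: integrableRZ.
rewrite -intZ//; last by apply: integrableRD => //; exact: integrableRZ.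
by apply: int_ext => v; rewrite mulrAC E; ring.
Qed.

Lemma multiplier_sin eta : multiplier (fun v => sin (eta * v)).
Proof.
split => // h [bh ah]; split; first exact: bmM.
move=> xi; have [c1 s1] := ah (eta + xi); have [c2 s2] := ah (eta - xi).
split.
  rewrite !(int_product_to_sum _ (k1 := fun v => sin ((eta + xi) * v))
    (k2 := fun v => sin ((eta - xi) * v)) (a := 1))// ?s1 ?s2//.
  1,2: by move=> v; rewrite [(eta + xi) * v]mulrDl [(eta - xi) * v]mulrBl sinD sinB; field.
rewrite !(int_product_to_sum _ (k1 := fun v => cos ((eta - xi) * v))
  (k2 := fun v => cos ((eta + xi) * v)) (a := -1))// ?c1 ?c2//.
all: by move=> v; rewrite [(eta + xi) * v]mulrDl [(eta - xi) * v]mulrBl cosB cosD; field.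
Qed.

Lemma multiplier_cos eta : multiplier (fun v => cos (eta * v)).
Proof.
split => // h [bh ah]; split; first exact: bmM.
move=> xi; have [c1 s1] := ah (eta + xi); have [c2 s2] := ah (eta - xi).
split.
  rewrite !(int_product_to_sum _ (k1 := fun v => cos ((eta + xi) * v))
    (k2 := fun v => cos ((eta - xi) * v)) (a := 1))// ?c1 ?c2//.
  1,2: by move=> v; rewrite [(eta + xi) * v]mulrDl [(eta - xi) * v]mulrBl cosD cosB; field.
rewrite !(int_product_to_sum _ (k1 := fun v => sin ((eta + xi) * v))
  (k2 := fun v => sin ((eta - xi) * v)) (a := -1))// ?s1 ?s2//.
all: by move=> v; rewrite [(eta + xi) * v]mulrDl [(eta - xi) * v]mulrBl sinD sinB; field.
Qed.

Lemma multiplier_iter_smoothstep k f : multiplier f ->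
  multiplier (fun v => iter k smoothstep (f v)).
Proof.
move=> mf; elim: k => [//|k IH].
have := multiplierD (multiplierZ (3 / 2) IH)
  (multiplierZ (- 2^-1) (multiplierM IH (multiplierM IH IH))).
by apply: multiplier_ext => v; rewrite iterS /smoothstep; field.
Qed.

Lemma sgr_measurable : measurable_fun setT (@Num.sg R).
Proof.
have E : @Num.sg R =1 fun x => (0 < x)%R%:R - (x < 0)%R%:R.
  move=> x; case: (ltgtP x 0) => [x0|x0|x0].
  - by rewrite ltr0_sg// sub0r.
  - by rewrite gtr0_sg// subr0.
  - by rewrite x0 sgr0 subr0.
have -> : @Num.sg R = fun x => \1_`]0, +oo[%classic x - \1_`]-oo, 0[%classic x.
  apply/funext => x; rewrite E !indicE; congr (_%:R - _%:R); congr nat_of_bool.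
    by apply/idP/idP; rewrite inE/= in_itv/= andbT.
  by apply/idP/idP; rewrite inE/= in_itv/=.
by apply: measurable_funB; apply: measurable_indic.
Qed.

(** On the values -1, 0 and 1 this polynomial is the indicator of 1, which turns
    the limiting square wave into an indicator. *)
Definition up_step (y : R) : R := (y ^+ 2 + y) / 2.

Lemma up_step_sg (x : R) : up_step (Num.sg x) = (0 < x)%R%:R.
Proof.
rewrite /up_step; case: (ltgtP x 0) => [x0|x0|->].
- by rewrite ltr0_sg//=; field.
- by rewrite gtr0_sg//=; field.
- by rewrite sgr0/=; field.
Qed.

Lemma up_step_le1 (y : R) : `|y| <= 1 -> `|up_step y| <= 1.
Proof.
move=> /ler_normlP[y1 y2]; rewrite /up_step.
have h1 : 0 <= (1 - y) * (1 + y) by rewrite mulr_ge0//; lra.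
have h2 := sqr_ge0 y.
have h3 : (1 - y) * (1 + y) = 1 - y ^+ 2 by ring.
by apply/ler_normlP; split; lra.
Qed.

Lemma cvg_up_step (u : nat -> R) l :
  u n @[n --> \oo] --> l -> up_step (u n) @[n --> \oo] --> up_step l.
Proof.
move=> ul; rewrite /up_step; apply: cvgMl; apply: cvgD => //.
by rewrite expr2; under eq_fun do rewrite expr2; exact: cvgM.
Qed.

Lemma norm_iter_smoothstep_le1 k (y : R) : `|y| <= 1 ->
  `|iter k smoothstep y| <= 1.
Proof.
have pos (z : R) : 0 <= z <= 1 -> `|iter k smoothstep z| <= 1.
  move=> z01; have [/andP[a b] _] := iter_smoothstep_bounds k z01.
  by rewrite ger0_norm//; lra.
move=> /ler_normlP[y1 y2]; have [y0|y0] := leP 0 y.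
  by apply: pos; rewrite y0 y2.
by rewrite -normrN -iter_smoothstepN; apply: pos; apply/andP; split; lra.
Qed.

Lemma multiplier_sin_shift eta a : multiplier (fun v => sin (eta * (v - a))).
Proof.
have := multiplierD (multiplierZ (cos (eta * a)) (multiplier_sin eta))
  (multiplierZ (- sin (eta * a)) (multiplier_cos eta)).
by apply: multiplier_ext => v; rewrite mulrBr sinB; ring.
Qed.

Lemma int_step_sin n a :
  \int[m1]_v (0 < sin (n.+1%:R^-1 * (v - a)))%R%:R =
  \int[m2]_v (0 < sin (n.+1%:R^-1 * (v - a)))%R%:R :> R.
Proof.
pose w v := sin (n.+1%:R^-1 * (v - a)).
have mw : measurable_fun setT w by case: (multiplier_sin_shift n.+1%:R^-1 a) => -[].
have mk k := multiplier_iter_smoothstep k (multiplier_sin_shift n.+1%:R^-1 a).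
have mu k : multiplier (fun v => up_step (iter k smoothstep (w v))).
  have := multiplierZ 2^-1 (multiplierD (multiplierM (mk k) (mk k)) (mk k)).
  by apply: multiplier_ext => v; rewrite /up_step /w; field.
have aux (m : probR R) :
    \int[m]_v up_step (iter k smoothstep (w v)) @[k --> \oo] -->
    (\int[m]_v (0 < w v)%R%:R : R).
  under int_ext do rewrite -up_step_sg.
  apply: (int_bounded_cvg (M := 1)).
  - by move=> k; case: (mu k) => -[].
  - move=> v; apply/cvg_up_step/cvg_iter_smoothstep; exact: norm_sin_le1.
  - move=> k v; apply/up_step_le1/norm_iter_smoothstep_le1; exact: norm_sin_le1.
have := aux m2; under eq_fun do rewrite -(multiplier_int (mu _)).
exact/(cvg_unique _ (aux m1)).
Qed.

(** For a large period the sine is positive at a given [v] if and only if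
    [v - a] is. *)
Lemma int_step a : \int[m1]_v (0 < v - a)%R%:R = \int[m2]_v (0 < v - a)%R%:R :> R.
Proof.
have aux (m : probR R) :
    \int[m]_v (0 < sin (n.+1%:R^-1 * (v - a)))%R%:R @[n --> \oo] -->
    (\int[m]_v (0 < v - a)%R%:R : R).
  apply: (int_bounded_cvg (M := 1)).
  - move=> n; under eq_fun do rewrite -up_step_sg.
    have ms : measurable_fun setT
        (fun v : R => Num.sg (sin (n.+1%:R^-1 * (v - a)))).
      apply: measurableT_comp; first exact: sgr_measurable.
      by case: (multiplier_sin_shift n.+1%:R^-1 a) => -[].
    rewrite /up_step; apply: measurable_funM => //; apply: measurable_funD => //.
    exact: measurable_funX.
  - move=> v; apply: cvg_near_cst.
    near=> n.
    have hn : `|n.+1%:R^-1 * (v - a)| < pi.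
      rewrite normrM ger0_norm ?invr_ge0// mulrC ltr_pdivrMr//.
      rewrite mulrC -ltr_pdivrMr ?pi_gt0//.
      apply: lt_trans (_ : n%:R < _); last by rewrite ltr_nat.
      near: n; exact: nbhs_infty_gtr.
    move: hn; set x := _ * (v - a) => hx.
    have -> : (0 < v - a) = (0 < x) by rewrite /x pmulr_rgt0 ?invr_gt0.
    congr (_%:R); case: (ltgtP x 0) => x0.
    + have : 0 < sin (- x).
        by rewrite sin_gt0_pi//; move: hx; rewrite ltr0_norm// oppr_gt0 x0.
      by rewrite sinN oppr_gt0 => /ltW; rewrite leNgt => /negbTE ->.
    + by rewrite sin_gt0_pi// x0/=; move: hx; rewrite gtr0_norm.
    + by rewrite x0 sin0 ltxx.
  - by move=> n v; case: (_ < _); rewrite ?normr1 ?normr0.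
have := aux m2; under eq_fun do rewrite -(int_step_sin _).
exact/(cvg_unique _ (aux m1)).
Unshelve. all: by end_near.
Qed.

Lemma int_ray (m : probR R) a :
  (\int[m]_v (0 < v - a)%R%:R : R) = fine (m `]a, +oo[%classic).
Proof.
rewrite /Rintegral; congr fine.
rewrite -[in RHS](setIT `]a, +oo[%classic) -integral_indic//.
apply: eq_integral => v _; rewrite indicE subr_gt0; congr (_%:R%:E).
by congr nat_of_bool; apply/idP/idP; rewrite inE/= in_itv/= andbT.
Qed.

Lemma transforms_determine (A : set (measurableTypeR R)) : measurable A ->
  m1 A = m2 A.
Proof.
pose G := [set B : set R | exists x, B = `]x, +oo[%classic].
have := @measure_unique _ R (measurableTypeR R) G
  (fun n => `](- n%:R), +oo[%classic).
apply.
- exact: RGenOInfty.measurableE.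
- move=> B C [x ->] [y ->]; exists (Num.max x y).
  apply/seteqP; split => z /=; rewrite !in_itv/= !andbT gt_max.
    by case=> -> ->.
  by move=> /andP[].
- by move=> i; exists (- i%:R).
- rewrite -subTset => z _; exists (Num.bound z) => //=.
  by rewrite in_itv/= andbT ltrNl unstable.ltrNbound.
- move=> B [x ->]; have := int_step x; rewrite !int_ray => E.
  by rewrite -[LHS]fineK ?fin_num_measure// E fineK ?fin_num_measure.
- by move=> k; apply: le_lt_trans (probability_le1 m1 _) _; rewrite ?ltry.
Qed.

End equal_transforms.

(** The trigonometric polynomials form an algebra: iterating a cubic on
    [sin ((v - a) / n)] produces in the limit the square wave
    [sg (sin ((v - a) / n))], and letting the period grow produces the indicator
    of a half-line; both limits are dominated. *)
Theorem fourier_inj (m1 m2 : probR R) :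
  (forall xi, fourier m1 xi = fourier m2 xi) ->
  forall A : set (measurableTypeR R), measurable A -> m1 A = m2 A.
Proof.
move=> E; apply: transforms_determine => xi.
  by have := E xi; rewrite !fourierE => -[].
by have := E xi; rewrite !fourierE => -[].
Qed.

End fourier_uniqueness.

(** * Countable mixtures of probability measures *)

Section mixtures.
Context (R : realType) d (T : measurableType d).
Implicit Types (w : nat -> R) (m : nat -> probability T R).

Definition weights w := (forall n, 0 <= w n) /\ series w n @[n --> \oo] --> (1 : R).

Lemma ge0_nneseries_cvg (a : nat -> R) l : (forall n, 0 <= a n) ->
  series a n @[n --> \oo] --> l ->
  (\sum_(0 <= n <oo) (a n)%:E = l%:E)%E.
Proof.
move=> a0 al; apply/cvg_lim => //.
under eq_fun do rewrite sumEFin.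
by apply: cvg_EFin => //; exact: nearW.
Qed.

(** The absolute values make the scaled sum a measure for every [w] and the
    normalization makes it a probability; for weights neither changes it. *)
Fact mixture_subproof : {mix : (nat -> R) -> (nat -> probability T R) ->
    probability T R | forall w m, weights w -> forall A, measurable A ->
  (mix w m A = \sum_(0 <= n <oo) (w n)%:E * m n A)%E}.
Proof.
pose s w m : {measure set T -> \bar R} :=
  mseries (fun n => mscale (NngNum (normr_ge0 (w n))) (m n)) 0.
exists (fun w m => mnormalize (s w m) (m 0%N)) => w m [w0 w1] A mA.
have E (B : set T) : (s w m B = \sum_(0 <= n <oo) (w n)%:E * m n B)%E.
  apply: eq_eseriesr => n _; rewrite /mscale; congr (_%:E * _)%E.
  exact: ger0_norm.
have s1 : s w m setT = 1%E.
  rewrite E -(ge0_nneseries_cvg w0 w1); apply: eq_eseriesr => n _.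
  by rewrite [X in (_ * X)%E](_ : _ = 1%E) ?mule1//; exact: probability_setT.
change (@mnormalize _ _ _ (s w m) (m 0%N) A =
  \sum_(0 <= n <oo) (w n)%:E * m n A)%E.
by rewrite /mnormalize s1 /= eqe oner_eq0 /= invr1 mule1 E.
Qed.

Definition mixture := sval mixture_subproof.

Lemma mixtureE w m : weights w -> forall A, measurable A ->
  (mixture w m A = \sum_(0 <= n <oo) (w n)%:E * m n A)%E.
Proof. exact: (svalP mixture_subproof). Qed.

Lemma ge0_mixture_integral w m (f : T -> \bar R) : weights w ->
  measurable_fun setT f -> (forall x, 0 <= f x)%E ->
  (\int[mixture w m]_x f x = \sum_(0 <= n <oo) (w n)%:E * \int[m n]_x f x)%E.
Proof.
move=> hw mf f0; have [w0 _] := hw.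
pose s := mseries (fun n => mscale (NngNum (normr_ge0 (w n))) (m n)) 0.
rewrite (@eq_measure_integral _ _ _ _ s); last first.
  move=> A mA _; apply: etrans (mixtureE m hw mA) _; apply: eq_eseriesr => n _.
  by rewrite /mscale; congr (_%:E * _)%E; exact/esym/ger0_norm.
rewrite ge0_integral_measure_series//; apply: eq_eseriesr => n _.
by rewrite ge0_integral_mscale//; congr (_%:E * _)%E; exact: ger0_norm.
Qed.

Let ge0_mixture_int w m (f : T -> R) M : weights w ->
  (forall x, 0 <= f x) -> (forall n, integrableR (m n) f) ->
  (forall N, \sum_(n < N) w n * \int[m n]_x f x <= M) ->
  integrableR (mixture w m) f /\
  \sum_(n < N) w n * \int[m n]_x f x @[N --> \oo] --> \int[mixture w m]_x f x.
Proof.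
move=> hw f0 fi fM; have mf := integrableR_measurable (fi 0%N).
have w0 n : 0 <= w n by case: hw.
pose a n := w n * \int[m n]_x f x.
have a0 n : 0 <= a n by rewrite mulr_ge0// Rintegral_ge0.
have sa : cvgn (series a).
  apply: nondecreasing_is_cvgn.
    by apply/nondecreasing_seqP => n; rewrite /series/= big_nat_recr//= lerDl.
  by exists M => _ [n _ <-]; rewrite /series/= big_mkord.
have E : (\int[mixture w m]_x (f x)%:E = (limn (series a))%:E)%E.
  rewrite ge0_mixture_integral//; last exact/measurable_EFinP.
  rewrite -(ge0_nneseries_cvg a0 sa); apply: eq_eseriesr => n _.
  by rewrite /a EFinM EFin_int.
split; first by apply: ge0_integrableR => //; rewrite E ltry.
rewrite /Rintegral E /=; move: sa; rewrite /series/= /a.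
by under eq_fun do rewrite big_mkord.
Qed.

(** The signed case follows from the nonnegative one applied to [`|f| + f] and to
    [`|f|], whose partial sums are bounded by [M + M] and [M]. *)
Lemma mixture_int w m (f : T -> R) M : weights w ->
  (forall n, integrableR (m n) f) ->
  (forall N, \sum_(n < N) w n * \int[m n]_x `|f x| <= M) ->
  integrableR (mixture w m) f /\
  \sum_(n < N) w n * \int[m n]_x f x @[N --> \oo] --> \int[mixture w m]_x f x.
Proof.
move=> hw fi fM.
have afi n : integrableR (m n) (fun x => `|f x|) by exact: integrableR_norm.
have w0 n : 0 <= w n by case: hw.
have [ia ca] := ge0_mixture_int hw (fun x => normr_ge0 (f x)) afi fM.
pose g x := `|f x| + f x.
have gi n : integrableR (m n) g by exact: integrableRD.
have g0 x : 0 <= g x by rewrite /g -lerBlDr sub0r -normrN ler_norm.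
have gM N : \sum_(n < N) w n * \int[m n]_x g x <= M + M.
  apply: le_trans (lerD (fM N) (fM N)); rewrite -big_split/=.
  apply: ler_sum => n _; rewrite -mulrDr; apply: ler_wpM2l => //.
  rewrite intD//; apply: lerD => //; apply: int_le => // x; exact: ler_norm.
have [ig cg] := ge0_mixture_int hw g0 gi gM.
have fE : f = fun x => g x - `|f x| by apply/funext => x; rewrite /g addrAC subrr add0r.
have iff : integrableR (mixture w m) f by rewrite fE; exact: integrableRB.
split => //.
have -> : \int[mixture w m]_x f x =
    \int[mixture w m]_x g x - \int[mixture w m]_x `|f x|.
  by rewrite -intB//; apply: int_ext => x; rewrite {1}fE.
rewrite (_ : (fun N => _) = (fun N => \sum_(n < N) w n * \int[m n]_x g x -
    \sum_(n < N) w n * \int[m n]_x `|f x|)); first exact: cvgB.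
apply/funext => N; rewrite -sumrB; apply: eq_bigr => n _.
by rewrite -mulrBr -intB//; congr (_ * _); apply: int_ext => x; rewrite {1}fE.
Qed.

Lemma bm_mixture_cvg w m (f : T -> R) : weights w -> bounded_measurable f ->
  \sum_(n < N) w n * \int[m n]_x f x @[N --> \oo] --> \int[mixture w m]_x f x.
Proof.
move=> hw bf; have [mf [M fM]] := bf.
have [w0 w1] := hw.
have fi n := bm_integrable (m n) bf.
have M0 : 0 <= M by apply: le_trans (fM point).
have sw N : \sum_(n < N) w n <= 1.
  rewrite -(cvg_lim _ w1)// -[leLHS](big_mkord xpredT w).
  apply: (@nondecreasing_cvgn_le _ (series w)); last by apply/cvg_ex; exists 1.
  by apply/nondecreasing_seqP => n; rewrite /series/= big_nat_recr//= lerDl.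
apply: (mixture_int (M := M) hw fi _).2 => N.
apply: le_trans (_ : \sum_(n < N) w n * M <= _); last first.
  by rewrite -mulr_suml ler_piMl.
apply: ler_sum => n _; apply: ler_wpM2l => //.
apply: le_trans (ler_norm _) _; apply: int_norm_bound.
  by apply: measurableT_comp => //; exact: normr_measurable.
by move=> x; rewrite normr_id.
Qed.

Definition average n m : probability T R :=
  mixture (fun j => if (j < n)%N then n%:R^-1 else 0) m.

Lemma weights_average n : (0 < n)%N ->
  weights (fun j => if (j < n)%N then n%:R^-1 else 0).
Proof.
move=> n0; split; first by move=> j; case: ifP => //; rewrite invr_ge0.
apply: cvg_near_cst; near=> N.
have nN : (n <= N)%N by near: N; exact: nbhs_infty_ge.
rewrite /series/= (big_cat_nat _ nN)//= big_nat_cond.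
rewrite (eq_bigr (fun=> n%:R^-1)); last first.
  by move=> i /andP[/andP[_ ->]].
rewrite -big_nat_cond sumr_const_nat subn0 -[_ *+ n]mulr_natr mulVf ?pnatr_eq0 -?lt0n//.
rewrite big_nat_cond big1 ?addr0// => i /andP[/andP[ni _] _].
by rewrite ltnNge ni.
Unshelve. all: by end_near.
Qed.

Lemma average_int n m (f : T -> R) : (forall j, integrableR (m j) f) ->
  integrableR (average n.+1 m) f /\
  n.+1%:R * \int[average n.+1 m]_x f x = \sum_(j < n.+1) \int[m j]_x f x.
Proof.
move=> fi; have hw := @weights_average n.+1 isT.
have cut (F : nat -> R) N : (n < N)%N ->
    \sum_(j < N) (if (j < n.+1)%N then n.+1%:R^-1 else 0) * F j =
    n.+1%:R^-1 * \sum_(j < n.+1) F j.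
  move=> nN; rewrite (big_ord_widen N F)//.
  rewrite big_distrr/= [RHS]big_mkcond/=; apply: eq_bigr => j _.
  by case: ifP => //; rewrite mul0r.
have [|iff cf] := @mixture_int _ m f
  (n.+1%:R^-1 * \sum_(j < n.+1) \int[m j]_x `|f x|) hw fi; last first.
  split => //; rewrite (_ : \int[_]_x f x =
      n.+1%:R^-1 * \sum_(j < n.+1) \int[m j]_x f x).
    by rewrite mulrA mulfV ?mul1r ?pnatr_eq0.
  apply: (cvg_unique _ cf) => //; apply: cvg_near_cst; near=> N.
  rewrite (cut (fun j => \int[m j]_x f x))//.
  by near: N; exact: nbhs_infty_gt.
move=> N; have [nN|nN] := ltnP n N; first by rewrite (cut (fun j => \int[m j]_x `|f x|)).
rewrite -(cut (fun j => \int[m j]_x `|f x|) n.+1)//.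
rewrite (big_ord_widen n.+1 (fun j => (if (j < n.+1)%N then n.+1%:R^-1 else 0) *
  \int[m j]_x `|f x|)); last by rewrite ltnW.
rewrite big_mkcond/=; apply: ler_sum => j _.
have: 0 <= (if (j < n.+1)%N then n.+1%:R^-1 else 0) * \int[m j]_x `|f x|.
  rewrite mulr_ge0//; last exact: Rintegral_ge0.
  by case: ifP => //; rewrite invr_ge0.
by case: (j < N)%N.
Unshelve. all: by end_near.
Qed.

End mixtures.

(** * Wild sums *)

Section wild_sums.
Context (R : realType) dO (Omega : measurableType dO) (P : probability Omega R).
Context d (T : measurableType d).
Variable op : {mfun (Omega * (T * T))%type >-> T}.
Implicit Types m : probability T R.

Definition joint_law m m' : probability (Omega * (T * T))%type R :=
  (P \x (m \x m'))%E.

(** The gain operator is characterized by its values on measurable sets instead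
    of being unfolded: the terms of a Wild sum nest product measures, and only
    their integrals matter. *)
Fact gain_subproof : {g : probability T R -> probability T R ->
    probability T R | forall m m' A, measurable A ->
  g m m' A = distribution (joint_law m m') op A}.
Proof. by exists (fun m m' => distribution (joint_law m m') op). Qed.

Definition gain := sval gain_subproof.

Lemma gain_integral m m' (f : T -> \bar R) :
  (\int[gain m m']_x f x = \int[distribution (joint_law m m') op]_x f x)%E.
Proof.
apply: eq_measure_integral => A mA _.
exact: (svalP gain_subproof).
Qed.

Lemma gain_int m m' (f : T -> R) : measurable_fun setT f ->
  integrableR (joint_law m m') (fun x => f (op x)) ->
  integrableR (gain m m') f /\
  \int[gain m m']_x f x = \int[joint_law m m']_x f (op x).
Proof.
move=> mf fi; have iff := integrableR_image mf fi; split.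
  apply/integrableP; split; first exact/measurable_EFinP.
  by rewrite gain_integral; case/integrableP: iff.
by rewrite /Rintegral gain_integral -[RHS](int_image mf fi).
Qed.

Variable m0 : probability T R.

(** The recursion is on a bound [k] for the rank, because the terms of rank [n.+1]
    call all smaller ranks; [minn j n'] keeps the index in range beyond the
    [n] terms that the average retains. *)
Fixpoint wild_upto k n : probability T R :=
  match k, n with
  | k'.+1, n'.+1 => average n (fun j =>
      gain (wild_upto k' (minn j n')) (wild_upto k' (n' - j)%N))
  | _, _ => m0
  end.

Definition wild n := wild_upto n n.

Lemma wild_upto_stable k n : (n <= k)%N -> wild_upto k n = wild n.
Proof.
rewrite /wild; have [N] := ubnP n; elim: N n k => // N IH [|n] k.
  by case: k.
rewrite ltnS => nN; case: k => [//|k]; rewrite ltnS => nk /=.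
congr (average _ _); apply/funext => j.
have h1 : (minn j n <= n)%N by rewrite geq_minr.
have h2 : (n - j <= n)%N by rewrite leq_subr.
have e k' i : (i <= n)%N -> (n <= k')%N ->
    wild_upto k' i = wild_upto i i.
  by move=> i_n n_k; apply: IH; [exact: leq_ltn_trans nN|exact: leq_trans n_k].
by rewrite (e k _ h1 nk) (e k _ h2 nk) (e n _ h1 (leqnn n)) (e n _ h2 (leqnn n)).
Qed.

Lemma wild0 : wild 0 = m0. Proof. by []. Qed.

Lemma wildS n :
  wild n.+1 = average n.+1 (fun j => gain (wild (minn j n)) (wild (n - j)%N)).
Proof.
rewrite /wild /=; congr (average _ _); apply/funext => j.
by congr gain; apply: wild_upto_stable; rewrite ?geq_minr ?leq_subr.
Qed.

Lemma wildS_int n (f : T -> R) :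
  (forall i j, (i <= n)%N -> (j <= n)%N ->
    integrableR (gain (wild i) (wild j)) f) ->
  integrableR (wild n.+1) f /\
  n.+1%:R * \int[wild n.+1]_x f x =
    \sum_(j < n.+1) \int[gain (wild j) (wild (n - j)%N)]_x f x.
Proof.
move=> fi; rewrite wildS.
have [|iw ->] := @average_int _ _ _ n
  (fun j => gain (wild (minn j n)) (wild (n - j)%N)) f.
  by move=> j; apply: fi; rewrite ?geq_minr ?leq_subr.
split => //; apply: eq_bigr => j _.
by rewrite (minn_idPl _)// -ltnS.
Qed.

Definition wild_weight (t : R) n := expR (- t) * (1 - expR (- t)) ^+ n.

Definition wild_sum t := mixture (wild_weight t) wild.

Lemma wild_rate (t : R) : 0 <= t -> 0 <= 1 - expR (- t) < 1.
Proof.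
move=> t0; have := expR_gt0 (- t); have : expR (- t) <= 1.
  by rewrite expR_le1 oppr_le0.
by move=> a b; apply/andP; split; lra.
Qed.

Lemma weights_wild t : 0 <= t -> weights (wild_weight t).
Proof.
move=> t0; have /andP[u0 u1] := wild_rate t0.
split; first by move=> n; rewrite mulr_ge0 ?exprn_ge0 ?expR_ge0.
have := @cvg_geometric_series R (expR (- t)) (1 - expR (- t)).
rewrite ger0_norm// => /(_ u1).
rewrite opprB addrCA subrr addr0 mulfV; last by rewrite gt_eqF ?expR_gt0.
by [].
Qed.

End wild_sums.

(** * Moduli of complex expectations *)

Section complex_moduli.
Context (R : realType).
Local Open Scope complex_scope.
Local Notation Re := complex.Re.
Local Notation Im := complex.Im.
Local Notation normc := (@Normc.normc R).
Implicit Types z : R[i].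

Lemma normcE z : normc z = Num.sqrt (Re z ^+ 2 + Im z ^+ 2).
Proof. by case: z. Qed.

Lemma normc_ge0 z : 0 <= normc z.
Proof. by rewrite normcE sqrtr_ge0. Qed.

Lemma rotated_part_le a b z : a ^+ 2 + b ^+ 2 = 1 ->
  a * Re z + b * Im z <= normc z.
Proof.
move=> ab; rewrite normcE.
apply: le_trans (ler_norm _) _; rewrite -sqrtr_sqr ler_sqrt ?addr_ge0 ?sqr_ge0//.
set x := Re z; set y := Im z; rewrite -subr_ge0.
suff -> : x ^+ 2 + y ^+ 2 - (a * x + b * y) ^+ 2 = (a * y - b * x) ^+ 2.
  exact: sqr_ge0.
have -> : x ^+ 2 + y ^+ 2 = (a ^+ 2 + b ^+ 2) * (x ^+ 2 + y ^+ 2).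
  by rewrite ab mul1r.
ring.
Qed.

(** A modulus is the largest real part over all rotations: this linearizes
    the modulus, so that bounds pass through integrals and derivatives. *)
Lemma normc_le_rotated z B : 0 <= B ->
  (forall a b, a ^+ 2 + b ^+ 2 = 1 -> a * Re z + b * Im z <= B) -> normc z <= B.
Proof.
move=> B0 h; have [->//|n0] := eqVneq (normc z) 0.
have E : normc z ^+ 2 = Re z ^+ 2 + Im z ^+ 2.
  by rewrite normcE sqr_sqrtr// addr_ge0// sqr_ge0.
have := h (Re z / normc z) (Im z / normc z).
rewrite !expr_div_n -mulrDl -E divff ?expf_neq0// => /(_ erefl).
by rewrite mulrAC [X in _ + X]mulrAC -mulrDl -!expr2 -E expr2 mulfK.
Qed.

Lemma normcR (x : R) : 0 <= x -> normc x%:C = x.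
Proof. by move=> x0; rewrite normcE /= expr0n addr0 sqrtr_sqr ger0_norm. Qed.

Lemma normc_sum (I : Type) (r : seq I) (F : I -> R[i]) :
  normc (\sum_(i <- r) F i) <= \sum_(i <- r) normc (F i).
Proof.
elim: r => [|i r IH]; first by rewrite !big_nil Normc.normc0.
rewrite !big_cons; apply: le_trans (le_normcD _ _) _; exact: lerD.
Qed.

Section complex_expectation.
Context d (T : measurableType d) (m : probability T R).
Implicit Types F G : T -> R[i].

Definition cbounded F :=
  bounded_measurable (fun x => Re (F x)) /\
  bounded_measurable (fun x => Im (F x)).

Lemma cboundedM F G : cbounded F -> cbounded G -> cbounded (fun x => F x * G x).
Proof.
move=> [F1 F2] [G1 G2]; split.
  rewrite (_ : (fun x => _) = (fun x => Re (F x) * Re (G x) - Im (F x) * Im (G x))).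
    by apply: bmB; exact: bmM.
  by apply/funext => x; case: (F x) => ? ?; case: (G x).
rewrite (_ : (fun x => _) = (fun x => Re (F x) * Im (G x) + Im (F x) * Re (G x))).
  by apply: bmD; exact: bmM.
by apply/funext => x; case: (F x) => ? ?; case: (G x).
Qed.

Lemma cboundedD F G : cbounded F -> cbounded G -> cbounded (fun x => F x + G x).
Proof.
move=> [F1 F2] [G1 G2]; split.
  rewrite (_ : (fun x => _) = (fun x => Re (F x) + Re (G x))); first exact: bmD.
  by apply/funext => x; case: (F x) => ? ?; case: (G x).
rewrite (_ : (fun x => _) = (fun x => Im (F x) + Im (G x))); first exact: bmD.
by apply/funext => x; case: (F x) => ? ?; case: (G x).
Qed.

Lemma cboundedB F G : cbounded F -> cbounded G -> cbounded (fun x => F x - G x).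
Proof.
move=> [F1 F2] [G1 G2]; split.
  rewrite (_ : (fun x => _) = (fun x => Re (F x) - Re (G x))); first exact: bmB.
  by apply/funext => x; case: (F x) => ? ?; case: (G x).
rewrite (_ : (fun x => _) = (fun x => Im (F x) - Im (G x))); first exact: bmB.
by apply/funext => x; case: (F x) => ? ?; case: (G x).
Qed.

Lemma cbounded_cst z : cbounded (fun=> z).
Proof. by split; exact: bm_cst. Qed.

Lemma cintegralD F G : cbounded F -> cbounded G ->
  cintegral m setT (fun x => F x + G x) =
  cintegral m setT F + cintegral m setT G.
Proof.
move=> [F1 F2] [G1 G2]; rewrite /cintegral.
have -> : \int[m]_x Re (F x + G x) = \int[m]_x Re (F x) + \int[m]_x Re (G x).
  rewrite -intD; [|exact: bm_integrable..].
  by apply: int_ext => x; case: (F x) => ? ?; case: (G x).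
have -> // : \int[m]_x Im (F x + G x) = \int[m]_x Im (F x) + \int[m]_x Im (G x).
rewrite -intD; [|exact: bm_integrable..].
by apply: int_ext => x; case: (F x) => ? ?; case: (G x).
Qed.

Lemma cintegralB F G : cbounded F -> cbounded G ->
  cintegral m setT (fun x => F x - G x) =
  cintegral m setT F - cintegral m setT G.
Proof.
move=> bF bG; rewrite -[LHS](addrK (cintegral m setT G)).
rewrite -cintegralD//; last exact: cboundedB.
by congr (cintegral _ _ _ - _); apply/funext => x; rewrite subrK.
Qed.

Lemma cintegralZ (a : R) F : cbounded F ->
  cintegral m setT (fun x => a%:C * F x) = a%:C * cintegral m setT F.
Proof.
move=> [F1 F2]; rewrite /cintegral /=; apply/eqP; rewrite eq_complex /=.
rewrite !mul0r subr0 addr0 -!intZ; [|exact: bm_integrable..].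
by apply/andP; split; apply/eqP; apply: int_ext => x; case: (F x) => ? ? /=;
  rewrite !mul0r ?subr0 ?addr0.
Qed.

Lemma cintegral0 : cintegral m setT (fun=> 0) = 0.
Proof. by rewrite /cintegral !int_cst. Qed.

Lemma cbounded_sum N (F : nat -> T -> R[i]) : (forall i, cbounded (F i)) ->
  cbounded (fun x => \sum_(i < N) F i x).
Proof.
move=> h; elim: N => [|N IH].
  by under eq_fun do rewrite big_ord0; exact: cbounded_cst.
by under eq_fun do rewrite big_ord_recr; exact: cboundedD.
Qed.

Lemma cintegral_sum N (F : nat -> T -> R[i]) : (forall i, cbounded (F i)) ->
  cintegral m setT (fun x => \sum_(i < N) F i x) =
  \sum_(i < N) cintegral m setT (F i).
Proof.
move=> h; elim: N => [|N IH].
  by under eq_fun do rewrite big_ord0; rewrite big_ord0 cintegral0.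
rewrite big_ord_recr /= -IH -cintegralD//; last exact: cbounded_sum.
by under eq_fun do rewrite big_ord_recr.
Qed.

Lemma cintegral_rotated a b F : cbounded F ->
  a * Re (cintegral m setT F) + b * Im (cintegral m setT F) =
  \int[m]_x (a * Re (F x) + b * Im (F x)).
Proof.
move=> [F1 F2]; rewrite intD; [|by apply/bm_integrable/bmZ..].
by rewrite !intZ//; exact: bm_integrable.
Qed.

Lemma normc_cintegral_le F B : cbounded F -> 0 <= B ->
  (forall x, normc (F x) <= B) -> normc (cintegral m setT F) <= B.
Proof.
move=> bF B0 FB; apply: normc_le_rotated => // a b ab.
rewrite cintegral_rotated// -[leRHS](int_cst m); case: bF => F1 F2.
apply: int_le.
- by apply: bm_integrable; apply: bmD; exact: bmZ.
- exact/bm_integrable/bm_cst.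
- by move=> x; apply: le_trans (rotated_part_le _ ab) (FB x).
Qed.

Lemma cintegral_ext F G : F =1 G -> cintegral m setT F = cintegral m setT G.
Proof. by move=> /funext ->. Qed.

End complex_expectation.

End complex_moduli.

(** * Derivatives in time *)

Section calculus_on_the_half_line.
Context (R : realType).

Lemma nonincreasing_from0 (g dg : R -> R) (t : R) : 0 <= t ->
  (forall s : R, 0 < s -> is_derive s 1 g (dg s)) ->
  (forall s : R, 0 < s -> dg s <= 0) ->
  g s @[s --> 0^'+] --> g 0 -> g t <= g 0.
Proof.
rewrite le_eqVlt => /predU1P[<-//|t0] dg' dg0 cg0.
have cg (s : R) : 0 < s -> {for s, continuous g}.
  move=> s0; apply: differentiable_continuous; apply/derivable1_diffP.
  by have [] := dg' _ s0.
have dg1 (s : R) : s \in `]0, t[ -> is_derive s 1 g (dg s).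
  by rewrite in_itv/= => /andP[s0 _]; exact: dg'.
have [|c] := MVT t0 dg1.
- apply/(continuous_within_itvP _ t0); split => //.
  + by move=> s; rewrite in_itv/= => /andP[s0 _]; exact: cg.
  + exact: cvg_at_left_filter (cg _ t0).
- rewrite in_itv/= => /andP[c0 _] E.
  by rewrite -subr_le0 E mulr_le0_ge0 ?dg0// subr0 ltW.
Qed.

Implicit Types f g : R -> R.

Lemma is_derive_lD f g (s df dg : R) :
  is_derive s 1 f df -> is_derive s 1 g dg ->
  is_derive s 1 (fun y => f y + g y) (df + dg).
Proof. by move=> hf hg; exact: is_deriveD. Qed.

Lemma is_derive_lB f g (s df dg : R) :
  is_derive s 1 f df -> is_derive s 1 g dg ->
  is_derive s 1 (fun y => f y - g y) (df - dg).
Proof. by move=> hf hg; exact: is_deriveB. Qed.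

Lemma is_derive_change f (s df df' : R) :
  is_derive s 1 f df -> df = df' -> is_derive s 1 f df'.
Proof. by move=> h <-. Qed.

Lemma is_derive_cvg_at_right f (s df : R) :
  is_derive s 1 f df -> f y @[y --> s^'+] --> f s.
Proof.
move=> [ds _]; have cf : {for s, continuous f}.
  by apply: differentiable_continuous; exact/derivable1_diffP.
exact: cvg_at_right_filter cf.
Qed.

Lemma is_derive_lM f g (s df dg : R) :
  is_derive s 1 f df -> is_derive s 1 g dg ->
  is_derive s 1 (fun y => f y * g y) (df * g s + f s * dg).
Proof.
move=> hf hg; apply: (is_derive_change (is_deriveM hf hg)).
by rewrite /GRing.scale/= addrC mulrC.
Qed.

Lemma is_derive_lcst (a s : R) : is_derive s 1 (fun=> a) 0.
Proof. exact: is_derive_cst. Qed.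

Lemma is_derive_lZ a f (s df : R) :
  is_derive s 1 f df -> is_derive s 1 (fun y => a * f y) (a * df).
Proof.
move=> hf; apply: (is_derive_change (is_derive_lM (is_derive_lcst a s) hf)).
by rewrite mul0r add0r.
Qed.

Lemma is_derive_lexp (a s : R) :
  is_derive s 1 (fun y => expR (a * y)) (a * expR (a * s)).
Proof.
have h := is_derive_lZ a (is_derive_id s (1 : R)).
apply: (is_derive_change (is_derive1_comp (is_derive_expR (a * s)) h)).
by rewrite mulr1 mulrC.
Qed.

Lemma is_derive_expN (s : R) :
  is_derive s 1 (fun y => expR (- y)) (- expR (- s)).
Proof.
have -> : (fun y : R => expR (- y)) = (fun y => expR (-1 * y)).
  by apply/funext => y; rewrite mulN1r.
by apply: (is_derive_change (is_derive_lexp (-1) s)); rewrite !mulN1r.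
Qed.

Lemma is_derive_rate_exp (n : nat) (s : R) :
  is_derive s 1 (fun s => (1 - expR (- s)) ^+ n)
    (n%:R * (1 - expR (- s)) ^+ n.-1 * expR (- s)).
Proof.
have d1 : is_derive s 1 (fun s : R => 1 - expR (- s)) (expR (- s)).
  apply: (is_derive_change (is_derive_lB (is_derive_lcst 1 s) (is_derive_expN s))).
  by rewrite sub0r opprK.
elim: n => [|n IH].
  by rewrite !mul0r; under eq_fun do rewrite expr0; exact: is_derive_lcst.
under eq_fun do rewrite exprS.
apply: (is_derive_change (is_derive_lM d1 IH)).
case: n IH => [|n] _ /=; first by rewrite !expr0; ring.
by rewrite exprS -[n.+2%:R]natr1; ring.
Qed.

Lemma is_derive_rate_series N (q : nat -> R) (s : R) :
  is_derive s 1 (fun s => \sum_(n < N) (1 - expR (- s)) ^+ n * q n)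
    (expR (- s) * \sum_(n < N.-1) n.+1%:R * (1 - expR (- s)) ^+ n * q n.+1).
Proof.
elim: N => [|N IH].
  under eq_fun do rewrite big_ord0.
  by rewrite big_ord0 mulr0; exact: is_derive_lcst.
under eq_fun do rewrite big_ord_recr/=.
have dN : is_derive s 1 (fun s => (1 - expR (- s)) ^+ N * q N)
    (N%:R * (1 - expR (- s)) ^+ N.-1 * expR (- s) * q N).
  apply: (is_derive_change
    (is_derive_lM (is_derive_rate_exp N s) (is_derive_lcst (q N) s))).
  by rewrite mulr0 addr0.
apply: (is_derive_change (is_derive_lD IH dN)).
case: N {IH dN} => [|N] /=; first by rewrite big_ord0 !mul0r mulr0 addr0.
by rewrite [in RHS]big_ord_recr/= mulrDr; congr (_ + _); ring.
Qed.

End calculus_on_the_half_line.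

(** * Transforms of Wild sums *)

(** The addition theorems of the cosine and of the sine have this bilinear form,
    in which the independence of the two arguments factors the integral. *)
Lemma gain_int_bilinear (R : realType) dO (Omega : measurableType dO)
    (P : probability Omega R) d (T : measurableType d)
    (op : {mfun (Omega * (T * T))%type >-> T}) (m m' : probability T R)
    (f : T -> R) (g h g' h' : Omega -> T -> R) :
  bounded_measurable f ->
  (forall w, bounded_measurable (g w) /\ bounded_measurable (h w)) ->
  (forall w, bounded_measurable (g' w) /\ bounded_measurable (h' w)) ->
  (forall w x y, f (op (w, (x, y))) = g w x * h w y + g' w x * h' w y) ->
  \int[gain P op m m']_z f z =
  \int[P]_w (\int[m]_x g w x * \int[m']_y h w y +
             \int[m]_x g' w x * \int[m']_y h' w y).
Proof.
move=> bf bg bg' fE.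
have bfo : bounded_measurable (fun x => f (op x)) by exact: bm_comp.
rewrite (gain_int bf.1 (bm_integrable _ bfo)).2 (int_fubini P (m \x m')%E bfo).
apply: int_ext => w; have [b1 b2] := bg w; have [b3 b4] := bg' w.
transitivity (\int[(m \x m')%E]_y (g w y.1 * h w y.2 + g' w y.1 * h' w y.2)).
  by apply: eq_Rintegral => -[x y] _; exact: fE.
have i n k (bk : bounded_measurable k) := bm_integrable (n : probability T R) bk.
rewrite (RintegralD measurableT (integrableR_prod (i m _ b1) (i m' _ b2))
  (integrableR_prod (i m _ b3) (i m' _ b4))).
by rewrite (int_prod (i m _ b1) (i m' _ b2)) (int_prod (i m _ b3) (i m' _ b4)).
Qed.

Section wild_transform.
Context (R : realType) dO (Omega : measurableType dO) (P : probability Omega R).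
Context d (T : measurableType d).
Variable op : {mfun (Omega * (T * T))%type >-> T}.
Variables (L Rr : Omega -> R) (l : T -> R).
Hypothesis mL : measurable_fun setT L.
Hypothesis mRr : measurable_fun setT Rr.
Hypothesis ml : measurable_fun setT l.
Hypothesis l_op : forall w z z', l (op (w, (z, z'))) = L w * l z + Rr w * l z'.
Local Notation normc := (@Normc.normc R).
Local Notation Re := complex.Re.
Local Notation Im := complex.Im.
Local Open Scope complex_scope.

Definition transform (m : probability T R) (xi : R) : R[i] :=
  (\int[m]_z cos (xi * l z)) +i* (\int[m]_z sin (xi * l z)).

Lemma bm_cosl xi : bounded_measurable (fun z : T => cos (xi * l z)).
Proof. by apply: bm_cos; exact: measurable_funM. Qed.

Lemma bm_sinl xi : bounded_measurable (fun z : T => sin (xi * l z)).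
Proof. by apply: bm_sin; exact: measurable_funM. Qed.

Lemma cbounded_transform m (X : Omega -> R) : measurable_fun setT X ->
  cbounded (fun w => transform m (X w)).
Proof.
move=> mX.
have mXl : measurable_fun setT (fun x : Omega * T => X x.1 * l x.2).
  by apply: measurable_funM; exact: measurableT_comp.
by split; [exact: (bm_fubini P m (bm_cos mXl))|
           exact: (bm_fubini P m (bm_sin mXl))].
Qed.

Lemma normc_transform_le1 m xi : normc (transform m xi) <= 1.
Proof.
apply: normc_le_rotated => // a b ab /=.
have i1 := bm_integrable m (bm_cosl xi).
have i2 := bm_integrable m (bm_sinl xi).
rewrite -!intZ// -intD; [|exact: integrableRZ..].
rewrite -[leRHS](int_cst m); apply: int_le.
- by apply: integrableRD; exact: integrableRZ.
- exact/bm_integrable/bm_cst.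
move=> z; have := @rotated_part_le R a b (cos (xi * l z) +i* sin (xi * l z)) ab.
by rewrite normcE/= cos2Dsin2 sqrtr1.
Qed.

Lemma transform_gain m m' xi : transform (gain P op m m') xi =
  cintegral P setT (fun w => transform m (L w * xi) * transform m' (Rr w * xi)).
Proof.
rewrite /transform /cintegral.
rewrite (gain_int_bilinear (g := fun w z => cos (L w * xi * l z))
  (h := fun w z => cos (Rr w * xi * l z))
  (g' := fun w z => - sin (L w * xi * l z))
  (h' := fun w z => sin (Rr w * xi * l z)) P m m' (bm_cosl xi)); first last.
- by move=> w x y; rewrite l_op mulNr -cosD; congr cos; ring.
- by move=> w; split; [apply: bmN|]; exact: bm_sinl.
- by move=> w; split; exact: bm_cosl.
rewrite (gain_int_bilinear (g := fun w z => cos (L w * xi * l z))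
  (h := fun w z => sin (Rr w * xi * l z))
  (g' := fun w z => sin (L w * xi * l z))
  (h' := fun w z => cos (Rr w * xi * l z)) P m m' (bm_sinl xi)); first last.
- by move=> w x y; rewrite l_op [RHS]addrC -sinD; congr sin; ring.
- by move=> w; split; [exact: bm_sinl|exact: bm_cosl].
- by move=> w; split; [exact: bm_cosl|exact: bm_sinl].
congr (_ +i* _); apply: int_ext => w //=; congr (_ + _).
by under eq_Rintegral do rewrite -mulN1r; rewrite intZ ?mulN1r ?mulNr//;
  apply: bm_integrable; exact: bm_sinl.
Qed.

Lemma transform_wildS m0 n xi :
  n.+1%:R%:C * transform (wild P op m0 n.+1) xi =
  \sum_(j < n.+1) cintegral P setT (fun w =>
    transform (wild P op m0 j) (L w * xi) *
    transform (wild P op m0 (n - j)%N) (Rr w * xi)).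
Proof.
have gi (f : T -> R) : bounded_measurable f ->
    n.+1%:R * \int[wild P op m0 n.+1]_x f x = \sum_(j < n.+1)
      \int[gain P op (wild P op m0 j) (wild P op m0 (n - j)%N)]_x f x.
  by move=> bf; apply: (wildS_int _).2 => i j _ _; exact: bm_integrable.
rewrite (eq_bigr (fun j : 'I_n.+1 => transform
  (gain P op (wild P op m0 j) (wild P op m0 (n - j)%N)) xi)); last first.
  by move=> j _; rewrite transform_gain.
apply/eqP; rewrite eq_complex /= !mul0r subr0 addr0 !gi; first last.
- exact: bm_cosl.
- exact: bm_sinl.
rewrite (raddf_sum (@complex.Re R : R[i] -> R)).
rewrite (raddf_sum (@complex.Im R : R[i] -> R)).
by rewrite !eqxx.
Qed.

Lemma transform_wild_sum m0 t xi : 0 <= t ->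
  (\sum_(n < N) wild_weight t n * Re (transform (wild P op m0 n) xi) @[N --> \oo]
    --> Re (transform (wild_sum P op m0 t) xi)) /\
  (\sum_(n < N) wild_weight t n * Im (transform (wild P op m0 n) xi) @[N --> \oo]
    --> Im (transform (wild_sum P op m0 t) xi)).
Proof.
move=> t0; have hw := weights_wild t0.
by split; apply: bm_mixture_cvg => //; [exact: bm_cosl|exact: bm_sinl].
Qed.

End wild_transform.

(** The Cauchy product of two truncated power series is a triangular sum, not
    the full product: this is why the remainder estimate below compares each
    row with a remainder of lower order. *)
Lemma wild_triangle (C : comPzRingType) (u : C) (a b : nat -> C) M :
  \sum_(n < M) u ^+ n * (\sum_(j < n.+1) a j * b (n - j)%N) =
  \sum_(j < M) u ^+ j * a j * \sum_(n < M - j) u ^+ n * b n.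
Proof.
elim: M => [|M IH]; first by rewrite !big_ord0.
rewrite [LHS]big_ord_recr/= IH.
have E (j : 'I_M.+1) : u ^+ j * a j * \sum_(n < M.+1 - j) u ^+ n * b n =
    u ^+ j * a j * (\sum_(n < M - j) u ^+ n * b n) + u ^+ M * (a j * b (M - j)%N).
  have jM : (j <= M)%N by rewrite -ltnS.
  rewrite subSn// big_ord_recr/= mulrDr; congr (_ + _).
  have -> : u ^+ M = u ^+ j * u ^+ (M - j) by rewrite -exprD subnKC.
  by ring.
under [RHS]eq_bigr do rewrite E.
rewrite big_split/= -mulr_sumr; congr (_ + _).
by rewrite [RHS]big_ord_recr/= subnn big_ord0 mulr0 addr0.
Qed.

(** * Solutions of the kinetic equation are Wild sums *)

Section wild_expansion_of_a_solution.
Context (R : realType) dO (Omega : measurableType dO) (P : probability Omega R).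
Variables (L Rr : Omega -> R).
Local Notation normc := (@Normc.normc R).
Local Notation Re := complex.Re.
Local Notation Im := complex.Im.
Local Open Scope complex_scope.

Variables (f : R -> R -> R[i]) (p : nat -> R -> R[i]).
Hypothesis f_boundedL : forall t xi, cbounded (fun w => f t (L w * xi)).
Hypothesis f_boundedR : forall t xi, cbounded (fun w => f t (Rr w * xi)).
Hypothesis f_le1 : forall t xi, normc (f t xi) <= 1.
Hypothesis p_boundedL : forall n xi, cbounded (fun w => p n (L w * xi)).
Hypothesis p_boundedR : forall n xi, cbounded (fun w => p n (Rr w * xi)).
Hypothesis p_le1 : forall n xi, normc (p n xi) <= 1.
Hypothesis pS : forall n xi, n.+1%:R%:C * p n.+1 xi =
  \sum_(j < n.+1) cintegral P setT
    (fun w => p j (L w * xi) * p (n - j)%N (Rr w * xi)).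
Hypothesis f0 : forall xi, f 0 xi = p 0%N xi.
Hypothesis cvgf0 : forall xi,
  Re (f t xi) @[t --> 0^'+] --> Re (f 0 xi) /\
  Im (f t xi) @[t --> 0^'+] --> Im (f 0 xi).
Let rhs t xi := cintegral P setT (fun w => f t (L w * xi) * f t (Rr w * xi))
  - f t xi.
Hypothesis f_derive : forall t xi : R, 0 < t ->
  is_derive t 1 (fun s : R => Re (f s xi)) (Re (rhs t xi)) /\
  is_derive t 1 (fun s : R => Im (f s xi)) (Im (rhs t xi)).

Let rate (t : R) : R := 1 - expR (- t).
Let G t xi : R[i] := (expR t)%:C * f t xi.
Let S N t xi : R[i] := \sum_(n < N) (rate t ^+ n)%:C * p n xi.

Let rot (a b : R) (z : R[i]) : R := a * Re z + b * Im z.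

Let rotD a b z z' : rot a b (z + z') = rot a b z + rot a b z'.
Proof. by rewrite /rot; case: z => ? ?; case: z' => ? ? /=; ring. Qed.

Let rotN a b z : rot a b (- z) = - rot a b z.
Proof. by rewrite /rot; case: z => ? ? /=; ring. Qed.

Let rotZ a b (x : R) z : rot a b (x%:C * z) = x * rot a b z.
Proof. by rewrite /rot; case: z => ? ? /=; ring. Qed.

Let rot_sum a b N (F : nat -> R[i]) :
  rot a b (\sum_(n < N) F n) = \sum_(n < N) rot a b (F n).
Proof.
elim: N => [|N IH]; first by rewrite !big_ord0 /rot /= !mulr0 addr0.
by rewrite !big_ord_recr/= rotD IH.
Qed.

Let rate_bounds t : 0 <= t -> 0 <= rate t.
Proof. by move=> /wild_rate /andP[]. Qed.

(* Row [j] of the triangle has the defect [u ^ j] times the remainder of order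
   [M - j], that is [u ^ M * exp t] for each row. *)
Let gain_defect M t (x y : R) : 0 <= t ->
  (forall k xi, (k <= M)%N -> normc (G t xi - S k t xi) <= rate t ^+ k * expR t) ->
  normc (G t x * G t y -
    \sum_(n < M) (rate t ^+ n)%:C * \sum_(j < n.+1) p j x * p (n - j)%N y) <=
  expR t * (rate t ^+ M * expR t + M%:R * rate t ^+ M).
Proof.
move=> t0 IH; set u := rate t.
have u0 : 0 <= u := rate_bounds t0.
have -> : \sum_(n < M) (u ^+ n)%:C * (\sum_(j < n.+1) p j x * p (n - j)%N y) =
    \sum_(j < M) (u ^+ j)%:C * p j x * S (M - j) t y.
  rewrite /S -/u.
  have := wild_triangle u%:C (fun j => p j x) (fun j => p j y) M.
  rewrite (eq_bigr (fun n : 'I_M => (u ^+ n)%:C *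
    \sum_(j < n.+1) p j x * p (n - j)%N y)); last by move=> n _; rewrite rmorphXn.
  move=> ->; apply: eq_bigr => j _; rewrite rmorphXn; congr (_ * _).
  by apply: eq_bigr => n _; rewrite rmorphXn.
have -> : G t x * G t y - \sum_(j < M) (u ^+ j)%:C * p j x * S (M - j) t y =
    (G t x - S M t x) * G t y +
    \sum_(j < M) (u ^+ j)%:C * p j x * (G t y - S (M - j) t y).
  rewrite mulrBl -addrA; congr (_ + _).
  under [X in _ = _ + X]eq_bigr do rewrite mulrBr.
  rewrite sumrB -mulr_suml -/u addrA [- _ + _](_ : _ = 0) ?add0r//.
  by rewrite /S -/u addrC subrr.
have nG z : normc (G t z) <= expR t.
  rewrite /G Normc.normcM normcR ?expR_ge0//.
  by rewrite ler_piMr ?expR_ge0.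
apply: le_trans (le_normcD _ _) _; rewrite mulrDr; apply: lerD.
  rewrite Normc.normcM mulrC; apply: ler_pM => //; try exact: normc_ge0.
  exact: IH.
apply: le_trans (normc_sum _ _) _.
apply: le_trans (_ : _ <= \sum_(j < M) u ^+ M * expR t) _; last first.
  by rewrite sumr_const card_ord -[_ *+ M]mulr_natr; lra.
apply: ler_sum => j _.
rewrite !Normc.normcM normcR ?exprn_ge0//.
have jM : (j <= M)%N by rewrite ltnW.
rewrite -[in leRHS](subnKC jM) exprD -mulrA.
rewrite -mulrA ler_wpM2l ?exprn_ge0//.
rewrite -[leRHS]mul1r; apply: ler_pM => //; try exact: normc_ge0.
by apply: IH; rewrite leq_subr.
Qed.

(** With [u = 1 - exp (- t)], the rescaled solution [exp t * f] solves
    [dG/du = E (G (L xi) G (R xi))], so its expansion in powers of [u] has the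
    Wild coefficients.  The remainder of order [N] is bounded by the one of
    [1 / (1 - u)], the solution of the majorant equation [dg/du = g ^ 2]: the
    derivative of the remainder is controlled by the lower remainders, and
    [u ^ N / (1 - u)] is exactly the primitive of the resulting bound. *)
Lemma wild_remainder N t xi : 0 <= t ->
  normc (G t xi - S N t xi) <= rate t ^+ N * expR t.
Proof.
have [M] := ubnP N; elim: M N t xi => // M IHM [|N] t xi.
  move=> _ t0; rewrite /S big_ord0 subr0 expr0 mul1r.
  by rewrite /G Normc.normcM normcR ?expR_ge0// ler_piMr ?expR_ge0.
rewrite ltnS => NM t0.
have IH (s : R) k z : 0 <= s -> (k <= N)%N ->
    normc (G s z - S k s z) <= rate s ^+ k * expR s.
  by move=> s0 kN; apply: IHM => //; exact: leq_ltn_trans NM.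
apply: normc_le_rotated.
  by rewrite mulr_ge0 ?expR_ge0 ?exprn_ge0 ?rate_bounds.
move=> a b ab; rewrite -/(rot a b _) -subr_le0.
pose q n := rot a b (p n xi).
pose g s := expR s * (a * Re (f s xi) + b * Im (f s xi)) -
  \sum_(n < N.+1) (1 - expR (- s)) ^+ n * q n - rate s ^+ N.+1 * expR s.
have gE s : g s = rot a b (G s xi - S N.+1 s xi) - rate s ^+ N.+1 * expR s.
  rewrite /g rotD rotN rotZ; congr (_ - _ - _).
  by rewrite (rot_sum _ _ _ (fun n => (rate s ^+ n)%:C * p n xi));
    apply: eq_bigr => n _; rewrite rotZ.
pose dg s := (expR s * rot a b (f s xi) + expR s * rot a b (rhs s xi) -
  expR (- s) * \sum_(n < N) n.+1%:R * (1 - expR (- s)) ^+ n * q n.+1) -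
  ((N.+1%:R * rate s ^+ N * expR (- s)) * expR s + rate s ^+ N.+1 * expR s).
have g_derive (s : R) : 0 < s -> is_derive s 1 g (dg s).
  move=> s0; have [dR dI] := f_derive xi s0.
  apply: is_derive_lB; last first.
    exact: is_derive_lM (is_derive_rate_exp N.+1 s) (is_derive_expR s).
  apply: is_derive_lB; last exact: is_derive_rate_series.
  have drot := is_derive_lD (is_derive_lZ a dR) (is_derive_lZ b dI).
  exact: is_derive_lM (is_derive_expR s) drot.
rewrite -gE; apply: le_trans (_ : g 0 <= 0); last first.
  rewrite gE /rate oppr0 expR0 subrr expr0n mul0r subr0.
  rewrite /G expR0 mul1r /S big_ord_recl big1 => [|n _]; last first.
    by rewrite /rate oppr0 expR0 subrr expr0n mul0r.
  by rewrite /= expr0 mul1r addr0 f0 subrr /rot/= !mulr0 addr0.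
apply: (nonincreasing_from0 t0 g_derive).
  move=> s s0; have s_ge0 : 0 <= s := ltW s0.
  have es : expR (- s) * expR s = 1 by rewrite -expRD addNr expR0.
  have rhsE : rot a b (rhs s xi) + rot a b (f s xi) =
      rot a b (cintegral P setT (fun w => f s (L w * xi) * f s (Rr w * xi))).
    by rewrite -rotD /rhs subrK.
  pose conv n w := \sum_(j < n.+1) p j (L w * xi) * p (n - j)%N (Rr w * xi).
  pose tri w := \sum_(n < N) (rate s ^+ n)%:C * conv n w.
  pose GG w := G s (L w * xi) * G s (Rr w * xi).
  have bpp n j : cbounded (fun w => p j (L w * xi) * p (n - j)%N (Rr w * xi)).
    exact: cboundedM.
  have bconv n : cbounded (conv n) by exact: cbounded_sum (bpp n).
  have bterm n : cbounded (fun w => (rate s ^+ n)%:C * conv n w).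
    by apply: cboundedM => //; exact: cbounded_cst.
  have btri : cbounded tri by exact: cbounded_sum bterm.
  have bGG : cbounded GG.
    by apply: cboundedM; apply: cboundedM => //; exact: cbounded_cst.
  have triE : \sum_(n < N) n.+1%:R * (1 - expR (- s)) ^+ n * q n.+1 =
      rot a b (cintegral P setT tri).
    rewrite (cintegral_sum P N bterm).
    rewrite (rot_sum _ _ _ (fun n => cintegral P setT
      (fun w => (rate s ^+ n)%:C * conv n w))).
    apply: eq_bigr => n _; rewrite cintegralZ// rotZ.
    rewrite (cintegral_sum P n.+1 (bpp n)) -pS rotZ.
    by rewrite mulrA [n.+1%:R * _]mulrC.
  have GGE : expR s ^+ 2 *
      rot a b (cintegral P setT (fun w => f s (L w * xi) * f s (Rr w * xi))) =
      rot a b (cintegral P setT GG).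
    rewrite -rotZ -cintegralZ; last exact: cboundedM.
    congr (rot _ _ _); apply: cintegral_ext => w.
    by rewrite /GG /G expr2 rmorphM; ring.
  have nD : rot a b (cintegral P setT (fun w => GG w - tri w)) <=
      expR s * (rate s ^+ N * expR s + N%:R * rate s ^+ N).
    apply: le_trans (rotated_part_le _ ab) _.
    apply: normc_cintegral_le; first exact: cboundedB.
      have u0 := rate_bounds s_ge0.
      by rewrite mulr_ge0 ?expR_ge0// addr_ge0 ?mulr_ge0 ?exprn_ge0 ?expR_ge0.
    by move=> w; apply: gain_defect => // k z kN; exact: IH.
  have -> : dg s = expR (- s) * (rot a b (cintegral P setT (fun w => GG w - tri w))
      - expR s * (rate s ^+ N * expR s + N%:R * rate s ^+ N)).
    rewrite cintegralB// rotD rotN -triE -GGE /dg.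
    have -> : rate s ^+ N.+1 = (1 - expR (- s)) * rate s ^+ N by rewrite exprS.
    rewrite -mulrDr [rot a b (f s xi) + _]addrC rhsE.
    set X := rot a b (cintegral _ _ _); set Y := \sum_(n < N) _.
    have -> : expR (- s) = (expR s)^-1 by rewrite expRN.
    have := expR_gt0 s; set E := expR s => E0.
    set U := rate s ^+ N.
    by rewrite -[N.+1%:R]natr1; field; rewrite gt_eqF.
  by rewrite pmulr_rle0 ?expR_gt0// subr_le0.
have [cR cI] := cvgf0 xi.
apply: cvgB; last first.
  apply: is_derive_cvg_at_right.
  exact: is_derive_lM (is_derive_rate_exp N.+1 0) (is_derive_expR 0).
apply: cvgB; last exact: is_derive_cvg_at_right (is_derive_rate_series N.+1 q 0).
apply: cvgM; first exact: is_derive_cvg_at_right (is_derive_expR 0).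
by apply: cvgD; apply: cvgM => //; exact: cvg_cst.
Qed.

(** Uniqueness for the kinetic equation: the remainder is geometric for any
    solution whose transforms have modulus at most 1, so such a solution can
    only be the Wild sum. *)
Lemma cvg_wild_expansion t xi : 0 <= t ->
  (\sum_(n < N) wild_weight t n * Re (p n xi) @[N --> \oo] --> Re (f t xi)) /\
  (\sum_(n < N) wild_weight t n * Im (p n xi) @[N --> \oo] --> Im (f t xi)).
Proof.
move=> t0; have /andP[u0 u1] := wild_rate t0.
have cv a b : a ^+ 2 + b ^+ 2 = 1 ->
    \sum_(n < N) wild_weight t n * rot a b (p n xi) @[N --> \oo] -->
    rot a b (f t xi).
  move=> ab; apply/cvgrPdist_le => e e0.
  have cu : rate t ^+ N @[N --> \oo] --> (0 : R).
    by apply: cvg_expr; rewrite ger0_norm.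
  near=> N.
  have ab' : (- a) ^+ 2 + (- b) ^+ 2 = 1 by rewrite !sqrrN.
  have sE : \sum_(n < N) wild_weight t n * rot a b (p n xi) =
      expR (- t) * rot a b (S N t xi).
    rewrite (rot_sum _ _ _ (fun n => (rate t ^+ n)%:C * p n xi)) mulr_sumr.
    by apply: eq_bigr => n _; rewrite rotZ mulrA.
  have fE : rot a b (f t xi) = expR (- t) * rot a b (G t xi).
    by rewrite rotZ mulrA -expRD addNr expR0 mul1r.
  rewrite sE fE -mulrBr -rotN -rotD normrM ger0_norm ?expR_ge0//.
  have h : `|rot a b (G t xi - S N t xi)| <= rate t ^+ N * expR t.
    have W := wild_remainder N xi t0.
    apply/ler_normlP; split; last exact: le_trans (rotated_part_le _ ab) W.
    apply: le_trans W; apply: le_trans (rotated_part_le _ ab').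
    by rewrite /rot; lra.
  apply: le_trans (_ : _ <= expR (- t) * (rate t ^+ N * expR t)) _.
    by rewrite ler_wpM2l ?expR_ge0.
  rewrite mulrCA -expRD addNr expR0 mulr1 -[leLHS]ger0_norm ?exprn_ge0//.
  rewrite -[X in `|X|]subr0 distrC; near: N.
  by move/cvgrPdist_le : cu; exact.
split.
  have := @cv 1 0; rewrite expr1n expr0n addr0 => /(_ erefl).
  by rewrite /rot mul1r mul0r addr0; under eq_fun do
    under eq_bigr do rewrite mul1r mul0r addr0.
have := @cv 0 1; rewrite expr1n expr0n add0r => /(_ erefl).
by rewrite /rot mul1r mul0r add0r; under eq_fun do
  under eq_bigr do rewrite mul1r mul0r add0r.
Unshelve. all: by end_near.
Qed.

End wild_expansion_of_a_solution.

(** * Inequalities for powers *)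

Section power_inequalities.
Context (R : realType).
Implicit Types x y : R.

Lemma expR_quadratic_bound (s : R) : expR s <= 1 + s + s ^+ 2 * expR `|s|.
Proof.
have h (z : R) : expR z - 1 <= z * expR z.
  have := expR_ge1Dx (- z); rewrite expRN -(ler_pM2r (expR_gt0 z)).
  by rewrite mulVf ?gt_eqF ?expR_gt0// mulrDl mul1r; lra.
have hs := h s.
suff : s * (expR s - 1) <= s ^+ 2 * expR `|s| by lra.
have [s0|s0] := leP 0 s.
  by rewrite ger0_norm// expr2 -mulrA ler_wpM2l.
have e1 : 1 <= expR `|s| by rewrite -expR0 ler_expR.
have h1 := expR_ge1Dx s.
have h2 : s * (expR s - 1) <= s * s.
  by apply: ler_wnM2l; [exact: ltW|lra].
by apply: le_trans h2 _; rewrite -expr2 ler_peMr// sqr_ge0.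
Qed.

(** Through [1 + t <= exp t] the power is compared with an exponential, whose
    second-order remainder is explicit. *)
Lemma powR_1D_bound (p t : R) : 0 < p -> `|t| <= 1 ->
  (1 + t) `^ p <= 1 + p * t + p ^+ 2 * expR p * t ^+ 2.
Proof.
move=> p0 t1.
have E : expR (p * t) <= 1 + p * t + p ^+ 2 * expR p * t ^+ 2.
  apply: le_trans (expR_quadratic_bound _) _.
  rewrite lerD2l exprMn.
  rewrite (_ : p ^+ 2 * expR p * t ^+ 2 = p ^+ 2 * t ^+ 2 * expR p); last by ring.
  apply: ler_wpM2l; first by rewrite mulr_ge0 ?sqr_ge0.
  by rewrite ler_expR normrM gtr0_norm// ler_piMr// ltW.
apply: le_trans E; rewrite /powR.
case: ifPn => [_|t0]; first by rewrite (gt_eqF p0) expR_ge0.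
rewrite ler_expR; apply: ler_wpM2l; first exact: ltW.
have t2 : 0 < 1 + t.
  by move/ler_normlP : t1 => [t1 _]; rewrite lt_neqAle eq_sym t0; lra.
by apply: le_ln1Dx; lra.
Qed.

Lemma powR_split (x r s : R) : 0 < s -> 0 < r ->
  x `^ (r + s) = x `^ r * x `^ s.
Proof. by move=> s0 r0; apply: powRD; rewrite gt_eqF// addr_gt0. Qed.

Lemma powR_sq (x : R) : 0 <= x -> x `^ 2 = x ^+ 2.
Proof. by move=> x0; rewrite powR_mulrn. Qed.

Lemma powR_sub2 (p x : R) : 2 < p -> 0 <= x -> x `^ p = x `^ (p - 2) * x ^+ 2.
Proof.
move=> p2 x0; rewrite -powR_sq// -powR_split//; last lra.
by rewrite subrK.
Qed.

Lemma sqr_norm (x : R) : `|x| ^+ 2 = x ^+ 2.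
Proof. by rewrite real_normK// num_real. Qed.

(** Up to the factor [p], the derivative of [|x| ^ p]. *)
Definition signed_pow (p x : R) : R := `|x| `^ (p - 2) * x.

(** Expanding [|x + y| ^ p] around the larger of the two arguments: the terms of
    first order are linear in one argument, hence vanish in expectation for
    independent centered variables, and the remainder carries a square. *)
Lemma powR_add_bound (p x y : R) : 2 < p ->
  `|x + y| `^ p <= `|x| `^ p + `|y| `^ p
    + p * (signed_pow p x * y) + p * (x * signed_pow p y)
    + (p ^+ 2 * expR p + p) *
      (`|x| `^ (p - 2) * y ^+ 2 + x ^+ 2 * `|y| `^ (p - 2)).
Proof.
move=> p2; rewrite /signed_pow; wlog yx : x y / `|y| <= `|x| => [H|].
  have [|/ltW yx] := leP `|y| `|x|; first exact: H.
  by have := H _ _ yx; rewrite addrC => /le_trans; apply; lra.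
have p0 : 0 < p by lra.
have c0 : 0 <= p ^+ 2 * expR p by rewrite mulr_ge0 ?sqr_ge0 ?expR_ge0.
have [x0|x0] := eqVneq x 0.
  have y0 : y = 0.
    by apply/eqP; rewrite -normr_le0 (le_trans yx)// x0 normr0.
  rewrite x0 y0 addr0 !normr0 powR0 ?gt_eqF//.
  by rewrite expr0n !(mul0r, mulr0, addr0).
have xn0 : 0 < `|x| by rewrite normr_gt0.
pose t := y / x.
have t1 : `|t| <= 1 by rewrite normrM normfV ler_pdivrMr// mul1r.
have t1' : 0 <= 1 + t by move/ler_normlP : t1 => [t1 _]; lra.
have -> : `|x + y| = `|x| * (1 + t).
  by rewrite -[1 + t]ger0_norm// -normrM /t mulrDr mulr1 mulrCA mulfV// mulr1.
rewrite powRM// ![`|_| `^ p]powR_sub2// !sqr_norm.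
have H := powR_1D_bound p0 t1.
set X := `|x| `^ (p - 2); set Y := `|y| `^ (p - 2).
have X0 : 0 <= X by exact: powR_ge0.
have Y0 : 0 <= Y by exact: powR_ge0.
have Xx : 0 <= X * x ^+ 2 by rewrite mulr_ge0// sqr_ge0.
apply: le_trans (ler_wpM2l Xx H) _.
set c := p ^+ 2 * expR p in c0 *.
have -> : X * x ^+ 2 * (1 + p * t + c * t ^+ 2) =
    X * x ^+ 2 + p * (X * x * y) + c * (X * y ^+ 2).
  by rewrite /t; field.
have y2 : 0 <= y ^+ 2 by exact: sqr_ge0.
have h1 : 0 <= Y * y ^+ 2 by rewrite mulr_ge0.
have h2 : 0 <= p * (X * y ^+ 2) by do ?apply: mulr_ge0 => //; exact: ltW.
have h3 : 0 <= c * (x ^+ 2 * Y) by apply: mulr_ge0 => //; apply: mulr_ge0 => //; exact: sqr_ge0.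
have xy : 0 <= x ^+ 2 + x * y.
  have : `|x * y| <= x ^+ 2.
    by rewrite normrM -sqr_norm expr2 ler_wpM2l.
  by move/ler_normlP => [xy _]; lra.
have h4 : 0 <= p * (Y * (x ^+ 2 + x * y)).
  by apply: mulr_ge0; [exact: ltW|exact: mulr_ge0].
lra.
Qed.

(** Whichever of [delta * x ^ 2] and [s ^ 2] is the larger one bounds the other:
    this is Young's inequality with both constants equal to 1. *)
Lemma powR_young (p x s delta : R) : 2 < p -> 0 <= x -> 0 <= s -> 0 < delta ->
  x `^ (p - 2) * s ^+ 2 <= delta * x `^ p + delta `^ (- ((p - 2) / 2)) * s `^ p.
Proof.
move=> p2 x0 s0 d0; have dp0 : 0 <= delta `^ (- ((p - 2) / 2)) by exact: powR_ge0.
rewrite ![_ `^ p]powR_sub2//.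
have [h|h] := leP (s ^+ 2) (delta * x ^+ 2).
  apply: (@le_trans _ _ (delta * (x `^ (p - 2) * x ^+ 2))).
    by rewrite [leRHS]mulrCA ler_wpM2l// powR_ge0.
  by rewrite lerDl !mulr_ge0 ?powR_ge0 ?sqr_ge0.
apply: (@le_trans _ _ (delta `^ (- ((p - 2) / 2)) * (s `^ (p - 2) * s ^+ 2))).
  rewrite mulrA ler_wpM2r ?sqr_ge0//.
  have e (z : R) : 0 <= z -> z `^ (p - 2) = (z ^+ 2) `^ ((p - 2) / 2).
    move=> z0; rewrite -powR_sq// -powRrM; congr (_ `^ _); by field.
  rewrite (e _ x0) (e _ s0) powRN [leRHS]mulrC ler_pdivlMr ?powR_gt0//.
  rewrite mulrC -powRM ?sqr_ge0//; last exact: ltW.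
  apply: ge0_ler_powR; rewrite ?nnegrE ?sqr_ge0 ?mulr_ge0 ?sqr_ge0 ?(ltW d0)//.
    lra.
  exact: ltW.
by rewrite lerDr !mulr_ge0 ?powR_ge0 ?sqr_ge0 ?(ltW d0).
Qed.

Lemma powR_le_1D (r p x : R) : 0 <= r <= p -> 0 <= x -> x `^ r <= 1 + x `^ p.
Proof.
move=> /andP[r0 rp] x0; have px := powR_ge0 x p.
have [x1|x1] := leP 1 x; first by have := ler_powR x1 rp; lra.
have [->|xn0] := eqVneq x 0.
  have [->|rn0] := eqVneq r 0; first by rewrite powRr0; have := powR_ge0 0 p; lra.
  by rewrite powR0//; have := powR_ge0 0 p; lra.
have xx : 0 < x <= 1 by rewrite lt_neqAle eq_sym xn0 x0 ltW.
by have := ger_powR xx r0; rewrite powRr0; lra.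
Qed.

Lemma powR_mixed_le (r s x y : R) : 0 < r -> 0 < s -> 0 <= x -> 0 <= y ->
  x `^ r * y `^ s <= x `^ (r + s) + y `^ (r + s).
Proof.
move=> r0 s0 x0 y0; rewrite !powR_split//.
have [xy|/ltW yx] := leP x y.
  apply: (@le_trans _ _ (y `^ r * y `^ s)).
    by rewrite ler_wpM2r ?powR_ge0// ge0_ler_powR// ?nnegrE// ltW.
  by rewrite lerDr mulr_ge0 ?powR_ge0.
apply: (@le_trans _ _ (x `^ r * x `^ s)).
  by rewrite ler_wpM2l ?powR_ge0// ge0_ler_powR// ?nnegrE// ltW.
by rewrite lerDl mulr_ge0 ?powR_ge0.
Qed.

End power_inequalities.

(** * A differential inequality with a free parameter *)

Section growth.
Context (R : realType).
Variables (y0 K q : R).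
Hypotheses (y0_ge0 : 0 <= y0) (K_ge0 : 0 <= K) (q_gt0 : 0 < q).

(** What Young's inequality leaves of a nonlinear differential inequality.  The
    parameter [delta] stays free, and letting it depend on time in a way adapted
    to the sign of [c] recovers the sharp rate. *)
Definition young_growth (c : R) (y dy : R -> R) :=
  [/\ forall t : R, is_derive t 1 y (dy t), y 0 <= y0 &
      forall t delta : R, 0 <= t -> 0 < delta ->
        dy t <= delta * y t + K * delta `^ (- q) * expR (c * t)].

(* The integrating factor [v] solves [v' = - delta v]; then [y v - H] has a
   nonpositive derivative. *)
Let integrate (c : R) y dy (v delta H dH : R -> R) t : young_growth c y dy ->
  0 <= t -> v 0 = 1 -> H 0 = 0 ->
  (forall s : R, 0 <= s -> 0 <= v s) ->
  (forall s : R, 0 <= s -> s <= t -> 0 < delta s) ->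
  (forall s : R, is_derive s 1 v (- delta s * v s)) ->
  (forall s : R, is_derive s 1 H (dH s)) ->
  (forall s : R, 0 <= s -> s <= t ->
    K * delta s `^ (- q) * expR (c * s) * v s <= dH s) ->
  y t * v t <= y0 + H t.
Proof.
move=> [yd yy0 yg] t0 v0 H0 vge dpos dv dHd hH.
pose g s := y s * v s - H s.
have gd (s : R) : is_derive s 1 g (dy s * v s + y s * (- delta s * v s) - dH s).
  by apply: is_derive_lB => //; exact: is_derive_lM.
have cg : {within `[0, t], continuous g}.
  apply: derivable_within_continuous => s _.
  by have [] := gd s.
have [c0 c0t E] := MVT_segment t0 (fun s _ => gd s) cg.
move: c0t; rewrite in_itv/= => /andP[c00 c0t].
have : g t - g 0 <= 0.
  rewrite E subr0 mulr_le0_ge0//.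
  have h1 := yg _ _ c00 (dpos _ c00 c0t); have h2 := hH _ c00 c0t.
  have h3 := ler_wpM2r (vge _ c00) h1.
  by lra.
rewrite /g v0 H0 mulr1 subr0; lra.
Qed.

(** The forcing grows faster than the homogeneous solution with the constant
    [delta = c / 2], and imposes its own rate. *)
Lemma growth_gt0 (c : R) : 0 < c -> exists C : R, forall y dy, young_growth c y dy ->
  forall t, 0 <= t -> y t <= C * expR (c * t).
Proof.
move=> c0; pose k := K * (c / 2) `^ (- q).
have k0 : 0 <= k by rewrite mulr_ge0// powR_ge0.
exists (y0 + k * (2 / c)) => y dy hy t t0.
pose v (s : R) := expR (- (c / 2) * s).
pose H (s : R) := k * (2 / c) * (expR (c / 2 * s) - 1).
have e (s : R) : expR (c * s) * v s = expR (c / 2 * s).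
  by rewrite -expRD; congr expR; field.
have := @integrate c y dy v (fun=> c / 2) H (fun s => k * expR (c / 2 * s)) t hy t0.
rewrite /v /H !mulr0 expR0 subrr mulr0 => /(_ erefl erefl).
have c20 : 0 < c / 2 by rewrite divr_gt0.
move=> h; have {h} : y t * expR (- (c / 2) * t) <=
    y0 + k * (2 / c) * (expR (c / 2 * t) - 1).
  apply: h => //.
  - by move=> s; exact: is_derive_lexp.
  - move=> s; have := is_derive_lZ (k * (2 / c)) (is_derive_lB
      (is_derive_lexp (c / 2) s) (is_derive_lcst 1 s)).
    move=> h; apply: (is_derive_change h).
    by rewrite subr0; field; rewrite gt_eqF.
  - by move=> s _ _; rewrite -/k -mulrA e.
move=> h.
have h2 := ler_wpM2r (expR_ge0 (c / 2 * t)) h.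
move: h2; rewrite -[leLHS]mulrA -expRD mulNr addNr expR0 mulr1 => h2; apply: le_trans h2 _.
have E1 : 1 <= expR (c / 2 * t).
  apply: le_trans (expR_ge1Dx _); rewrite lerDl.
  by apply: mulr_ge0 t0; exact: ltW.
have -> : expR (c * t) = expR (c / 2 * t) * expR (c / 2 * t).
  by rewrite -expRD; congr expR; field.
set e1 := expR _ in E1 *.
have k1 : 0 <= k * (2 / c) by rewrite mulr_ge0// divr_ge0// ltW.
rewrite mulrA ler_wpM2r//; first by lra.
rewrite mulrDl.
have h3 : y0 <= y0 * e1 by rewrite ler_peMr.
by lra.
Qed.

(** With [delta = 1 / (1 + t)], where [t] is the final time, the homogeneous
    solution stays bounded and the forcing contributes [t * (1 + t) ^ q]. *)
Lemma growth_eq0 : exists C : R, forall y dy, young_growth 0 y dy ->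
  forall t, 0 <= t -> y t <= C * (1 + t) `^ (q + 1).
Proof.
exists (expR 1 * (y0 + K)) => y dy hy t t0.
have t1 : 0 < 1 + t by lra.
pose delta := (1 + t)^-1.
have d0 : 0 < delta by rewrite invr_gt0.
pose k := K * delta `^ (- q).
have k0 : 0 <= k by rewrite mulr_ge0// powR_ge0.
have := @integrate 0 y dy (fun s => expR (- delta * s)) (fun=> delta)
  (fun s => k * s) (fun=> k) t hy t0.
rewrite !mulr0 expR0 => /(_ erefl erefl) h.
have {h} : y t * expR (- delta * t) <= y0 + k * t.
  apply: h => //.
  - by move=> s; exact: is_derive_lexp.
  - move=> s; apply: (is_derive_change (is_derive_lZ k (is_derive_id s 1))).
    by rewrite mulr1.
  - move=> s s0 _; rewrite mul0r expR0 mulr1 -/k ler_piMr//.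
    by rewrite -expR0 ler_expR mulNr oppr_le0 mulr_ge0// ltW.
move=> h.
have h2 := ler_wpM2r (expR_ge0 (delta * t)) h.
move: h2; rewrite -[leLHS]mulrA -expRD mulNr addNr expR0 mulr1 => h2; apply: le_trans h2 _.
have dt1 : delta * t <= 1 by rewrite mulrC ler_pdivrMr//; lra.
have e1 : expR (delta * t) <= expR 1 by rewrite ler_expR.
have kE : k * t <= K * (1 + t) `^ (q + 1).
  rewrite /k /delta -powR_inv1; last exact: ltW.
  rewrite -powRrM mulN1r opprK -mulrA ler_wpM2l//.
  rewrite powR_split// powRr1 ?(ltW t1)// ler_wpM2l ?powR_ge0//; lra.
have y1 : y0 <= y0 * (1 + t) `^ (q + 1).
  have h0 : 0 <= q + 1 by rewrite addr_ge0// ltW.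
  have h1 : 1 <= 1 + t by rewrite lerDl.
  by have := ler_powR h1 h0; rewrite powRr0 => ?; rewrite ler_peMr.
have F1 : y0 + k * t <= (y0 + K) * (1 + t) `^ (q + 1) by rewrite mulrDl lerD.
apply: le_trans (ler_wpM2r (expR_ge0 _) F1) _.
rewrite [leLHS]mulrC -[leRHS]mulrA; apply: ler_wpM2r e1.
by rewrite mulr_ge0 ?powR_ge0 ?addr_ge0.
Qed.

(** With [delta = exp (- eta s)] and [eta = - c / (2 q)], both [delta] and the
    forcing [delta ^ (- q) exp (c s) = exp (c s / 2)] are integrable. *)
Lemma growth_lt0 (c : R) : c < 0 -> exists C : R, forall y dy,
  (forall t : R, 0 <= t -> 0 <= y t) -> young_growth c y dy ->
  forall t, 0 <= t -> y t <= C.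
Proof.
move=> c0; pose eta := - c / (2 * q).
have eta0 : 0 < eta by rewrite divr_gt0 ?oppr_gt0// mulr_gt0.
exists ((y0 + K * (2 / - c)) * expR eta^-1) => y dy ypos hy t t0.
pose r (s : R) := eta^-1 * (expR (- eta * s) - 1).
have r0 (s : R) : 0 <= s -> - eta^-1 <= r s <= 0.
  move=> s0; have e1 : expR (- eta * s) <= 1.
    by rewrite -expR0 ler_expR mulNr oppr_le0 mulr_ge0// ltW.
  have e0 := expR_ge0 (- eta * s).
  have ei : 0 <= eta^-1 by rewrite invr_ge0 ltW.
  apply/andP; split; rewrite /r.
    by rewrite -[leLHS]mulrN1 ler_wpM2l//; lra.
  by rewrite mulr_ge0_le0//; lra.
have dr (s : R) : is_derive s 1 r (- expR (- eta * s)).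
  have h := is_derive_lZ eta^-1 (is_derive_lB
    (is_derive_lexp (- eta) s) (is_derive_lcst 1 s)).
  by apply: (is_derive_change h); rewrite subr0; field; rewrite gt_eqF.
have dv (s : R) : is_derive s 1 (fun s => expR (r s)) (- expR (- eta * s) * expR (r s)).
  apply: (is_derive_change (is_derive1_comp (is_derive_expR (r s)) (dr s))).
  by rewrite mulrC.
pose H (s : R) := K * (2 / - c) * (1 - expR (c / 2 * s)).
have := @integrate c y dy (fun s => expR (r s)) (fun s => expR (- eta * s))
  H (fun s => K * expR (c / 2 * s)) t hy t0.
have r00 : r 0 = 0 by rewrite /r mulr0 expR0 subrr mulr0.
rewrite r00 expR0 => /(_ erefl) h.
have {h} h : y t * expR (r t) <= y0 + H t.
  apply: h => //.
  - by rewrite /H mulr0 expR0 subrr mulr0.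
  - by move=> s _ _; exact: expR_gt0.
  - move=> s; have h := is_derive_lZ (K * (2 / - c)) (is_derive_lB
      (is_derive_lcst 1 s) (is_derive_lexp (c / 2) s)).
    by apply: (is_derive_change h); rewrite sub0r; field; rewrite lt_eqF.
  - move=> s s0 _; rewrite -expRM -!mulrA ler_wpM2l// -!expRD ler_expR.
    have /andP[_ rs] := r0 s s0.
    have -> : - eta * (s * - q) = - (c / 2) * s.
      by rewrite /eta; field; rewrite gt_eqF.
    by lra.
have /andP[rt _] := r0 t t0.
have e2 : expR (- eta^-1) <= expR (r t) by rewrite ler_expR.
have Hle : H t <= K * (2 / - c).
  apply: ler_piMr; last by have := expR_ge0 (c / 2 * t); lra.
  by apply: mulr_ge0 => //; apply: divr_ge0 => //; lra.
have h2 : y t * expR (- eta^-1) <= y0 + K * (2 / - c).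
  by apply: le_trans (ler_wpM2l (ypos t t0) e2) _; lra.
have := ler_wpM2r (expR_ge0 eta^-1) h2.
by rewrite -mulrA -expRD addNr expR0 mulr1.
Qed.

End growth.

(** * Moments of the Wild terms *)

Section gain_moments.
Context (R : realType) dO (Omega : measurableType dO) (P : probability Omega R).
Context d (T : measurableType d).
Variable op : {mfun (Omega * (T * T))%type >-> T}.
Variables (L Rr : Omega -> R) (l : T -> R) (p : R).
Hypothesis mL : measurable_fun setT L.
Hypothesis mRr : measurable_fun setT Rr.
Hypothesis L0 : forall w, 0 <= L w.
Hypothesis Rr0 : forall w, 0 <= Rr w.
Hypothesis ml : measurable_fun setT l.
Hypothesis l_op : forall w z z', l (op (w, (z, z'))) = L w * l z + Rr w * l z'.
Hypothesis p2 : 2 < p.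
Hypothesis iL : integrableR P (fun w => L w `^ p).
Hypothesis iRr : integrableR P (fun w => Rr w `^ p).
Implicit Types m : probability T R.

Let h1 : 0 <= (1 : R) <= p.
Proof. by move: p2 => p2'; rewrite ler01/=; lra. Qed.

Let h2 : 0 <= (2 : R) <= p.
Proof. by rewrite ler0n/= ltW. Qed.

Let hp1 : 0 <= p - 1 <= p.
Proof. by move: p2 => p2'; apply/andP; split; lra. Qed.

Let hp2 : 0 <= p - 2 <= p.
Proof. by move: p2 => p2'; apply/andP; split; lra. Qed.

Definition moment m r := \int[m]_z `|l z| `^ r.

Definition centered m :=
  integrableR m (fun z => `|l z| `^ p) /\ \int[m]_z l z = 0.

Lemma measurable_powR_comp d' (T' : measurableType d') (f : T' -> R) r :
  measurable_fun setT f -> measurable_fun setT (fun x => f x `^ r).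
Proof. by move=> mf; apply: (measurableT_comp (measurable_powR r)). Qed.

Lemma measurable_abs_powR r : measurable_fun setT (fun z => `|l z| `^ r).
Proof. by apply: measurable_powR_comp; exact: measurableT_comp. Qed.

Lemma integrable_lower_exponent d' (T' : measurableType d') (m : probability T' R)
    (X : T' -> R) r : measurable_fun setT X ->
  (forall x, 0 <= X x) -> integrableR m (fun x => X x `^ p) ->
  0 <= r <= p -> integrableR m (fun x => X x `^ r).
Proof.
move=> mX X0 iX hr; have i1 : integrableR m (fun x => 1 + X x `^ p).
  by apply: integrableRD => //; exact/bm_integrable/bm_cst.
apply: integrableR_le i1 _; first exact: measurable_powR_comp.
move=> x; rewrite !ger0_norm ?addr_ge0 ?powR_ge0//.
exact: powR_le_1D.
Qed.

Lemma integrable_lower_power m r : integrableR m (fun z => `|l z| `^ p) ->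
  0 <= r <= p -> integrableR m (fun z => `|l z| `^ r).
Proof.
by apply: (integrable_lower_exponent (X := fun z => `|l z|)) => //; exact: measurableT_comp.
Qed.

Lemma integrable_l m : integrableR m (fun z => `|l z| `^ p) -> integrableR m l.
Proof.
move=> ip.
apply: integrableR_le (integrable_lower_power ip h1) _ => // z.
by rewrite powRr1// normr_id.
Qed.

Lemma integrable_signed m : integrableR m (fun z => `|l z| `^ p) ->
  integrableR m (fun z => signed_pow p (l z)).
Proof.
move: p2 => p2' ip.
apply: integrableR_le (integrable_lower_power ip hp1) _.
  by apply: measurable_funM => //; exact: measurable_abs_powR.
move=> z; rewrite /signed_pow normrM ![`|_ `^ _|]ger0_norm ?powR_ge0//.
rewrite -{2}[`|l z|]powRr1// -powR_split; [|lra..].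
by rewrite le_eqVlt; apply/orP; left; apply/eqP; congr (_ `^ _); ring.
Qed.

Lemma integrable_sum_powers : integrableR P (fun w => L w `^ p + Rr w `^ p).
Proof. exact: integrableRD. Qed.

Lemma integrable_mixed r s : 0 < r -> 0 < s -> r + s = p ->
  integrableR P (fun w => L w `^ r * Rr w `^ s).
Proof.
move=> r0 s0 rs; apply: integrableR_le integrable_sum_powers _.
  by apply: measurable_funM; exact: measurable_powR_comp.
move=> w; rewrite !ger0_norm ?mulr_ge0 ?addr_ge0 ?powR_ge0//.
by rewrite -rs; exact: powR_mixed_le.
Qed.

Section joint_products.
Variables m m' : probability T R.
Local Notation J := (joint_law P m m').

Lemma integrable_joint (f : Omega -> R) (g h : T -> R) :
  integrableR P f -> integrableR m g -> integrableR m' h ->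
  integrableR J (fun x => f x.1 * (g x.2.1 * h x.2.2)).
Proof.
move=> hf hg hh.
exact: (integrableR_prod (m2 := (m \x m')%E) hf (integrableR_prod hg hh)).
Qed.

Lemma int_joint (f : Omega -> R) (g h : T -> R) :
  integrableR P f -> integrableR m g -> integrableR m' h ->
  \int[J]_x (f x.1 * (g x.2.1 * h x.2.2)) =
  \int[P]_w f w * (\int[m]_z g z * \int[m']_z h z).
Proof.
move=> hf hg hh; rewrite -(int_prod hg hh).
exact: (int_prod (m2 := (m \x m')%E) hf (integrableR_prod hg hh)).
Qed.

Lemma l_opE (x : Omega * (T * T)) : l (op x) = L x.1 * l x.2.1 + Rr x.1 * l x.2.2.
Proof. by case: x => w [z z']. Qed.

Hypothesis cm : centered m.
Hypothesis cm' : centered m'.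

Let one_int (n : probability T R) : integrableR n (fun=> 1).
Proof. exact/bm_integrable/bm_cst. Qed.

Let iL1 : integrableR P L.
Proof.
have := integrable_lower_exponent mL L0 iL h1.
by under eq_fun do rewrite powRr1//.
Qed.

Let iRr1 : integrableR P Rr.
Proof.
have := integrable_lower_exponent mRr Rr0 iRr h1.
by under eq_fun do rewrite powRr1//.
Qed.

Let jE : (fun x => l (op x)) =
  (fun x => L x.1 * (l x.2.1 * 1) + Rr x.1 * (1 * l x.2.2)).
Proof. by apply/funext => x; rewrite l_opE mulr1 mul1r. Qed.

(** Centering is preserved, which is what kills the terms of first order in the
    expansions of the second and of the [p]-th moment. *)
Lemma gain_mean : \int[gain P op m m']_z l z = 0.
Proof.
have [im m0] := cm; have [im' m'0] := cm'.
have i1 := integrable_joint iL1 (integrable_l im) (one_int m').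
have i2 := integrable_joint iRr1 (one_int m) (integrable_l im').
have ij : integrableR J (fun x => l (op x)) by rewrite jE; exact: integrableRD.
rewrite (gain_int ml ij).2.
have -> : \int[J]_x l (op x) =
    \int[J]_x (L x.1 * (l x.2.1 * 1) + Rr x.1 * (1 * l x.2.2)).
  by apply: int_ext => x; rewrite l_opE mulr1 mul1r.
rewrite intD//.
rewrite (int_joint iL1 (integrable_l im) (one_int m')).
rewrite (int_joint iRr1 (one_int m) (integrable_l im')).
by rewrite m0 m'0 mul0r !mulr0 addr0.
Qed.

Lemma gain_second_moment : moment (gain P op m m') 2 =
  \int[P]_w L w `^ 2 * moment m 2 + \int[P]_w Rr w `^ 2 * moment m' 2.
Proof.
have [im m0] := cm; have [im' m'0] := cm'.
have iL2 := integrable_lower_exponent mL L0 iL h2.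
have iR2 := integrable_lower_exponent mRr Rr0 iRr h2.
have iLR : integrableR P (fun w => L w * Rr w).
  have iS := integrableRD iL2 iR2.
  apply: integrableR_le iS _; first exact: measurable_funM.
  move=> w; rewrite !ger0_norm ?mulr_ge0 ?addr_ge0 ?powR_ge0//.
  have -> : 2 = 1 + 1 :> R by ring.
  rewrite -{1}[L w]powRr1// -{1}[Rr w]powRr1//.
  exact: powR_mixed_le.
have i1 := integrable_joint iL2 (integrable_lower_power im h2) (one_int m').
have i2 := integrable_joint iR2 (one_int m) (integrable_lower_power im' h2).
have i3 := integrable_joint iLR (integrable_l im) (integrable_l im').
have E (x : Omega * (T * T)) : `|l (op x)| `^ 2 =
    (L x.1 `^ 2 * (`|l x.2.1| `^ 2 * 1) + Rr x.1 `^ 2 * (1 * `|l x.2.2| `^ 2))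
    + 2 * (L x.1 * Rr x.1 * (l x.2.1 * l x.2.2)).
  by rewrite !powR_sq// !sqr_norm l_opE; ring.
have i12 := integrableRD i1 i2.
have i23 := integrableRZ 2 i3.
have ij : integrableR J (fun x => `|l (op x)| `^ 2).
  by under eq_fun do rewrite E; exact: integrableRD.
rewrite /moment (gain_int (measurable_abs_powR 2) ij).2.
under int_ext do rewrite E.
rewrite (intD i12 i23) (intD i1 i2) (intZ 2 i3).
rewrite (int_joint iL2 (integrable_lower_power im h2) (one_int m')).
rewrite (int_joint iR2 (one_int m) (integrable_lower_power im' h2)).
rewrite (int_joint iLR (integrable_l im) (integrable_l im')).
by rewrite m0 mul0r !mulr0 addr0 !int_cst mulr1 mul1r.
Qed.

Definition cross_constant : R := p ^+ 2 * expR p + p.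

Lemma cross_constant_ge0 : 0 <= cross_constant.
Proof.
move: p2 => p2'.
by rewrite addr_ge0 ?mulr_ge0 ?sqr_ge0 ?expR_ge0//; lra.
Qed.

(** The first-order terms of [powR_add_bound] integrate to products of a signed
    moment by a mean, hence vanish; what remains besides the pure moments pairs
    moments of order [p - 2] with second moments. *)
Lemma gain_moment : integrableR (gain P op m m') (fun z => `|l z| `^ p) /\
  moment (gain P op m m') p <=
  \int[P]_w L w `^ p * moment m p + \int[P]_w Rr w `^ p * moment m' p +
  cross_constant * \int[P]_w (L w `^ p + Rr w `^ p) *
    (moment m (p - 2) * moment m' 2 + moment m 2 * moment m' (p - 2)).
Proof.
move: p2 => p2'; have [im m0] := cm; have [im' m'0] := cm'.
have ipL1R : integrableR P (fun w => L w `^ (p - 1) * Rr w `^ 1).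
  by apply: integrable_mixed; lra.
have iL1pR : integrableR P (fun w => L w `^ 1 * Rr w `^ (p - 1)).
  by apply: integrable_mixed; lra.
have ip2L2R : integrableR P (fun w => L w `^ (p - 2) * Rr w `^ 2).
  by apply: integrable_mixed; lra.
have i2Lp2R : integrableR P (fun w => L w `^ 2 * Rr w `^ (p - 2)).
  by apply: integrable_mixed; lra.
have im2 := integrable_lower_power im h2.
have im2' := integrable_lower_power im' h2.
have imp2 := integrable_lower_power im hp2.
have imp2' := integrable_lower_power im' hp2.
have j1 := integrable_joint iL im (one_int m').
have j2 := integrable_joint iRr (one_int m) im'.
have j3 := integrable_joint ipL1R (integrable_signed im) (integrable_l im').
have j4 := integrable_joint iL1pR (integrable_l im) (integrable_signed im').
have j5 := integrable_joint ip2L2R imp2 im2'.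
have j6 := integrable_joint i2Lp2R im2 imp2'.
pose F (x : Omega * (T * T)) :=
  ((L x.1 `^ p * (`|l x.2.1| `^ p * 1) + Rr x.1 `^ p * (1 * `|l x.2.2| `^ p))
  + (p * (L x.1 `^ (p - 1) * Rr x.1 `^ 1 * (signed_pow p (l x.2.1) * l x.2.2)) +
     p * (L x.1 `^ 1 * Rr x.1 `^ (p - 1) * (l x.2.1 * signed_pow p (l x.2.2))))
  + cross_constant * (
     L x.1 `^ (p - 2) * Rr x.1 `^ 2 * (`|l x.2.1| `^ (p - 2) * `|l x.2.2| `^ 2) +
     L x.1 `^ 2 * Rr x.1 `^ (p - 2) * (`|l x.2.1| `^ 2 * `|l x.2.2| `^ (p - 2)))).
have j12 := integrableRD j1 j2.
have j34 := integrableRD (integrableRZ p j3) (integrableRZ p j4).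
have j56 := integrableRD j5 j6.
have jF : integrableR J F.
  by apply: integrableRD; [exact: integrableRD|exact: integrableRZ].
have FE (x : Omega * (T * T)) : `|l (op x)| `^ p <= F x.
  rewrite l_opE /F; have := powR_add_bound (L x.1 * l x.2.1) (Rr x.1 * l x.2.2) p2.
  move: (L0 x.1) (Rr0 x.1); set a := L x.1; set b := Rr x.1; set u := l x.2.1.
  set v := l x.2.2 => a0 b0 /le_trans; apply.
  have e r : `|a * u| `^ r = a `^ r * `|u| `^ r.
    by rewrite normrM ger0_norm// powRM.
  have e' r : `|b * v| `^ r = b `^ r * `|v| `^ r.
    by rewrite normrM ger0_norm// powRM.
  clear F jF j12 j34 j56 j1 j2 j3 j4 j5 j6; have pa (c : R) : c `^ (p - 1) = c `^ (p - 2) * c `^ 1.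
    by rewrite -powR_split; [congr (_ `^ _); ring|lra..].
  rewrite /signed_pow !e !e' !pa !powRr1// !powR_sq// !sqr_norm /cross_constant.
  by rewrite le_eqVlt; apply/orP; left; apply/eqP; ring.
have mj : measurable_fun setT (fun x : Omega * (T * T) => `|l (op x)| `^ p).
  by apply: (measurableT_comp (measurable_abs_powR p)).
have ij : integrableR J (fun x => `|l (op x)| `^ p).
  apply: integrableR_le jF _ => // x.
  by rewrite ger0_norm ?powR_ge0//; apply: le_trans (ler_norm _).
have [ig gE] := gain_int (measurable_abs_powR p) ij.
split => //; rewrite /moment gE.
apply: le_trans (int_le ij jF FE) _; rewrite /F.
rewrite (intD (integrableRD j12 j34) (integrableRZ cross_constant j56)).
rewrite (intD j12 j34) (intD j1 j2) (intZ cross_constant j56) (intD j5 j6).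
rewrite (intD (integrableRZ p j3) (integrableRZ p j4)) (intZ p j3) (intZ p j4).
rewrite (int_joint iL im (one_int m')) (int_joint iRr (one_int m) im').
rewrite (int_joint ipL1R (integrable_signed im) (integrable_l im')).
rewrite (int_joint iL1pR (integrable_l im) (integrable_signed im')).
rewrite (int_joint ip2L2R imp2 im2') (int_joint i2Lp2R im2 imp2').
clear ig ij mj FE jF; rewrite m0 m'0 !mul0r !mulr0 !addr0 !int_cst mulr1 mul1r -/(moment m p) -/(moment m' p).
rewrite lerD2l -mulrA ler_wpM2l ?cross_constant_ge0//.
clear gE j34 j12 F j1 j2 j3 j4 j5 j6 j56.
have mom0 n r : 0 <= moment n r by apply: Rintegral_ge0 => z _; exact: powR_ge0.
rewrite mulrDr -!/(moment _ _); apply: lerD; apply: ler_wpM2r;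
  rewrite ?mulr_ge0//; apply: int_le => //; try exact: integrableRD.
- move=> w; have -> : L w `^ p + Rr w `^ p = L w `^ (p - 2 + 2) + Rr w `^ (p - 2 + 2).
    by rewrite subrK.
  by apply: powR_mixed_le => //; lra.
- move=> w; have -> : L w `^ p + Rr w `^ p = L w `^ (2 + (p - 2)) + Rr w `^ (2 + (p - 2)).
    by have -> : 2 + (p - 2) = p by ring.
  by apply: powR_mixed_le => //; lra.
Qed.

End joint_products.

Variable m0 : probability T R.
Hypothesis cm0 : centered m0.
Local Notation rho := (wild P op m0).

Lemma wild_centered n : centered (rho n).
Proof.
have [N] := ubnP n; elim: N n => // N IH [//|n]; rewrite ltnS => nN.
have ci i : (i <= n)%N -> centered (rho i).
  by move=> i_n; apply: IH; exact: leq_ltn_trans nN.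
have gp i j : (i <= n)%N -> (j <= n)%N ->
    integrableR (gain P op (rho i) (rho j)) (fun z => `|l z| `^ p).
  by move=> i_n j_n; exact: (gain_moment (ci _ i_n) (ci _ j_n)).1.
have gl i j : (i <= n)%N -> (j <= n)%N ->
    integrableR (gain P op (rho i) (rho j)) l.
  by move=> i_n j_n; apply: integrable_l; exact: gp.
split; first exact: (wildS_int gp).1.
have := (wildS_int gl).2; rewrite big1 => [/eqP|j _].
  by rewrite mulf_eq0 pnatr_eq0/= => /eqP.
by apply: gain_mean; apply: ci; rewrite ?leq_subr// -ltnS.
Qed.

Lemma wild_moment_rec n : n.+1%:R * moment (rho n.+1) p <=
  \sum_(j < n.+1) (\int[P]_w L w `^ p * moment (rho j) p +
    \int[P]_w Rr w `^ p * moment (rho (n - j)%N) p +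
    cross_constant * \int[P]_w (L w `^ p + Rr w `^ p) *
    (moment (rho j) (p - 2) * moment (rho (n - j)%N) 2 +
     moment (rho j) 2 * moment (rho (n - j)%N) (p - 2))).
Proof.
have gp i j : (i <= n)%N -> (j <= n)%N ->
    integrableR (gain P op (rho i) (rho j)) (fun z => `|l z| `^ p).
  by move=> _ _; exact: (gain_moment (wild_centered _) (wild_centered _)).1.
rewrite /moment (wildS_int gp).2; apply: ler_sum => j _.
exact: (gain_moment (wild_centered _) (wild_centered _)).2.
Qed.

Lemma wild_second_moment_rec n : n.+1%:R * moment (rho n.+1) 2 =
  \sum_(j < n.+1) (\int[P]_w L w `^ 2 * moment (rho j) 2 +
    \int[P]_w Rr w `^ 2 * moment (rho (n - j)%N) 2).
Proof.
have g2 i j : (i <= n)%N -> (j <= n)%N ->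
    integrableR (gain P op (rho i) (rho j)) (fun z => `|l z| `^ 2).
  move=> _ _; apply: integrable_lower_power => //.
  exact: (gain_moment (wild_centered _) (wild_centered _)).1.
rewrite /moment (wildS_int g2).2; apply: eq_bigr => j _.
exact: gain_second_moment (wild_centered _) (wild_centered _).
Qed.

End gain_moments.

(** * Moments of the partial Wild sums *)

Section wild_partial_sums.
Context (R : realType).
Implicit Types (f g : nat -> R) (t : R) (N : nat).

(** Differential inequalities are derived for partial sums, where termwise
    differentiation is free of convergence questions; all bounds are uniform in
    [N]. *)
Definition wild_partial N f t := expR (- t) * \sum_(n < N) (1 - expR (- t)) ^+ n * f n.

Let gains N f t := expR (- t) *
  (expR (- t) * \sum_(n < N.-1) n.+1%:R * (1 - expR (- t)) ^+ n * f n.+1).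

(** The factor [n + 1] produced by differentiating [u ^ (n + 1)] cancels the
    average in the definition of the Wild terms. *)
Lemma is_derive_wild_partial N f t :
  is_derive t 1 (wild_partial N f) (gains N f t - wild_partial N f t).
Proof.
apply: (is_derive_change
  (is_derive_lM (is_derive_expN t) (is_derive_rate_series N f t))).
by rewrite /gains /wild_partial; ring.
Qed.

Lemma wild_partial_ge0 N f t : (forall n, 0 <= f n) -> 0 <= t ->
  0 <= wild_partial N f t.
Proof.
move=> f0 t0; have /andP[u0 _] := wild_rate t0.
apply: mulr_ge0; first exact: expR_ge0.
by apply: sumr_ge0 => n _; apply: mulr_ge0 => //; exact: exprn_ge0.
Qed.

Lemma wild_partial_le N f g t : (forall n, f n <= g n) -> 0 <= t ->
  wild_partial N f t <= wild_partial N g t.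
Proof.
move=> fg t0; have /andP[u0 _] := wild_rate t0.
apply: ler_wpM2l; first exact: expR_ge0.
by apply: ler_sum => n _; apply: ler_wpM2l => //; exact: exprn_ge0.
Qed.

Lemma wild_partialD N f g t :
  wild_partial N (fun n => f n + g n) t = wild_partial N f t + wild_partial N g t.
Proof.
rewrite /wild_partial -mulrDr -big_split/=; congr (_ * _).
by apply: eq_bigr => n _; rewrite mulrDr.
Qed.

Lemma wild_partialZ N (k : R) f t :
  wild_partial N (fun n => k * f n) t = k * wild_partial N f t.
Proof.
rewrite /wild_partial [RHS]mulrCA [k * _]mulr_sumr; congr (_ * _).
by apply: eq_bigr => n _; rewrite mulrCA.
Qed.

Lemma wild_partial1 N t : 0 <= t -> wild_partial N (fun=> 1) t <= 1.
Proof.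
move=> t0; have /andP[u0 u1] := wild_rate t0.
have -> : wild_partial N (fun=> 1) t = 1 - (1 - expR (- t)) ^+ N; last first.
  by have := exprn_ge0 N u0; lra.
rewrite /wild_partial -[X in _ = X - _](expr1n _ N) subrXX.
have -> : 1 - (1 - expR (- t)) = expR (- t) by ring.
congr (_ * _); apply: eq_bigr => n _.
by rewrite expr1n mul1r mulr1.
Qed.

Lemma wild_partial_at0 N f : (forall n, 0 <= f n) -> wild_partial N f 0 <= f 0%N.
Proof.
move=> f0; rewrite /wild_partial oppr0 expR0 subrr mul1r.
case: N => [|N]; first by rewrite big_ord0.
rewrite big_ord_recl big1 => [|n _]; last by rewrite expr0n mul0r.
by rewrite expr0 mul1r addr0.
Qed.

(** For nonnegative terms the triangle is a part of the full product, so the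
    partial sums satisfy the moment equation with an inequality. *)
Lemma wild_partial_conv N f g t : (forall n, 0 <= f n) -> (forall n, 0 <= g n) ->
  0 <= t ->
  expR (- t) * (expR (- t) * \sum_(n < N.-1) (1 - expR (- t)) ^+ n *
    \sum_(j < n.+1) f j * g (n - j)%N) <= wild_partial N f t * wild_partial N g t.
Proof.
move=> f0 g0 t0; have /andP[u0 _] := wild_rate t0.
set e := expR (- t); have e0 : 0 <= e by exact: expR_ge0.
rewrite wild_triangle /wild_partial -/e.
set u := 1 - e in u0 *.
have le_sum M M' (h : nat -> R) : (forall n, 0 <= h n) -> (M <= M')%N ->
    \sum_(n < M) u ^+ n * h n <= \sum_(n < M') u ^+ n * h n.
  move=> h0 MM'; rewrite -(subnKC MM') big_split_ord/= lerDl.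
  by apply: sumr_ge0 => n _; apply: mulr_ge0 => //; exact: exprn_ge0.
have -> : e * (\sum_(n < N) u ^+ n * f n) * (e * \sum_(n < N) u ^+ n * g n) =
   e * (e * ((\sum_(n < N) u ^+ n * f n) * \sum_(n < N) u ^+ n * g n)) by ring.
do 2!apply: ler_wpM2l => //.
apply: (@le_trans _ _ ((\sum_(n < N.-1) u ^+ n * f n) * \sum_(n < N) u ^+ n * g n)).
  rewrite mulr_suml; apply: ler_sum => j _; apply: ler_wpM2l.
    by apply: mulr_ge0 => //; exact: exprn_ge0.
  by apply: le_sum => //; rewrite (leq_trans (leq_subr _ _))// leq_pred.
apply: ler_wpM2r; last by apply: le_sum => //; exact: leq_pred.
by apply: sumr_ge0 => n _; apply: mulr_ge0 => //; exact: exprn_ge0.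
Qed.

Lemma gains_le N f h t : 0 <= t ->
  (forall n, n.+1%:R * f n.+1 <= h n) ->
  gains N f t <= expR (- t) * (expR (- t) * \sum_(n < N.-1) (1 - expR (- t)) ^+ n * h n).
Proof.
move=> t0 fh; have /andP[u0 _] := wild_rate t0.
do 2!(apply: ler_wpM2l; first exact: expR_ge0).
apply: ler_sum => n _; rewrite [_ * _ ^+ n]mulrC -mulrA.
by apply: ler_wpM2l => //; exact: exprn_ge0.
Qed.

Lemma sum_reflect f n : \sum_(j < n.+1) f (n - j)%N = \sum_(j < n.+1) f j.
Proof.
rewrite (reindex_inj rev_ord_inj)/=; apply: eq_bigr => j _.
by rewrite subSS subKn// -ltnS.
Qed.

Lemma conv_one_le N f t : (forall n, 0 <= f n) -> 0 <= t ->
  expR (- t) * (expR (- t) * \sum_(n < N.-1) (1 - expR (- t)) ^+ n *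
    \sum_(j < n.+1) f j) <= wild_partial N f t.
Proof.
move=> f0 t0; have := wild_partial_conv N f0 (fun=> ler01) t0.
under eq_bigr do under eq_bigr do rewrite mulr1.
move/le_trans; apply; rewrite -[leRHS]mulr1.
by apply: ler_wpM2l; [exact: wild_partial_ge0|exact: wild_partial1].
Qed.

Section second_moment_decay.
Variables (s : nat -> R) (l2 r2 : R).
Hypothesis s_ge0 : forall n, 0 <= s n.
Hypothesis l2_ge0 : 0 <= l2.
Hypothesis r2_ge0 : 0 <= r2.
Hypothesis s_rec : forall n, n.+1%:R * s n.+1 =
  \sum_(j < n.+1) (l2 * s j + r2 * s (n - j)%N).

(** The second moments of the partial sums satisfy a linear differential
    inequality of rate [l2 + r2 - 1]. *)
Lemma second_moment_decay N t : 0 <= t ->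
  wild_partial N s t <= s 0%N * expR ((l2 + r2 - 1) * t).
Proof.
move=> t0; set k := l2 + r2 - 1.
pose g (t : R) := expR (- k * t) * wild_partial N s t.
pose dg (t : R) := - k * expR (- k * t) * wild_partial N s t +
  expR (- k * t) * (gains N s t - wild_partial N s t).
have dg_g (x : R) : is_derive x 1 g (dg x).
  exact: is_derive_lM (is_derive_lexp _ _) (is_derive_wild_partial N s x).
suff : g t <= g 0.
  rewrite /g mulr0 expR0 mul1r => h.
  have {h} h := le_trans h (wild_partial_at0 N s_ge0).
  have -> : wild_partial N s t = expR (- k * t) * wild_partial N s t * expR (k * t).
    by rewrite mulrAC -expRD -mulrDl addNr mul0r expR0 mul1r.
  by apply: ler_wpM2r => //; exact: expR_ge0.
apply: (nonincreasing_from0 t0 (fun x _ => dg_g x)).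
  move=> x x0; have x0' := ltW x0.
  have -> : dg x = expR (- k * x) * (gains N s x - (l2 + r2) * wild_partial N s x).
    by rewrite /dg /k; ring.
  rewrite pmulr_rle0 ?expR_gt0// subr_le0.
  have h n : n.+1%:R * s n.+1 <= (l2 + r2) * \sum_(j < n.+1) s j.
    rewrite s_rec big_split/= -!mulr_sumr sum_reflect -mulrDl.
    exact: lexx.
  apply: le_trans (gains_le N x0' h) _.
  under eq_bigr do rewrite mulrCA.
  rewrite -mulr_sumr 2!(mulrCA _ (l2 + r2)).
  apply: ler_wpM2l; first exact: addr_ge0.
  exact: conv_one_le.
exact: is_derive_cvg_at_right (dg_g 0).
Qed.

End second_moment_decay.

Section pth_moment_growth.
Variables (a b s : nat -> R) (p l2 r2 lp rp k : R).
Hypothesis p2 : 2 < p.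
Hypothesis a_ge0 : forall n, 0 <= a n.
Hypothesis b_ge0 : forall n, 0 <= b n.
Hypothesis s_ge0 : forall n, 0 <= s n.
Hypothesis l2_ge0 : 0 <= l2.
Hypothesis r2_ge0 : 0 <= r2.
Hypothesis lp_ge0 : 0 <= lp.
Hypothesis rp_ge0 : 0 <= rp.
Hypothesis k_ge0 : 0 <= k.
Hypothesis s_rec : forall n, n.+1%:R * s n.+1 =
  \sum_(j < n.+1) (l2 * s j + r2 * s (n - j)%N).
Hypothesis a_rec : forall n, n.+1%:R * a n.+1 <=
  \sum_(j < n.+1) (lp * a j + rp * a (n - j)%N +
    k * (b j * s (n - j)%N + s j * b (n - j)%N)).
Hypothesis b_young : forall n (delta sigma : R), 0 < delta -> 0 <= sigma ->
  b n * sigma ^+ 2 <= delta * a n + delta `^ (- ((p - 2) / 2)) * sigma `^ p.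

Let k' := 2 * k + 1.
Let q := (p - 2) / 2.
Let kp := lp + rp - 1.
Let k2 := l2 + r2 - 1.

(** The constant [k'] is positive and bounds the coefficient of the coupling
    term; [delta / k'] in place of [delta] normalizes the linear term. *)
Definition pth_growth_constant := k' * k'^-1 `^ (- q) * s 0%N `^ (p / 2).

Lemma gains_pth N t : 0 <= t -> gains N a t <=
  (lp + rp) * wild_partial N a t + k' * (wild_partial N b t * wild_partial N s t).
Proof.
move=> t0; set D := wild_partial N b t * wild_partial N s t.
have D0 : 0 <= D by apply: mulr_ge0; exact: wild_partial_ge0.
pose h n := (lp + rp) * \sum_(j < n.+1) a j +
   k * (\sum_(j < n.+1) b j * s (n - j)%N + \sum_(j < n.+1) s j * b (n - j)%N).
have ah n : n.+1%:R * a n.+1 <= h n.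
  apply: le_trans (a_rec n) _; rewrite !big_split/= -!mulr_sumr big_split/= /h.
  by rewrite sum_reflect -mulrDl.
apply: le_trans (gains_le N t0 ah) _.
have -> : expR (- t) * (expR (- t) *
    \sum_(n < N.-1) (1 - expR (- t)) ^+ n * h n) =
    (lp + rp) * (expR (- t) * (expR (- t) * \sum_(n < N.-1) (1 - expR (- t)) ^+ n *
      \sum_(j < n.+1) a j)) +
    (k * (expR (- t) * (expR (- t) * \sum_(n < N.-1) (1 - expR (- t)) ^+ n *
      \sum_(j < n.+1) b j * s (n - j)%N)) +
     k * (expR (- t) * (expR (- t) * \sum_(n < N.-1) (1 - expR (- t)) ^+ n *
      \sum_(j < n.+1) s j * b (n - j)%N))).
  rewrite !(mulrCA (lp + rp)) !(mulrCA k) -!mulrDr; congr (_ * (_ * _)).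
  rewrite -big_split/= !mulr_sumr -big_split/=; apply: eq_bigr => n _.
  by rewrite /h; ring.
apply: lerD.
  by apply: ler_wpM2l; [exact: addr_ge0|exact: conv_one_le].
apply: (@le_trans _ _ (k * D + k * D)); last first.
  by rewrite /k' [leRHS]mulrDl mul1r; lra.
apply: lerD; apply: ler_wpM2l => //; first exact: wild_partial_conv.
by rewrite /D [_ * wild_partial N s t]mulrC; exact: wild_partial_conv.
Qed.

(** With [sigma ^ 2] the bound of the second moment, Young's inequality splits
    the product of moments, and [sigma ^ p] evolves at the rate [p * k2 / 2]. *)
Lemma young_partial N t delta : 0 <= t -> 0 < delta ->
  wild_partial N b t * wild_partial N s t <= delta * wild_partial N a t +
    delta `^ (- q) * s 0%N `^ (p / 2) * expR (p * k2 / 2 * t).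
Proof.
move=> t0 d0; pose sigma := s 0%N `^ (1 / 2) * expR (k2 / 2 * t).
have sg0 : 0 <= sigma by rewrite mulr_ge0 ?powR_ge0 ?expR_ge0.
have sg2 : sigma ^+ 2 = s 0%N * expR (k2 * t).
  rewrite /sigma exprMn -powR_mulrn ?powR_ge0// -powRrM.
  have -> : 1 / 2 * 2%:R = 1 :> R by field.
  by rewrite powRr1// expr2 -expRD; congr (_ * expR _); field.
have sgp : sigma `^ p = s 0%N `^ (p / 2) * expR (p * k2 / 2 * t).
  rewrite /sigma powRM ?powR_ge0 ?expR_ge0// -powRrM -expRM.
  by congr (_ `^ _ * expR _); field.
have hs := second_moment_decay s_ge0 l2_ge0 r2_ge0 s_rec N t0.
apply: (@le_trans _ _ (wild_partial N b t * sigma ^+ 2)).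
  by rewrite sg2; apply: ler_wpM2l => //; exact: wild_partial_ge0.
rewrite mulrC -wild_partialZ.
apply: (@le_trans _ _ (wild_partial N
   (fun n => delta * a n + (delta `^ (- q) * sigma `^ p) * 1) t)).
  by apply: wild_partial_le => // n; rewrite mulrC mulr1; exact: b_young.
rewrite wild_partialD !wild_partialZ lerD2l -[leRHS]mulrA -sgp.
rewrite -[leRHS]mulr1; apply: ler_wpM2l; last exact: wild_partial1.
by rewrite mulr_ge0 ?powR_ge0.
Qed.

Lemma young_growth_pth N : young_growth (a 0%N) pth_growth_constant q
  (p * k2 / 2 - kp) (fun t => expR (- kp * t) * wild_partial N a t)
  (fun t => - kp * expR (- kp * t) * wild_partial N a t +
     expR (- kp * t) * (gains N a t - wild_partial N a t)).
Proof.
have k'0 : 0 < k' by rewrite /k'; move: k_ge0 => k0; lra.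
split=> [t||t delta t0 d0].
- exact: is_derive_lM (is_derive_lexp _ _) (is_derive_wild_partial N a t).
- by rewrite mulr0 expR0 mul1r; exact: wild_partial_at0.
have dk0 : 0 < delta / k' by exact: divr_gt0.
have hg := gains_pth N t0; have hy := young_partial N t0 dk0.
apply: (@le_trans _ _ (expR (- kp * t) *
   (k' * (wild_partial N b t * wild_partial N s t)))).
  rewrite [- kp * _]mulrC -mulrA -mulrDr.
  apply: ler_wpM2l; first exact: expR_ge0.
  by rewrite /kp; lra.
apply: (@le_trans _ _ (expR (- kp * t) * (k' * (delta / k' * wild_partial N a t +
   (delta / k') `^ (- q) * s 0%N `^ (p / 2) * expR (p * k2 / 2 * t))))).
  by apply: ler_wpM2l; [exact: expR_ge0|apply: ler_wpM2l => //; exact: ltW].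
rewrite powRM ?invr_ge0//; [|exact: ltW..].
rewrite /pth_growth_constant mulrBl expRD -(mulNr kp) le_eqVlt; apply/orP; left; apply/eqP.
by field; rewrite gt_eqF.
Qed.

Lemma pth_growth_constant_ge0 : 0 <= pth_growth_constant.
Proof.
rewrite /pth_growth_constant !mulr_ge0 ?powR_ge0//.
by rewrite /k'; move: k_ge0 => k0; lra.
Qed.

Lemma pth_q_gt0 : 0 < q.
Proof. by rewrite /q; move: p2 => p2'; lra. Qed.

Let wa N t : wild_partial N a t = expR (kp * t) * (expR (- kp * t) * wild_partial N a t).
Proof. by rewrite mulrA -expRD -mulrDl subrr mul0r expR0 mul1r. Qed.

Lemma pth_moment_gt : kp < p * k2 / 2 -> exists C : R, forall N t, 0 <= t ->
  wild_partial N a t <= C * expR (p * k2 / 2 * t).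
Proof.
rewrite -subr_gt0 => c0.
have [C hC] := growth_gt0 q (a_ge0 0%N) pth_growth_constant_ge0 c0.
exists C => N t t0; rewrite wa.
apply: le_trans (ler_wpM2l (expR_ge0 _) (hC _ _ (young_growth_pth N) t t0)) _.
by rewrite mulrCA -expRD -mulrDl addrC subrK.
Qed.

Lemma pth_moment_eq : kp = p * k2 / 2 -> exists C : R, forall N t, 0 <= t ->
  wild_partial N a t <= C * (1 + t) `^ (p / 2) * expR (kp * t).
Proof.
move=> e; have [C hC] := growth_eq0 (a_ge0 0%N) pth_growth_constant_ge0 pth_q_gt0.
exists C => N t t0; rewrite wa [leRHS]mulrC.
apply: ler_wpM2l; first exact: expR_ge0.
have -> : p / 2 = q + 1 by rewrite /q; field.
have := young_growth_pth N; rewrite -e subrr => h; exact: hC h t t0.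
Qed.

Lemma pth_moment_lt : p * k2 / 2 < kp -> exists C : R, forall N t, 0 <= t ->
  wild_partial N a t <= C * expR (kp * t).
Proof.
rewrite -subr_lt0 => c0.
have [C hC] := growth_lt0 (a 0%N) pth_growth_constant_ge0 pth_q_gt0 c0.
exists C => N t t0; rewrite wa [leRHS]mulrC.
apply: ler_wpM2l; first exact: expR_ge0.
apply: hC (young_growth_pth N) t t0 => x x0.
by apply: mulr_ge0; [exact: expR_ge0|exact: wild_partial_ge0].
Qed.

End pth_moment_growth.

End wild_partial_sums.

(** * Moments of the Wild sum *)

Section wild_cost.
Context (R : realType) dO (Omega : measurableType dO) (P : probability Omega R).
Context d (T : measurableType d).
Variable op : {mfun (Omega * (T * T))%type >-> T}.
Variables (L Rr : Omega -> R) (l : T -> R) (p : R).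
Hypothesis mL : measurable_fun setT L.
Hypothesis mRr : measurable_fun setT Rr.
Hypothesis L0 : forall w, 0 <= L w.
Hypothesis Rr0 : forall w, 0 <= Rr w.
Hypothesis ml : measurable_fun setT l.
Hypothesis l_op : forall w z z', l (op (w, (z, z'))) = L w * l z + Rr w * l z'.
Hypothesis p2 : 2 < p.
Hypothesis iL : integrableR P (fun w => L w `^ p).
Hypothesis iRr : integrableR P (fun w => Rr w `^ p).
Variable m0 : probability T R.
Hypothesis cm0 : centered l p m0.
Local Notation rho := (wild P op m0).

Let moment_ge0 (m : probability T R) r : 0 <= moment l m r.
Proof. by apply: Rintegral_ge0 => z _; exact: powR_ge0. Qed.

Let cmn n : centered l p (rho n).
Proof. exact: (wild_centered mL mRr L0 Rr0 ml l_op p2 iL iRr cm0 n). Qed.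

(** The bounds on the partial sums pass to the limit by monotone convergence,
    which also gives integrability. *)
Lemma moment_wild_sum_le t M : 0 <= t ->
  (forall N, wild_partial N (fun n => moment l (rho n) p) t <= M) ->
  moment l (wild_sum P op m0 t) p <= M /\
  integrableR (wild_sum P op m0 t) (fun z => `|l z| `^ p).
Proof.
move=> t0 hM.
have sE N : \sum_(n < N) wild_weight t n * moment l (rho n) p =
    wild_partial N (fun n => moment l (rho n) p) t.
  by rewrite /wild_partial mulr_sumr; apply: eq_bigr => n _; rewrite mulrA.
have [] := @mixture_int _ _ _ (wild_weight t) rho (fun z => `|l z| `^ p) M
  (weights_wild t0) (fun n => (cmn n).1).
  move=> N; apply: le_trans (hM N); rewrite -sE.
  apply: ler_sum => n _; rewrite le_eqVlt; apply/orP; left; apply/eqP.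
  by congr (_ * _); apply: int_ext => z; rewrite ger0_norm// powR_ge0.
move=> im cvm; split => //; apply: (ler_cvg_to cvm (cvg_cst M)); near=> N.
by have := hM N; rewrite -sE.
Unshelve. all: by end_near. Qed.

Lemma moment_young (m : probability T R) (delta sigma : R) : centered l p m -> 0 < delta -> 0 <= sigma ->
  moment l m (p - 2) * sigma ^+ 2 <=
  delta * moment l m p + delta `^ (- ((p - 2) / 2)) * sigma `^ p.
Proof.
move=> [im _] d0 s0.
have hp2 : 0 <= p - 2 <= p by move: p2 => p2'; apply/andP; split; lra.
have i2 := integrable_lower_power ml im hp2.
have c : integrableR m (fun=> delta `^ (- ((p - 2) / 2)) * sigma `^ p).
  exact/bm_integrable/bm_cst.
rewrite mulrC /moment -(intZ _ i2) -(intZ _ im).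
rewrite -[X in _ <= _ + X](int_cst m) -(intD (integrableRZ _ im) c).
apply: int_le; [exact: integrableRZ| |].
  by apply: integrableRD => //; exact: integrableRZ.
by move=> z; rewrite mulrC; exact: powR_young.
Qed.

(** The function [S] of the kinetic equation, split into the two integrals in
    which the recursions for the moments express it. *)
Definition loss r := \int[P]_w L w `^ r + \int[P]_w Rr w `^ r - 1.

Lemma wild_cost : exists C : R, forall t, 0 <= t ->
  moment l (wild_sum P op m0 t) p <=
    (if loss p == p * loss 2 / 2 then C * (1 + t) `^ (p / 2) * expR (loss p * t)
     else C * expR (Num.max (loss p) (p * loss 2 / 2) * t)) /\
  integrableR (wild_sum P op m0 t) (fun z => `|l z| `^ p).
Proof.
pose a n := moment l (rho n) p; pose s n := moment l (rho n) 2.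
pose b n := moment l (rho n) (p - 2).
pose k := cross_constant p * \int[P]_w (L w `^ p + Rr w `^ p).
have k0 : 0 <= k.
  apply: mulr_ge0; first exact: cross_constant_ge0.
  by apply: Rintegral_ge0 => w _; rewrite addr_ge0 ?powR_ge0.
have e0 r (X : Omega -> R) : 0 <= \int[P]_w X w `^ r.
  by apply: Rintegral_ge0 => w _; exact: powR_ge0.
have srec n : n.+1%:R * s n.+1 = \sum_(j < n.+1)
   (\int[P]_w L w `^ 2 * s j + \int[P]_w Rr w `^ 2 * s (n - j)%N).
  exact: (wild_second_moment_rec mL mRr L0 Rr0 ml l_op p2 iL iRr cm0 n).
have arec n : n.+1%:R * a n.+1 <= \sum_(j < n.+1)
   (\int[P]_w L w `^ p * a j + \int[P]_w Rr w `^ p * a (n - j)%N +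
    k * (b j * s (n - j)%N + s j * b (n - j)%N)).
  exact: (wild_moment_rec mL mRr L0 Rr0 ml l_op p2 iL iRr cm0 n).
have by_ n (delta sigma : R) : 0 < delta -> 0 <= sigma -> b n * sigma ^+ 2 <=
    delta * a n + delta `^ (- ((p - 2) / 2)) * sigma `^ p.
  exact: moment_young (cmn n).
have a0 n : 0 <= a n by exact: moment_ge0.
have b0 n : 0 <= b n by exact: moment_ge0.
have s0 n : 0 <= s n by exact: moment_ge0.
case: (ltgtP (loss p) (p * loss 2 / 2)) => h.
- have [C hC] := pth_moment_gt a0 b0 s0 (e0 2 L) (e0 2 Rr) (e0 p L) (e0 p Rr) k0
    srec arec by_ h.
  by exists C => t t0; apply: moment_wild_sum_le => // N; exact: hC.
- have [C hC] := pth_moment_lt p2 a0 b0 s0 (e0 2 L) (e0 2 Rr) (e0 p L) (e0 p Rr) k0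
    srec arec by_ h.
  by exists C => t t0; apply: moment_wild_sum_le => // N; exact: hC.
- have [C hC] := pth_moment_eq p2 a0 b0 s0 (e0 2 L) (e0 2 Rr) (e0 p L) (e0 p Rr) k0
    srec arec by_ h.
  by exists C => t t0; apply: moment_wild_sum_le => // N; exact: hC.
Qed.

End wild_cost.

(** * The slope of the sine transform at the origin *)

Section sine_bounds.
Context (R : realType).
Implicit Types u v x : R.

Let mvt (f df : R -> R) u v : u <= v -> (forall x, is_derive x 1 f (df x)) ->
  exists2 z, u <= z <= v & f v - f u = df z * (v - u).
Proof.
move=> uv fd; have cf : {within `[u, v], continuous f}.
  apply: continuous_subspaceT => x.
  by apply: differentiable_continuous; apply/derivable1_diffP; have [] := fd x.
have [z] := MVT_segment uv (fun x (_ : x \in `]u, v[%R) => fd x) cf.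
by rewrite in_itv/= => hz e; exists z.
Qed.

Lemma one_sub_cos_le v : 0 <= v -> 1 - cos v <= v.
Proof.
move=> v0; have [z _] := mvt v0 (@is_derive_cos R).
rewrite cos0 subr0 => e; have := sin_le1 z; nra.
Qed.

Lemma sin_sub_id_lipschitz u v : 0 <= u -> u <= v ->
  `|(sin v - v) - (sin u - u)| <= v * (v - u).
Proof.
move=> u0 uv; pose df x : R := cos x - 1.
have fd x : is_derive x 1 (fun x => sin x - x) (df x).
  by apply: is_deriveB.
have [z /andP[uz zv] ->] := mvt uv fd.
have vu : 0 <= v - u by rewrite subr_ge0.
rewrite normrM [`|v - u|]ger0_norm// ler_wpM2r//.
have := one_sub_cos_le (le_trans u0 uz); have := cos_le1 z.
by move=> c1 c2; rewrite /df ler0_norm; lra.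
Qed.

Lemma norm_sin_sub_id x : `|sin x - x| <= x ^+ 2.
Proof.
wlog x0 : x / 0 <= x.
  move=> h; have [/h//|x0] := leP 0 x.
  rewrite -normrN opprB -sqrrN.
  have -> : x - sin x = sin (- x) - (- x) by rewrite sinN; ring.
  by apply: h; rewrite oppr_ge0 ltW.
have := sin_sub_id_lipschitz (lexx 0) x0.
by rewrite sin0 !subr0 expr2.
Qed.

Lemma norm_sin_sub u v : `|sin u - sin v| <= `|u - v|.
Proof.
wlog uv : u v / v <= u.
  move=> h; have [/h//|/ltW/h] := leP v u.
  by rewrite [X in X <= _]distrC [X in _ <= X]distrC.
have [z _ ->] := mvt uv (@is_derive_sin R).
by rewrite normrM ler_piMl// norm_cos_le1.
Qed.

Lemma norm_sin_le x : `|sin x| <= `|x|.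
Proof. by have := norm_sin_sub x 0; rewrite sin0 !subr0. Qed.

End sine_bounds.

Section slope_of_a_heavy_tailed_law.
Context (R : realType).
Variable m : probR R.
Implicit Types (x y rho xi : R).

Definition upper y x : R := (y <= x)%R%:R.
Definition lower y x : R := (x <= - y)%R%:R.

Lemma measurable_mem_itv (i : interval R) :
  measurable_fun setT (fun x : measurableTypeR R => (x \in i)%:R : R).
Proof.
have -> : (fun x : R => (x \in i)%:R : R) = \1_[set` i].
  by apply/funext => x; rewrite indicE mem_setE.
exact: measurable_indic.
Qed.

Let indicator_bounded (P : R -> bool) : exists M : R, forall x, `|(P x)%:R : R| <= M.
Proof. by exists 1 => x; rewrite ger0_norm ?ler0n// -[leRHS]/(1%:R) ler_nat leq_b1. Qed.

Lemma bm_upper y : bounded_measurable (upper y).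
Proof.
split; last exact: indicator_bounded.
have -> : upper y = fun x => (x \in `[y, +oo[)%:R.
  by apply/funext => x; rewrite in_itv/= andbT.
exact: measurable_mem_itv.
Qed.

Lemma bm_lower y : bounded_measurable (lower y).
Proof.
split; last exact: indicator_bounded.
have -> : lower y = fun x => (x \in `]-oo, - y])%:R by apply/funext => x; rewrite in_itv.
exact: measurable_mem_itv.
Qed.

Definition upper_tail y := \int[m]_x upper y x.
Definition lower_tail y := \int[m]_x lower y x.

(** For [0 < y <= rho] this is [sg x] on [y <= |x| < rho]: its integral is the
    imbalance between the two tails, of order [o (1 / y)] when both tails have
    the same constant. *)
Definition shell rho y x := (upper y x - upper rho x) - (lower y x - lower rho x).

Lemma bm_shell rho y : bounded_measurable (shell rho y).
Proof. by apply: bmB; apply: bmB; [exact: bm_upper..|exact: bm_lower|exact: bm_lower]. Qed.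

Lemma int_shell rho y : \int[m]_x shell rho y x =
  (upper_tail y - upper_tail rho) - (lower_tail y - lower_tail rho).
Proof.
have iu z := bm_integrable m (bm_upper z); have il z := bm_integrable m (bm_lower z).
rewrite intB; [|by apply: bm_integrable; apply: bmB; exact: bm_upper
               |by apply: bm_integrable; apply: bmB; exact: bm_lower].
by rewrite !intB.
Qed.

Lemma upperN y x : upper y (- x) = lower y x.
Proof. by rewrite /upper /lower lerNr. Qed.

Lemma lowerN y x : lower y (- x) = upper y x.
Proof. by rewrite /upper /lower lerN2. Qed.

Lemma shellN rho y x : shell rho y (- x) = - shell rho y x.
Proof. by rewrite /shell !upperN !lowerN [RHS]opprB. Qed.

Lemma shell_pos rho y x : 0 < y -> y <= rho -> 0 <= x ->
  shell rho y x = (y <= x < rho)%R%:R.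
Proof.
move=> y0 yr x0; rewrite /shell /upper /lower.
have -> : (x <= - y) = false by apply/negbTE; rewrite -ltNge; lra.
have -> : (x <= - rho) = false by apply/negbTE; rewrite -ltNge; lra.
case: (leP y x) => yx; case: (leP rho x) => rx /=; rewrite ?subrr ?subr0 ?sub0r ?oppr0//.
by exfalso; lra.
Qed.

Variables (xi y0 delta : R).
Hypotheses (xi0 : 0 < xi) (y00 : 0 < y0) (delta0 : 0 < delta).

Let h x := sin (xi * x) / xi - x.
Let y i := y0 + i%:R * delta.
Let w i := h (y i) - (if i is j.+1 then h (y j) else 0).

(** The derivative of [h] is [cos (xi x) - 1], of modulus at most [xi x]. *)
Lemma h_lipschitz a b : 0 <= a -> a <= b -> `|h b - h a| <= xi * b * (b - a).
Proof.
move=> a0 ab.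
have -> : h b - h a = ((sin (xi * b) - xi * b) - (sin (xi * a) - xi * a)) / xi.
  by rewrite /h; field; rewrite gt_eqF.
have xi1 : 0 <= xi^-1 by rewrite invr_ge0 ltW.
rewrite normrM [`|xi^-1|]ger0_norm// ler_pdivrMr//.
have := @sin_sub_id_lipschitz _ (xi * a) (xi * b).
move=> /(_ (mulr_ge0 (ltW xi0) a0) (ler_wpM2l (ltW xi0) ab)) /le_trans; apply.
by rewrite le_eqVlt; apply/orP; left; apply/eqP; ring.
Qed.

Let h0 : h 0 = 0.
Proof. by rewrite /h mulr0 sin0 mul0r subr0. Qed.

Let hN x : h (- x) = - h x.
Proof. by rewrite /h mulrN sinN mulNr opprB opprK addrC. Qed.

Let y_gt0 i : 0 < y i.
Proof. by rewrite /y ltr_pwDl// mulr_ge0// ltW. Qed.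

Let y_le i j : (i <= j)%N -> y i <= y j.
Proof. by move=> ij; rewrite lerD2l ler_wpM2r ?ler_nat// ltW. Qed.

(** [h] is approximated by the staircase with steps at the [y i]; this replaces
    an integration by parts against the distribution function. *)
Lemma staircase_approx K r : y0 <= r -> r <= y K + delta ->
  `|h r - \sum_(i < K.+1) w i * (y i <= r)%R%:R| <= xi * r * delta.
Proof.
have wS n : \sum_(i < n.+1) w i = h (y n).
  elim: n => [|n IH]; first by rewrite big_ord_recr big_ord0/= add0r /w subr0.
  by rewrite big_ord_recr/= IH /w addrC subrK.
move=> yr; elim: K => [|K IH] rK.
  rewrite big_ord_recr big_ord0/= add0r /w subr0 /y mul0r addr0 yr mulr1.
  rewrite /y mul0r addr0 in rK.
  apply: le_trans (h_lipschitz (ltW y00) yr) _; rewrite ler_wpM2l//.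
    by apply: mulr_ge0; [exact: ltW|exact: le_trans (ltW y00) yr].
  by rewrite lerBlDl.
have [r_lt|r_ge] := ltP r (y K.+1).
  rewrite big_ord_recr/= [y K.+1 <= r]leNgt r_lt/= mulr0 addr0; apply: IH.
  by move: (ltW r_lt); rewrite /y -natr1 mulrDl mul1r addrA.
have E (i : 'I_K.+2) : w i * (y i <= r)%R%:R = w i.
  by rewrite (le_trans _ r_ge) ?mulr1// y_le// -ltnS.
under eq_bigr do rewrite E.
rewrite wS; apply: le_trans (h_lipschitz (ltW (y_gt0 _)) r_ge) _.
rewrite ler_wpM2l//.
  by apply: mulr_ge0; [exact: ltW|exact: le_trans (ltW y00) yr].
by rewrite lerBlDl.
Qed.

Variable K : nat.
Let rho := y K.

(** Beyond [rho] the sine is bounded by 1, below [y0] the function [h] is at most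
    [xi y0 ^ 2], and in between it is a staircase; oddness reduces the claim to
    [x >= 0]. *)
Lemma sine_staircase x :
  `|sin (xi * x) / xi - x * (- rho < x < rho)%R%:R -
    \sum_(i < K.+1) w i * shell rho (y i) x| <=
  xi^-1 * (upper rho x + lower rho x) + (xi * y0 ^+ 2 + xi * rho * delta).
Proof.
have ylt (i : 'I_K.+1) : y i <= rho by apply: y_le; rewrite -ltnS.
wlog x0 : x / 0 <= x.
  move=> H; have [/H//|/ltW x0] := leP 0 x.
  have := H (- x); rewrite oppr_ge0 => /(_ x0).
  rewrite mulrN sinN ltrNr ltrNl opprK [(_ < rho) && _]andbC.
  under eq_bigr do rewrite shellN// mulrN.
  rewrite sumrN mulNr mulNr -!opprD normrN upperN lowerN.
  by rewrite [upper _ _ + _]addrC.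
under eq_bigr do rewrite shell_pos//.
have xi1 : 0 <= xi^-1 by rewrite invr_ge0 ltW.
have A1 : 0 <= xi * y0 ^+ 2 by rewrite mulr_ge0 ?sqr_ge0 ?ltW.
have A2 : 0 <= xi * rho * delta by rewrite !mulr_ge0 ?ltW ?y_gt0.
have A3 : 0 <= xi^-1 * (upper rho x + lower rho x).
  by rewrite mulr_ge0// addr_ge0 ?ler0n.
have [rx|xr] := leP rho x.
  under eq_bigr do rewrite andbF mulr0.
  rewrite andbF mulr0 big1// !subr0 normrM [`|xi^-1|]ger0_norm// mulrC.
  apply: (@le_trans _ _ (xi^-1 * (upper rho x + lower rho x))); last by lra.
  rewrite ler_wpM2l//; apply: le_trans (norm_sin_le1 _) _.
  by rewrite /upper rx lerDl ler0n.
have -> : (- rho < x) by apply: lt_le_trans x0; rewrite oppr_lt0 y_gt0.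
rewrite /= mulr1 -/(h x).
under eq_bigr do rewrite andbT.
have [xy0|y0x] := ltP x y0.
  rewrite big1 => [|i _]; last first.
    by rewrite leNgt (lt_le_trans xy0) ?mulr0// lerDl mulr_ge0// ltW.
  rewrite subr0; have := h_lipschitz (lexx 0) x0; rewrite h0 !subr0 => /le_trans; apply.
  have xx : x * x <= y0 * y0 by apply: ler_pM => //; exact: ltW.
  have : xi * (x * x) <= xi * (y0 * y0) by rewrite ler_wpM2l// ltW.
  by move: A2 A3; rewrite expr2 mulrA; lra.
have rK : x <= y K + delta by apply: le_trans (ltW xr) _; rewrite lerDl ltW.
apply: le_trans (staircase_approx y0x rK) _.
have : xi * x * delta <= xi * rho * delta.
  apply: ler_wpM2r; first exact: ltW.
  by apply: ler_wpM2l; exact: ltW.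
by lra.
Qed.

Let S x := \sum_(i < K.+1) w i * shell rho (y i) x.

Lemma bm_truncated_id r : bounded_measurable (fun x => x * (- r < x < r)%R%:R).
Proof.
split.
  apply: measurable_funM => //.
  have -> : (fun x : R => (- r < x < r)%R%:R : R) = fun x => (x \in `]- r, r[)%:R.
    by apply/funext => x; rewrite in_itv.
  exact: measurable_mem_itv.
exists `|r| => x; case: (boolP (- r < x < r)) => [/andP[a b]|_]; last first.
  by rewrite mulr0 normr0.
by rewrite mulr1; apply: le_trans (ler_norm r); rewrite ler_norml !ltW.
Qed.

Let bm_int_staircase : bounded_measurable S /\
  \int[m]_x S x = \sum_(i < K.+1) w i * \int[m]_x shell rho (y i) x.
Proof.
rewrite /S; elim: K.+1 => [|n [bn En]].
  rewrite big_ord0; under eq_fun do rewrite big_ord0.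
  by split; [exact: bm_cst|exact: int_cst].
rewrite big_ord_recr/= -En.
under eq_fun do rewrite big_ord_recr/=.
have bs := bmZ (w n) (bm_shell rho (y n)).
split; first exact: bmD.
rewrite -intZ; last by apply: bm_integrable; exact: bm_shell.
by rewrite -intD; [|exact: bm_integrable..].
Qed.

Variables (c eps : R).
Hypothesis tails : forall z, y0 <= z ->
  `|z * upper_tail z - c| <= eps /\ `|z * lower_tail z - c| <= eps.

Let wle (i : nat) : `|w i| <= xi * y i * (y i - (if i is j.+1 then y j else 0)).
Proof.
rewrite /w; case: i => [|i].
  by have := h_lipschitz (lexx 0) (ltW (y_gt0 0)); rewrite h0.
by apply: h_lipschitz; [exact: ltW|exact: y_le].
Qed.

Let shell_small (i : nat) : (i <= K)%N ->
  y i * `|\int[m]_x shell rho (y i) x| <= 4 * eps.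
Proof.
move=> iK; rewrite int_shell.
have yi := y_le iK; have y0i : y0 <= y i by rewrite lerDl mulr_ge0// ltW.
have y0r := le_trans y0i yi; have yi0 := y_gt0 i.
have r0 : 0 < rho by exact: lt_le_trans yi.
have [a1 a2] := tails y0i; have [a3 a4] := tails y0r.
have e0 : 0 <= eps by exact: le_trans a1.
pose t := y i / rho.
have t0 : 0 <= t by rewrite divr_ge0 ?ltW.
have t1 : t <= 1 by rewrite ler_pdivrMr// mul1r.
rewrite -[X in X * _]gtr0_norm// -normrM.
have -> : y i * (upper_tail (y i) - upper_tail rho - (lower_tail (y i) - lower_tail rho)) =
   ((y i * upper_tail (y i) - c) - (y i * lower_tail (y i) - c)) -
   t * ((rho * upper_tail rho - c) - (rho * lower_tail rho - c)).
  by rewrite /t; field; rewrite gt_eqF.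
apply: le_trans (ler_normB _ _) _; rewrite normrM [`|t|]ger0_norm//.
have b1 := le_trans (ler_normB _ _) (lerD a1 a2).
have b2 := le_trans (ler_normB _ _) (lerD a3 a4).
have := ler_wpM2l t0 b2; have : t * (eps + eps) <= eps + eps by rewrite ler_piMl// addr_ge0.
by move: b1; lra.
Qed.

(** Each step of the staircase at [z] costs [xi z delta] times the imbalance of
    the tails, which is at most [4 eps / z]: the sum is [4 eps xi rho]. *)
Lemma slope_error : `|sin_transform m xi / xi - \int[m]_x (x * (- rho < x < rho)%R%:R)| <=
  xi^-1 * (2 * (c + eps) / rho) + (xi * y0 ^+ 2 + xi * rho * delta) + 4 * eps * (xi * rho).
Proof.
have xi1 : 0 <= xi^-1 by rewrite invr_ge0 ltW.
have r0 : 0 < rho by exact: y_gt0.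
have [bS ES] := bm_int_staircase.
have bsin : bounded_measurable (fun x : R => sin (xi * x)).
  by apply: bm_sin; exact: measurable_funM.
have bsx : bounded_measurable (fun x : R => sin (xi * x) / xi).
  by apply: bmM => //; exact: bm_cst.
have bt := bm_truncated_id rho.
have bul := bmD (bm_upper rho) (bm_lower rho).
have bE := bmB (bmB bsx bt) bS.
pose C := xi * y0 ^+ 2 + xi * rho * delta.
have bG := bmD (bmZ xi^-1 bul) (bm_cst (measurableTypeR R) C).
have := le_trans (int_norm_le (bm_integrable m bE))
  (int_le (integrableR_norm (bm_integrable m bE)) (bm_integrable m bG) (@sine_staircase)).
rewrite (intB (bm_integrable m (bmB bsx bt)) (bm_integrable m bS)).
rewrite (intB (bm_integrable m bsx) (bm_integrable m bt)).
rewrite (intD (bm_integrable m (bmZ xi^-1 bul)) (bm_integrable m (bm_cst _ C))).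
rewrite (intZ _ (bm_integrable m bul)) int_cst.
rewrite (intD (bm_integrable m (bm_upper rho)) (bm_integrable m (bm_lower rho))).
have -> : \int[m]_x (sin (xi * x) / xi) = sin_transform m xi / xi.
  by under int_ext do rewrite mulrC; rewrite (intZ _ (bm_integrable m bsin)) mulrC.
rewrite -/(upper_tail rho) -/(lower_tail rho) ES => H.
have y0r : y0 <= rho by rewrite lerDl mulr_ge0// ltW.
have [a1 a2] := tails y0r.
have tl : upper_tail rho + lower_tail rho <= 2 * (c + eps) / rho.
  rewrite ler_pdivlMr// mulrDl ![_ * rho]mulrC.
  by move: a1 a2; rewrite !ler_norml => /andP[_ a1] /andP[_ a2]; lra.
have := ler_wpM2l xi1 tl => tl'.
set W := \sum_(i < K.+1) _ in H *.
have Wle : `|W| <= 4 * eps * (xi * rho).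
  have tele n : \sum_(i < n.+1) (y i - (if (i : nat) is j.+1 then y j else 0)) = y n.
    elim: n => [|n IH]; first by rewrite big_ord_recr big_ord0/= add0r subr0.
    by rewrite big_ord_recr/= IH addrC subrK.
  rewrite -[rho](tele K) !mulr_sumr; apply: le_trans (ler_norm_sum _ _ _) _.
  apply: ler_sum => i _; rewrite normrM.
  have iK : (i <= K)%N by rewrite -ltnS.
  have d0 : 0 <= y i - (if (i : nat) is j.+1 then y j else 0).
    by case: (nat_of_ord i) => [|j]; rewrite subr_ge0 ?(ltW (y_gt0 _))// y_le.
  apply: le_trans (ler_wpM2r (normr_ge0 _) (wle i)) _.
  set D := y i - _ in d0 *; set I := `|_|.
  have := shell_small iK; rewrite -/I => hI.
  have := ler_wpM2l (mulr_ge0 (ltW xi0) d0) hI.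
  suff -> : xi * y i * D * I = xi * D * (y i * I).
    by move/le_trans; apply; rewrite mulrC.
  by ring.
set A := sin_transform m xi / xi - _ in H *.
have -> : A = (A - W) + W by rewrite subrK.
apply: le_trans (ler_normD _ _) _; apply: lerD => //.
by apply: le_trans H _; rewrite /C lerD2r.
Qed.

End slope_of_a_heavy_tailed_law.

Section sine_slope.
Context (R : realType) (m : probR R).
Variables c gamma : R.
Hypothesis upper_cvg : y * upper_tail m y @[y --> +oo] --> c.
Hypothesis lower_cvg : y * lower_tail m y @[y --> +oo] --> c.
Hypothesis truncated_cvg :
  \int[m]_x (x * (- rho < x < rho)%R%:R) @[rho --> +oo] --> gamma.

(** At the scale [rho = T / xi] the tails contribute [O (1 / T)] and the staircase
    [O (eps T)]: [T] is chosen first, then [eps], then [xi] small, and finally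
    the mesh [delta]. *)
Lemma sine_slope (e : R) : 0 < e -> exists2 x0 : R, 0 < x0 &
  forall xi : R, 0 < xi -> xi < x0 -> `|sin_transform m xi / xi - gamma| <= e.
Proof.
move=> e0.
pose T := 1 + 16 * (`|c| + 1) / e.
have cn := normr_ge0 c; have clec := ler_norm c.
have T0 : 1 <= T by rewrite lerDl divr_ge0 ?mulr_ge0 ?(ltW e0)// addr_ge0.
have T1 : 16 * (`|c| + 1) <= e * T.
  have -> : e * T = e + 16 * (`|c| + 1) by rewrite /T; field; rewrite gt_eqF.
  by rewrite lerDr ltW.
pose eps := Num.min 1 (e / (32 * T)).
have T00 : 0 < T by lra.
have eps0 : 0 < eps by rewrite lt_min ltr01 divr_gt0// mulr_gt0.
have eps1 : eps <= 1 by rewrite ge_min lexx.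
have epsT : 32 * eps * T <= e.
  have : eps <= e / (32 * T) by rewrite ge_min lexx orbT.
  by rewrite ler_pdivlMr ?mulr_gt0//; lra.
have : \forall y \near +oo, [/\ `|y * upper_tail m y - c| <= eps,
    `|y * lower_tail m y - c| <= eps &
    `|\int[m]_x (x * (- y < x < y)%R%:R) - gamma| <= e / 4].
  have e4 : 0 < e / 4 by rewrite divr_gt0.
  near=> y; split; near: y; [move/cvgrPdist_le: upper_cvg => /(_ _ eps0)
    |move/cvgrPdist_le: lower_cvg => /(_ _ eps0)
    |move/cvgrPdist_le: truncated_cvg => /(_ _ e4)];
  by apply: filterS => y; rewrite distrC.
move=> [M [_ hM]].
pose y0 := Num.max 1 (M + 1).
have y01 : 1 <= y0 by rewrite le_max lexx.
have y0M y : y0 <= y -> M < y.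
  by move=> h; have : M + 1 <= y0 by [rewrite le_max lexx orbT]; lra.
have y00 : 0 < y0 by lra.
have tails y : y0 <= y ->
    `|y * upper_tail m y - c| <= eps /\ `|y * lower_tail m y - c| <= eps.
  by move=> /y0M /hM [].
exists (Num.min (T / (2 * y0)) (e / (8 * y0 ^+ 2))).
  by rewrite lt_min !divr_gt0// mulr_gt0// exprn_gt0.
move=> xi xi0; rewrite lt_min => /andP[xiT xie].
pose rho := T / xi.
have xir : xi * rho = T by rewrite /rho mulrC divfK// gt_eqF.
have y0r : y0 < rho.
  rewrite ltr_pdivlMr//; move: xiT; rewrite ltr_pdivlMr ?mulr_gt0//; nra.
have xiy : xi * y0 ^+ 2 <= e / 8.
  by move: xie; rewrite ltr_pdivlMr ?mulr_gt0 ?exprn_gt0//; lra.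
pose K := (Num.truncn (8 * T * rho / e)).+1.
have K0 : 0 < K%:R :> R by rewrite ltr0n.
have KT : 8 * T * rho / e < K%:R by exact: truncnS_gt.
pose delta := (rho - y0) / K%:R.
have d0 : 0 < delta by rewrite divr_gt0// subr_gt0.
have yK : y0 + K%:R * delta = rho.
  by rewrite /delta mulrC divfK ?gt_eqF// addrC subrK.
have Td : T * delta <= e / 8.
  rewrite /delta mulrA ler_pdivrMr//; move: KT; rewrite ltr_pdivrMr//; nra.
have := @slope_error _ m xi y0 delta xi0 y00 d0 K c eps tails.
rewrite yK xir.
have -> : xi^-1 * (2 * (c + eps) / rho) = 2 * (c + eps) / T.
  by rewrite -xir; field; rewrite !gt_eqF// (lt_trans y00).
have ceps : 2 * (c + eps) / T <= e / 8 by rewrite ler_pdivrMr//; lra.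
have [_ _ hg] := hM _ (y0M _ (ltW y0r)).
set A := sin_transform m xi / xi; set B := \int[m]_x _ in hg *.
move=> h; have -> : A - gamma = (A - B) + (B - gamma) by ring.
by apply: le_trans (ler_normD _ _) _; lra.
Unshelve. all: by end_near. Qed.

End sine_slope.

Lemma int_marginal (R : realType) d1 d2 (T1 : measurableType d1)
    (T2 : measurableType d2) (m : probability T1 R) (mu : probability T2 R)
    (X : T1 -> T2) (f : T2 -> R) :
  measurable_fun setT X -> (forall A, measurable A -> m (X @^-1` A) = mu A) ->
  bounded_measurable f -> \int[mu]_y f y = \int[m]_x f (X x).
Proof.
move=> mX hX bf.
pose X' : {mfun T1 >-> T2} := HB.pack X (isMeasurableFun.Build _ _ _ _ _ mX).
have iX : integrableR m (f \o X') by apply: bm_integrable; exact: bm_comp.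
rewrite -[RHS](int_image bf.1 iX) /Rintegral; congr fine.
apply: eq_measure_integral => A mA _; exact/esym/hX.
Qed.

(** * The initial law and its couplings *)

Section tails_of_a_distribution_function.
Context (R : realType) (m : probR R).
Local Notation F := (distribution_function m).
Implicit Types y z : R.

Lemma lower_tailE y : lower_tail m y = F (- y).
Proof.
rewrite /lower_tail /distribution_function.
have -> : (fine (m `]-oo, - y]))%classic = \int[m]_(x in `]-oo, - y]) 1.
  by rewrite Rintegral_cst// mul1r.
rewrite [RHS]Rintegral_mkcond; apply: eq_Rintegral => x _.
rewrite /lower patchE; case: ifP => [|/negP]; rewrite inE/= in_itv/= => h.
  by rewrite h.
by rewrite (negbTE (introN idP h)).
Qed.

Lemma upper_tail_ge y : 1 - F y <= upper_tail m y.
Proof.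
have -> : F y = lower_tail m (- y) by rewrite lower_tailE opprK.
have iu := bm_integrable m (bm_upper y).
have il := bm_integrable m (bm_lower (- y)).
rewrite lerBlDr /upper_tail /lower_tail -intD// -[leLHS](int_cst m).
apply: int_le; [exact/bm_integrable/bm_cst|exact: integrableRD|move=> x].
by rewrite /upper /lower opprK; case: (leP y x) => h; case: (leP x y) => h' /=; lra.
Qed.

Lemma upper_tail_le y z : z < y -> upper_tail m y <= 1 - F z.
Proof.
move=> zy; have -> : F z = lower_tail m (- z) by rewrite lower_tailE opprK.
have iu := bm_integrable m (bm_upper y).
have il := bm_integrable m (bm_lower (- z)).
rewrite lerBrDr /upper_tail /lower_tail -intD// -[leRHS](int_cst m).
apply: int_le; [exact: integrableRD|exact/bm_integrable/bm_cst|move=> x].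
by rewrite /upper /lower opprK; case: (leP y x) => h; case: (leP x z) => h' /=; lra.
Qed.

Lemma upper_tail_le1 y : upper_tail m y <= 1.
Proof.
rewrite -[leRHS](int_cst m); apply: int_le.
- exact/bm_integrable/bm_upper.
- exact/bm_integrable/bm_cst.
by move=> x; rewrite -[leRHS]/(1%:R) ler_nat leq_b1.
Qed.

Lemma upper_tail_ge0 y : 0 <= upper_tail m y.
Proof. by apply: Rintegral_ge0 => x _; exact: ler0n. Qed.

Lemma cvg_lower_tail (c : R) : `|x| * F x @[x --> -oo] --> c ->
  y * lower_tail m y @[y --> +oo] --> c.
Proof.
move=> /cvgNy_compNP; apply: cvg_trans; apply: near_eq_cvg; near=> y.
have y0 : 0 < y by near: y; exact: nbhs_pinfty_gt.
by rewrite /= lower_tailE normrN gtr0_norm.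
Unshelve. all: by end_near. Qed.

(** The tail of the distribution function excludes the endpoint; a jump at [y]
    is seen from slightly smaller [z], at a cost [y - z]. *)
Lemma cvg_upper_tail (c : R) : x * (1 - F x) @[x --> +oo] --> c ->
  y * upper_tail m y @[y --> +oo] --> c.
Proof.
move=> /cvgrPdist_le h; apply/cvgrPdist_le => e e0.
have [M [_ hM]] := h _ e0.
near=> y.
have y0 : 0 < y by near: y; exact: nbhs_pinfty_gt.
have yM : M + 1 < y by near: y; apply: nbhs_pinfty_gt; exact: num_real.
have My : M < y by lra.
have up := upper_tail_ge y.
have := hM y My; rewrite /= !ler_norml => /andP[a1 a2].
apply/andP; split; last first.
  by have := ler_wpM2l (ltW y0) up; lra.
rewrite -lerN2 opprK opprB lerBlDr; apply/ler_addgt0Pr => eta eta0.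
pose z := y - Num.min eta (1 / 2).
have z1 : 0 < Num.min eta (1 / 2) by rewrite lt_min eta0 divr_gt0.
have z2 : Num.min eta (1 / 2) <= eta by rewrite ge_min lexx.
have z3 : Num.min eta (1 / 2) <= 1 / 2 by rewrite ge_min lexx orbT.
have zM : M < z by rewrite /z; lra.
have zy : z < y by rewrite /z; lra.
have := hM z zM; rewrite /= ler_norml => /andP[b1 b2].
have u0 := upper_tail_ge0 y; have u1 := upper_tail_le1 y.
have ul := upper_tail_le zy.
have y1 : 1 < y by near: y; exact: nbhs_pinfty_gt.
have z0 : 0 <= z by rewrite /z; lra.
have := ler_wpM2l z0 ul.
have -> : y * upper_tail m y = z * upper_tail m y + Num.min eta (1 / 2) * upper_tail m y.
  by rewrite /z; ring.
have : Num.min eta (1 / 2) * upper_tail m y <= eta * 1.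
  by apply: ler_pM => //; exact: ltW.
by lra.
Unshelve. all: by end_near. Qed.

Lemma cvg_truncated_id (gamma : R) :
  \int[m]_(x in `]- rho, rho[) x @[rho --> +oo] --> gamma ->
  \int[m]_x (x * (- rho < x < rho)%R%:R) @[rho --> +oo] --> gamma.
Proof.
apply: cvg_trans; apply: near_eq_cvg; near=> rho.
rewrite Rintegral_mkcond; apply: eq_Rintegral => x _.
rewrite patchE; case: ifP => [|/negP]; rewrite inE/= in_itv/= => h.
  by rewrite h mulr1.
by rewrite (negbTE (introN idP h)) mulr0.
Unshelve. all: by end_near. Qed.

End tails_of_a_distribution_function.

Section slopes.
Context (R : realType).
Implicit Types m : probR R.
Local Notation step n := (harmonic n : R).

Definition sine_slope_to m (g : R) :=
  sin_transform m (step n) / step n @[n --> \oo] --> g.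

Lemma step_gt0 n : 0 < step n.
Proof. by rewrite /harmonic/= invr_gt0 ltr0n. Qed.

Lemma cvg_step_right : (step n @[n --> \oo]) --> (0 : R)^'+.
Proof.
move=> A [e /= e0 hA].
have := @cvg_harmonic R; move/cvgrPdist_lt => /(_ _ e0).
apply: filterS => n; rewrite sub0r normrN => h.
by apply: hA; [rewrite /= sub0r normrN|exact: step_gt0].
Qed.

Lemma sine_slope_heavy_tail m (c gamma : R) :
  `|x| * distribution_function m x @[x --> -oo] --> c ->
  x * (1 - distribution_function m x) @[x --> +oo] --> c ->
  \int[m]_(x in `]- rho, rho[) x @[rho --> +oo] --> gamma ->
  sine_slope_to m gamma.
Proof.
move=> hl hu ht; apply/cvgrPdist_le => e e0.
have [x0 x00 hx] := sine_slope (cvg_upper_tail hu) (cvg_lower_tail hl)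
  (cvg_truncated_id ht) e0.
have := @cvg_harmonic R; move/cvgrPdist_lt => /(_ _ x00).
apply: filterS => n; rewrite sub0r normrN gtr0_norm ?step_gt0// => h.
by rewrite distrC; apply: hx => //; exact: step_gt0.
Qed.

Let slope_pointwise (x : R) : sin (step n * x) / step n @[n --> \oo] --> x.
Proof.
apply/cvgrPdist_le => e e0.
have x2 : 0 < e / (1 + x ^+ 2) by rewrite divr_gt0// ltr_pwDl// sqr_ge0.
have := @cvg_harmonic R; move/cvgrPdist_lt => /(_ _ x2).
apply: filterS => n; rewrite sub0r normrN gtr0_norm ?step_gt0// => h.
have s0 := step_gt0 n; set s := harmonic n in s0 h *.
have -> : x - sin (s * x) / s = - ((sin (s * x) - s * x) / s).
  by field; rewrite gt_eqF.
rewrite normrN normrM [`|s^-1|]gtr0_norm ?invr_gt0// ler_pdivrMr//.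
apply: le_trans (norm_sin_sub_id _) _; rewrite exprMn.
move: h; rewrite ltr_pdivlMr ?ltr_pwDl ?sqr_ge0// => h.
have := sqr_ge0 x; nra.
Qed.

Lemma sine_slope_integrable m : integrableR m id ->
  sine_slope_to m (\int[m]_x x).
Proof.
move=> im; rewrite /sine_slope_to.
have -> : (fun n => sin_transform m (step n) / step n) =
    (fun n => \int[m]_x (sin (step n * x) / step n)).
  apply/funext => n; under [RHS]int_ext do rewrite mulrC.
  rewrite intZ 1?mulrC//; apply: bm_integrable; apply: bm_sin.
  exact: measurable_funM.
apply: (@int_dominated_cvg R _ _ m (fun n (x : measurableTypeR R) =>
  sin (step n * x) / step n) id (fun x => `|x|)).
- move=> n; apply: measurable_funM => //.
  by apply: (bm_sin _).1; exact: measurable_funM.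
- by move=> x; exact: slope_pointwise.
- exact: integrableR_norm.
- move=> n x; have s0 := step_gt0 n.
  rewrite normrM [`|(step n)^-1|]gtr0_norm ?invr_gt0// ler_pdivrMr//.
  by rewrite (le_trans (norm_sin_le _))// normrM mulrC [`|step n|]gtr0_norm.
Qed.

(** Only the sine slopes at the origin of the two marginals matter: the means
    of the marginals themselves may fail to exist. *)
Lemma coupling_mean_difference (m1 m2 : probR R)
    (m : probability (measurableTypeR R * measurableTypeR R)%type R) (g : R) :
  is_coupling m1 m2 m -> integrableR m (fun z => z.1 - z.2) ->
  sine_slope_to m1 g -> sine_slope_to m2 g -> \int[m]_z (z.1 - z.2) = 0.
Proof.
move=> hm il h1 h2.
have bs s : bounded_measurable (fun x : measurableTypeR R => sin (s * x)).
  by apply: bm_sin; exact: measurable_funM.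
have E1 s : sin_transform m1 s = \int[m]_z sin (s * z.1).
  apply: (int_marginal (X := fst) _ _ (bs s)) => // A mA; rewrite -(hm A mA).1; congr (m _).
  by apply/seteqP; split => -[a b]/=; [|case].
have E2 s : sin_transform m2 s = \int[m]_z sin (s * z.2).
  apply: (int_marginal (X := snd) _ _ (bs s)) => // A mA; rewrite -(hm A mA).2; congr (m _).
  by apply/seteqP; split => -[a b]/=; [|case].
have b1 s : bounded_measurable
    (fun z : measurableTypeR R * measurableTypeR R => sin (s * z.1)).
  by apply: bm_sin; exact: measurable_funM.
have b2 s : bounded_measurable
    (fun z : measurableTypeR R * measurableTypeR R => sin (s * z.2)).
  by apply: bm_sin; exact: measurable_funM.
have lim1 : \int[m]_z ((sin (step n * z.1) - sin (step n * z.2)) / step n)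
    @[n --> \oo] --> \int[m]_z (z.1 - z.2).
  apply: (@int_dominated_cvg R _ _ m
    (fun n (z : measurableTypeR R * measurableTypeR R) =>
      (sin (step n * z.1) - sin (step n * z.2)) / step n)
    (fun z => z.1 - z.2) (fun z => `|z.1 - z.2|)).
  - by move=> n; apply: measurable_funM => //; exact: (bmB (b1 _) (b2 _)).1.
  - move=> z; under eq_fun do rewrite mulrBl.
    by apply: cvgB; exact: slope_pointwise.
  - exact: integrableR_norm.
  - move=> n z; have s0 := step_gt0 n.
    rewrite normrM [`|(step n)^-1|]gtr0_norm ?invr_gt0// ler_pdivrMr//.
    rewrite (le_trans (norm_sin_sub _ _))// -mulrBr normrM mulrC.
    by rewrite [`|step n|]gtr0_norm.
have lim2 : \int[m]_z ((sin (step n * z.1) - sin (step n * z.2)) / step n)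
    @[n --> \oo] --> (0 : R).
  have -> : (fun n => \int[m]_z ((sin (step n * z.1) - sin (step n * z.2)) / step n)) =
    (fun n => sin_transform m1 (step n) / step n - sin_transform m2 (step n) / step n).
    apply/funext => n; rewrite E1 E2 -mulrBl -intB; [|exact: bm_integrable..].
    rewrite mulrC -intZ; last by apply: bm_integrable; exact: bmB.
    by apply: int_ext => z; rewrite mulrC.
  by rewrite -(subrr g); exact: cvgB h1 h2.
exact: cvg_unique lim1 lim2.
Qed.

End slopes.

(** * The slope of the steady state *)

Section law_on_the_half_line.
Context (R : realType) (nu : probR R).
Hypothesis nu1 : nu `[0, +oo[%classic = 1%E.

(** For a law carried by the half-line, composing with the positive part leaves
    integrals unchanged and makes [exp (- a x)], [a >= 0], bounded on the whole
    line. *)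
Definition pos_part (x : R) : R := Num.max 0 x.

Lemma pos_part_ge0 x : 0 <= pos_part x.
Proof. by rewrite /pos_part le_max lexx. Qed.

Lemma pos_part_id x : 0 <= x -> pos_part x = x.
Proof. by move=> x0; rewrite /pos_part max_r. Qed.

Lemma measurable_pos_part : measurable_fun setT (pos_part : measurableTypeR R -> R).
Proof. exact: measurable_maxr. Qed.

Let mD : measurable (`[0%R, +oo[%classic : set (measurableTypeR R)).
Proof. by []. Qed.

Let n0 : nu (~` `[0%R, +oo[%classic) = 0%E.
Proof. by rewrite probability_setC// nu1 subee. Qed.

Lemma int_on_halfline (f : measurableTypeR R -> R) : bounded_measurable f ->
  \int[nu]_x f x = \int[nu]_(x in `[0%R, +oo[) f x.
Proof.
move=> bf; rewrite /Rintegral; congr fine.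
rewrite [LHS](negligible_integral (measurableC mD) _ (bm_integrable nu bf) n0)//.
by rewrite setTD setCK.
Qed.

Lemma int_halfline (f : R -> R) :
  bounded_measurable (fun x : measurableTypeR R => f (pos_part x)) ->
  \int[nu]_(x in `[0%R, +oo[) f x = \int[nu]_x f (pos_part x).
Proof.
move=> bf; rewrite int_on_halfline//; apply: eq_Rintegral => x.
by rewrite inE/= in_itv/= andbT => x0; rewrite pos_part_id.
Qed.

Lemma int_pos_part (f : measurableTypeR R -> R) : bounded_measurable f ->
  \int[nu]_x f x = \int[nu]_x f (pos_part x).
Proof.
move=> bf; rewrite int_on_halfline// int_halfline//.
exact: (bm_comp bf measurable_pos_part).
Qed.

Lemma mean_pos_part : (\int[nu]_(v in `[0%R, +oo[) v%:E = 1)%E ->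
  integrableR nu pos_part /\ \int[nu]_x pos_part x = 1.
Proof.
move=> h.
have E : (\int[nu]_x (pos_part x)%:E = 1)%E.
  rewrite -h [RHS]integral_mkcond; apply: eq_integral => x _.
  rewrite patchE; case: ifP => [|/negP]; rewrite inE/= in_itv/= andbT => x0.
    by rewrite pos_part_id.
  by rewrite /pos_part max_l// ltW// ltNge; apply/negP.
have ip : integrableR nu pos_part.
  apply: ge0_integrableR; [exact: measurable_pos_part|exact: pos_part_ge0|].
  by rewrite E ltry.
by split => //; rewrite /Rintegral E.
Qed.

(** Dominated convergence with the dominating function [B * x], integrable
    because [nu] has a finite mean. *)
Lemma damped_sine_slope (a b : nat -> R) (g B : R) :
  (\int[nu]_(v in `[0%R, +oo[) v%:E = 1)%E ->
  (forall n, 0 <= a n) -> a n @[n --> \oo] --> (0 : R) ->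
  b n / harmonic n @[n --> \oo] --> g -> (forall n, `|b n / harmonic n| <= B) ->
  (\int[nu]_(x in `[0%R, +oo[) (expR (- (a n * x)) * sin (b n * x))) / harmonic n
     @[n --> \oo] --> g.
Proof.
move=> hnu a0 ca cb bB; have [ip E] := mean_pos_part hnu.
pose f n (x : R) := expR (- (a n * x)) * sin (b n * x).
have bf n : bounded_measurable (fun x : measurableTypeR R => f n (pos_part x)).
  apply: bmM; last first.
    by apply: bm_sin; apply: measurable_funM => //; exact: measurable_pos_part.
  split.
    apply: (measurableT_comp (@measurable_expR R)).
    apply: measurableT_comp => //; apply: measurable_funM => //.
    exact: measurable_pos_part.
  exists 1 => x; rewrite ger0_norm ?expR_ge0// expR_le1 oppr_le0.
  by rewrite mulr_ge0// pos_part_ge0.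
have -> : (fun n => (\int[nu]_(x in `[0%R, +oo[) f n x) / harmonic n) =
    (fun n => \int[nu]_x (f n (pos_part x) / harmonic n)).
  apply/funext => n; rewrite int_halfline// mulrC -intZ; last exact: bm_integrable.
  by apply: int_ext => x; rewrite mulrC.
have -> : g = \int[nu]_x (g * pos_part x) by rewrite intZ// E mulr1.
apply: (@int_dominated_cvg R _ _ nu (fun n (x : measurableTypeR R) =>
  f n (pos_part x) / harmonic n) (fun x => g * pos_part x) (fun x => B * pos_part x)).
- by move=> n; apply: measurable_funM => //; exact: (bf n).1.
- move=> x; set y := pos_part x.
  have ce : expR (- (a n * y)) @[n --> \oo] --> (1 : R).
    rewrite -(@expR0 R); have -> : (0 : R) = - (0 * y) by rewrite mul0r oppr0.
    apply: continuous_cvg; first exact: continuous_expR.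
    by apply: cvgN; apply: cvgM => //; exact: cvg_cst.
  have cs : sin (b n * y) / harmonic n @[n --> \oo] --> g * y.
    have c1 : b n / harmonic n * y @[n --> \oo] --> g * y.
      by apply: cvgM => //; exact: cvg_cst.
    have c2 : harmonic n * (B ^+ 2 * y ^+ 2) @[n --> \oo] --> (0 : R).
      rewrite -(mul0r (B ^+ 2 * y ^+ 2)); apply: cvgM; [exact: cvg_harmonic|exact: cvg_cst].
    have c3 : sin (b n * y) / harmonic n - b n / harmonic n * y @[n --> \oo] --> (0 : R).
      apply/cvgr0Pnorm_le => e e0.
      have := c2; move/cvgr0Pnorm_le => /(_ _ e0); apply: filterS => n hn.
      have s0 := step_gt0 R n.
      apply: le_trans hn; rewrite (ger0_norm (mulr_ge0 _ _)) ?(ltW s0)//; last first.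
        by rewrite mulr_ge0 ?sqr_ge0.
      have -> : sin (b n * y) / harmonic n - b n / harmonic n * y =
          (sin (b n * y) - b n * y) / harmonic n by rewrite mulrBl; congr (_ - _); ring.
      rewrite normrM [`|_^-1|]gtr0_norm ?invr_gt0// ler_pdivrMr//.
      apply: le_trans (norm_sin_sub_id _) _; rewrite exprMn.
      have -> : harmonic n * (B ^+ 2 * y ^+ 2) * harmonic n =
          (B * harmonic n) ^+ 2 * y ^+ 2 by ring.
      rewrite ler_wpM2r ?sqr_ge0// -[leLHS]sqr_norm ler_sqr ?nnegrE//; last first.
        by rewrite mulr_ge0 ?(ltW s0)//; exact: le_trans (bB n).
      move: (bB n); rewrite normrM [`|_^-1|]gtr0_norm ?invr_gt0//.
      by rewrite ler_pdivrMr.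
    rewrite -[g * y]add0r.
    have -> : (fun n => sin (b n * y) / harmonic n) = (fun n =>
        (sin (b n * y) / harmonic n - b n / harmonic n * y) + b n / harmonic n * y).
      by apply/funext => n; rewrite subrK.
    exact: cvgD c3 c1.
  rewrite -[g * y]mul1r.
  have -> : (fun n => f n y / harmonic n) =
      (fun n => expR (- (a n * y)) * (sin (b n * y) / harmonic n)).
    by apply/funext => n; rewrite mulrA.
  exact: cvgM ce cs.
- exact: integrableRZ.
- move=> n x; have s0 := step_gt0 R n; have y0 := pos_part_ge0 x.
  rewrite /f; set y := pos_part x in y0 *.
  rewrite -mulrA normrM ger0_norm ?expR_ge0//.
  apply: (@le_trans _ _ `|sin (b n * y) / harmonic n|).
    by rewrite ler_piMl// expR_le1 oppr_le0 mulr_ge0.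
  rewrite normrM; apply: le_trans (ler_wpM2r (normr_ge0 _) (norm_sin_le _)) _.
  by rewrite normrM mulrAC -normrM [`|y|]ger0_norm// ler_wpM2r.
Qed.

End law_on_the_half_line.

Section slope_of_the_steady_state.
Context (R : realType).
Variables (alpha cp cm c gamma : R) (nu muinf mu0 : probR R).
Hypothesis nu1 : nu `[0, +oo[%classic = 1%E.
Hypothesis nu_mean : (\int[nu]_(v in `[0%R, +oo[) v%:E = 1)%E.
Hypothesis steady : is_steady_state alpha cp cm c gamma nu muinf.
Hypothesis initial : initial_condition alpha cp cm c gamma mu0.

Let sin_muinf (xi : R) (a b : R) :
  fourier muinf xi = cintegral nu `[0, +oo[%classic (fun m => cexp (m%:C * (- a +i* b))%C) ->
  sin_transform muinf xi = \int[nu]_(x in `[0%R, +oo[) (expR (- (a * x)) * sin (b * x)).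
Proof.
move=> /(congr1 (@complex.Im R)); rewrite fourierE /= => ->.
apply: eq_Rintegral => x _; rewrite /= !mul0r subr0 addr0.
by congr (expR _ * sin _); ring.
Qed.

Lemma tail_constant_ge0 : 1 < alpha < 2 -> 0 <= cp + cm.
Proof.
move=> ha; have [[hp hm _] _] := (initial.1 ha, tt).
have F01 x : 0 <= distribution_function mu0 x <= 1.
  rewrite /distribution_function; have h1 := probability_le1 mu0 (measurable_itv `]-oo, x]).
  have h0 := measure_ge0 mu0 `]-oo, x]%classic.
  have hf : mu0 `]-oo, x]%classic \is a fin_num.
    by rewrite ge0_fin_numE// (le_lt_trans h1)// ltry.
  by rewrite -(@lee_fin _ 0) -(@lee_fin _ _ 1) fineK// h0 h1.
apply: addr_ge0.
- apply: (ler_cvg_to (cvg_cst 0) hp); near=> x; rewrite mulr_ge0 ?powR_ge0// subr_ge0.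
  by have /andP[] := F01 x.
- apply: (ler_cvg_to (cvg_cst 0) hm); near=> x; rewrite mulr_ge0 ?powR_ge0//.
  by have /andP[] := F01 x.
Unshelve. all: by end_near. Qed.

Lemma stable_lambda_ge0 : 1 < alpha < 2 -> 0 <= stable_lambda alpha cp cm.
Proof.
move=> ha; have h := tail_constant_ge0 ha; have /andP[a1 a2] := ha.
rewrite /stable_lambda divr_ge0//; first by rewrite mulr_ge0// pi_ge0.
rewrite !mulr_ge0//.
  by apply: Rintegral_ge0 => x _; rewrite mulr_ge0 ?powR_ge0 ?expR_ge0.
apply/ltW/sin_gt0_pi; have := pi_gt0 R => p0.
by apply/andP; split; nra.
Qed.

Lemma cvg_step_power (r : R) : 0 < r -> (harmonic n : R) `^ r @[n --> \oo] --> (0 : R).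
Proof.
move=> r0; apply: cvg_comp (powR_cvg0 r0); exact: cvg_step_right.
Qed.

Lemma step_power_le1 (r : R) n : 0 <= r -> (harmonic n : R) `^ r <= 1.
Proof.
move=> r0; have s0 := step_gt0 R n.
have s1 : (harmonic n : R) <= 1 by rewrite /harmonic/= invf_le1 ?ltr0n// ler1n.
have -> : 1 = 1 `^ r :> R by rewrite powR1.
apply: ge0_ler_powR => //; rewrite ?nnegrE//.
exact: ltW.
Qed.

Lemma sine_slope_steady_gt1 : 1 < alpha < 2 -> sine_slope_to muinf 0.
Proof.
move=> ha; have /andP[a1 a2] := ha; have l0 := stable_lambda_ge0 ha.
set lam := stable_lambda alpha cp cm in l0 *.
pose k := lam * (stable_beta cp cm * tan (pi * alpha / 2)).
have pw n : (harmonic n : R) `^ alpha = harmonic n * harmonic n `^ (alpha - 1).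
  have s0 := step_gt0 R n.
  have {1}-> : alpha = 1 + (alpha - 1) by ring.
  have b1 : 0 < alpha - 1 by rewrite subr_gt0.
  by rewrite (powR_split _ b1 ltr01) powRr1// ltW.
have E n : sin_transform muinf (harmonic n) = \int[nu]_(x in `[0%R, +oo[)
    (expR (- ((lam * harmonic n `^ alpha) * x)) * sin ((k * harmonic n `^ alpha) * x)).
  apply: sin_muinf; rewrite (steady.1 ha).
  have s0 := step_gt0 R n; congr cintegral; apply/funext => m; congr cexp.
  rewrite (gtr0_norm s0) gtr0_sg//; apply/eqP; rewrite eq_complex /=.
  by rewrite !mul0r !mulr1 /k -/lam; apply/andP; split; apply/eqP; ring.
rewrite /sine_slope_to; under eq_fun do rewrite E.
apply: (@damped_sine_slope _ nu nu1 _ _ 0 `|k|) => //.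
- by move=> n; rewrite mulr_ge0 ?powR_ge0.
- by rewrite -(mulr0 lam); apply: cvgM; [exact: cvg_cst|apply: cvg_step_power; lra].
- have e n : k * harmonic n `^ alpha / harmonic n = k * harmonic n `^ (alpha - 1).
    by rewrite pw; field; rewrite gt_eqF ?step_gt0.
  under eq_fun do rewrite e.
  by rewrite -(mulr0 k); apply: cvgM; [exact: cvg_cst|apply: cvg_step_power; lra].
- move=> n; have -> : k * harmonic n `^ alpha / harmonic n = k * harmonic n `^ (alpha - 1).
    by rewrite pw; field; rewrite gt_eqF ?step_gt0.
  rewrite normrM ler_piMr// ger0_norm ?powR_ge0// step_power_le1//; lra.
Qed.

Lemma sine_slope_steady_eq1 : alpha = 1 -> sine_slope_to muinf gamma.
Proof.
move=> ha; have [c0 _ _ _] := initial.2 ha.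
have E n : sin_transform muinf (harmonic n) = \int[nu]_(x in `[0%R, +oo[)
    (expR (- ((c * pi * harmonic n) * x)) * sin ((gamma * harmonic n) * x)).
  by apply: sin_muinf; rewrite (steady.2 ha) (gtr0_norm (step_gt0 R n)).
rewrite /sine_slope_to; under eq_fun do rewrite E.
have e n : gamma * harmonic n / harmonic n = gamma.
  by rewrite mulfK// gt_eqF ?step_gt0.
apply: (@damped_sine_slope _ nu nu1 _ _ gamma `|gamma|) => //.
- by move=> n; rewrite !mulr_ge0 ?pi_ge0// ltW ?step_gt0.
- rewrite -(mulr0 (c * pi)); apply: cvgM; [exact: cvg_cst|exact: cvg_harmonic].
- by under eq_fun do rewrite e; exact: cvg_cst.
- by move=> n; rewrite e.
Qed.

Lemma sine_slope_initial_gt1 : 1 < alpha < 2 -> sine_slope_to mu0 0.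
Proof.
move=> ha; have [_ _ h0] := initial.1 ha.
have [ip hp] : integrableR mu0 id /\ \int[mu0]_x x = 0.
  split; last by rewrite /Rintegral h0.
  have me : measurable_fun setT (EFin : measurableTypeR R -> \bar R) by exact/measurable_EFinP.
  apply/integrableP; split => //.
  have fp : (0 <= \int[mu0]_x (EFin^\+ x))%E by exact: integral_ge0.
  have fn : (0 <= \int[mu0]_x (EFin^\- x))%E by exact: integral_ge0.
  have : ((\int[mu0]_x (EFin^\+ x) < +oo) /\ (\int[mu0]_x (EFin^\- x) < +oo))%E.
    move: h0; rewrite integralE; move: fp fn.
    case: (integral _ _ _) => [a||]; case: (integral _ _ _) => [b||] //=.
    by rewrite !ltry.
  move=> [ap an].
  under eq_integral do rewrite -[(`|_|)%E]/((abse \o EFin) _) fune_abse.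
  rewrite ge0_integralD//; first exact: lte_add_pinfty.
  - exact: measurable_funepos.
  - exact: measurable_funeneg.
by rewrite -hp; exact: sine_slope_integrable.
Qed.

(** For [alpha > 1] the slope is the common mean 0; for [alpha = 1] the
    principal value [gamma] of the initial law is the drift of the steady
    state. *)
Lemma coupling_centered (m : probability (measurableTypeR R * measurableTypeR R)%type R) :
  1 <= alpha < 2 ->
  is_coupling mu0 muinf m -> integrableR m (fun z => z.1 - z.2) ->
  \int[m]_z (z.1 - z.2) = 0.
Proof.
move=> /andP[]; rewrite le_eqVlt => /orP[/eqP/esym a1|a1] a2 hm im.
  have [_ hl hu ht] := initial.2 a1.
  apply: (coupling_mean_difference hm im (g := gamma)).
    exact: sine_slope_heavy_tail hl hu ht.
  exact: sine_slope_steady_eq1.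
have ha : 1 < alpha < 2 by rewrite a1.
apply: (coupling_mean_difference hm im (g := 0)).
  exact: sine_slope_initial_gt1.
exact: sine_slope_steady_gt1.
Qed.

End slope_of_the_steady_state.

Lemma law_of_measurable (R : realType) d1 d2 (T1 : measurableType d1)
    (T2 : measurableType d2) (m : probability T1 R) (X : T1 -> T2) :
  measurable_fun setT X ->
  exists mu : probability T2 R, forall A, measurable A -> m (X @^-1` A) = mu A.
Proof.
move=> mX; pose X' : {mfun T1 >-> T2} := HB.pack X (isMeasurableFun.Build _ _ _ _ _ mX).
by exists (distribution m X').
Qed.

(** * The steady state is a fixed point of the gain operator *)

Section mixing_measure_is_a_fixed_point.
Context (R : realType) dO (Omega : measurableType dO) (P : probability Omega R).
Variables (L Rr : {RV P >-> R}) (alpha : R) (nu : probR R).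
Hypothesis L0 : forall w, 0 <= L w.
Hypothesis Rr0 : forall w, 0 <= Rr w.
Hypothesis mixing : is_mixing_measure L Rr alpha nu.

Local Notation pos := (@pos_part R).
Local Notation T := (measurableTypeR R).

Let nu1 : nu `[0, +oo[%classic = 1%E.
Proof. by case: mixing. Qed.

Let mLa : measurable_fun setT (fun w => L w `^ alpha).
Proof. by apply: measurable_powR_comp. Qed.

Let mRa : measurable_fun setT (fun w => Rr w `^ alpha).
Proof. by apply: measurable_powR_comp. Qed.

Let mpos : measurable_fun setT (pos : T -> T).
Proof. exact: measurable_pos_part. Qed.

Let opf (x : Omega * (T * T)) : T :=
  L x.1 `^ alpha * pos x.2.1 + Rr x.1 `^ alpha * pos x.2.2.

Let mopf : measurable_fun setT opf.
Proof.
apply: measurable_funD; apply: measurable_funM.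
- exact: (measurableT_comp mLa measurable_fst).
- apply: (measurableT_comp (@measurable_pos_part R)).
  exact: (measurableT_comp (f := fst) measurable_fst measurable_snd).
- exact: (measurableT_comp mRa measurable_fst).
- apply: (measurableT_comp (@measurable_pos_part R)).
  exact: (measurableT_comp (f := snd) measurable_snd measurable_snd).
Qed.

Let op : {mfun (Omega * (T * T))%type >-> T} :=
  HB.pack opf (isMeasurableFun.Build _ _ _ _ _ mopf).

Let opE w x y : pos (op (w, (x, y))) = L w `^ alpha * pos x + Rr w `^ alpha * pos y.
Proof.
by rewrite pos_part_id// /op /= /opf addr_ge0// mulr_ge0 ?powR_ge0 ?pos_part_ge0.
Qed.

Let transform_pos (xi : R) : @transform R _ T pos nu xi = fourier nu xi.
Proof.
rewrite fourierE /transform; congr (_ +i* _)%C; apply/esym;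
  [apply: (int_pos_part nu1 (f := fun x => cos (xi * x)))
  |apply: (int_pos_part nu1 (f := fun x => sin (xi * x)))].
- by apply: bm_cos; exact: measurable_funM.
- by apply: bm_sin; exact: measurable_funM.
Qed.

(** The equation of the transforms of [nu] is an equality of laws by uniqueness
    of the Fourier transform; as such it can be tested on the complex
    exponentials in the steady state. *)
Lemma gain_mixing (A : set T) : measurable A -> gain P op nu nu (pos @^-1` A) = nu A.
Proof.
move=> mA.
have [lp lpE] : exists lp : probR R, forall B, measurable B ->
    gain P op nu nu (pos @^-1` B) = lp B.
  exact: (law_of_measurable (gain P op nu nu) mpos).
rewrite lpE//.
suff h xi : fourier lp xi = fourier nu xi by exact: fourier_inj h A mA.
have [_ _ ->] := mixing.
have -> : fourier lp xi = @transform R _ T pos (gain P op nu nu) xi.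
  rewrite fourierE /transform; congr (_ +i* _)%C.
  - apply: (int_marginal mpos lpE (f := fun x : T => cos (xi * x))).
    by apply: bm_cos; exact: measurable_funM.
  - apply: (int_marginal mpos lpE (f := fun x : T => sin (xi * x))).
    by apply: bm_sin; exact: measurable_funM.
rewrite (transform_gain P (@measurable_pos_part R) opE).
by apply: cintegral_ext => w; rewrite !transform_pos.
Qed.

Lemma mixing_int_bilinear (f : R -> R) (g h g' h' : Omega -> R -> R) :
  bounded_measurable (fun x : T => f (pos x)) ->
  (forall w, bounded_measurable (fun x : T => g w (pos x)) /\
             bounded_measurable (fun x : T => h w (pos x))) ->
  (forall w, bounded_measurable (fun x : T => g' w (pos x)) /\
             bounded_measurable (fun x : T => h' w (pos x))) ->
  (forall w x y, 0 <= x -> 0 <= y -> f (L w `^ alpha * x + Rr w `^ alpha * y) =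
     g w x * h w y + g' w x * h' w y) ->
  \int[nu]_x f (pos x) =
  \int[P]_w (\int[nu]_x g w (pos x) * \int[nu]_y h w (pos y) +
             \int[nu]_x g' w (pos x) * \int[nu]_y h' w (pos y)).
Proof.
move=> bf bg bg' fE.
rewrite (int_marginal mpos gain_mixing bf).
under int_ext do rewrite (pos_part_id (pos_part_ge0 _)).
apply: gain_int_bilinear => // w x y.
by rewrite opE fE// pos_part_ge0.
Qed.

Variables (a b : R) (muinf : probR R).
Hypothesis alpha0 : 0 < alpha.
Hypothesis a0 : 0 <= a.
Hypothesis muinfE : forall xi, fourier muinf xi =
  ((\int[nu]_(m in `[0%R, +oo[) (expR (- (a * `|xi| `^ alpha * m)) *
      cos (b * Num.sg xi * `|xi| `^ alpha * m))) +i*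
  (\int[nu]_(m in `[0%R, +oo[) (expR (- (a * `|xi| `^ alpha * m)) *
      sin (b * Num.sg xi * `|xi| `^ alpha * m))))%C.

Let damped (k : R -> R) xi m :=
  expR (- (a * `|xi| `^ alpha * m)) * k (b * Num.sg xi * `|xi| `^ alpha * m).

Let bm_damped_exp (xi : R) : bounded_measurable
  (fun m : T => expR (- (a * `|xi| `^ alpha * pos m))).
Proof.
split.
  apply: (measurableT_comp (@measurable_expR R)).
  have h : measurable_fun setT (fun m : T => a * `|xi| `^ alpha * pos m).
    by apply: measurable_funM => //; exact: measurable_pos_part.
  exact: measurableT_comp h.
exists 1 => x; rewrite ger0_norm ?expR_ge0// expR_le1 oppr_le0.
by rewrite !mulr_ge0 ?powR_ge0// pos_part_ge0.
Qed.

Let bm_damped_cos (xi : R) : bounded_measurable (fun m : T => damped (@cos R) xi (pos m)).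
Proof.
apply: bmM; first exact: bm_damped_exp.
by apply: bm_cos; apply: measurable_funM => //; exact: mpos.
Qed.

Let bm_damped_sin (xi : R) : bounded_measurable (fun m : T => damped (@sin R) xi (pos m)).
Proof.
apply: bmM; first exact: bm_damped_exp.
by apply: bm_sin; apply: measurable_funM => //; exact: mpos.
Qed.

Let fE xi : fourier muinf xi = ((\int[nu]_m damped (@cos R) xi (pos m)) +i*
  (\int[nu]_m damped (@sin R) xi (pos m)))%C.
Proof.
rewrite muinfE; congr (_ +i* _)%C.
- exact: (int_halfline nu1 (f := damped (@cos R) xi)).
- exact: (int_halfline nu1 (f := damped (@sin R) xi)).
Qed.

Let scaleE (x xi : R) : 0 <= x ->
  a * `|x * xi| `^ alpha = x `^ alpha * (a * `|xi| `^ alpha) /\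
  b * Num.sg (x * xi) * `|x * xi| `^ alpha =
    x `^ alpha * (b * Num.sg xi * `|xi| `^ alpha).
Proof.
move=> x0; rewrite normrM (ger0_norm x0) powRM// sgrM; split; first by ring.
move: x0; rewrite le_eqVlt => /predU1P[<-|x0]; last by rewrite gtr0_sg//; ring.
by rewrite powR0 ?gt_eqF// !mul0r mulr0.
Qed.

(** The stable exponent is homogeneous of degree [alpha]: scaling the frequency
    by [L] amounts to scaling the mixing parameter by [L ^ alpha], so that the
    fixed point equation of [nu] becomes the one of [muinf]. *)
Lemma steady_state_fixed_point xi : fourier muinf xi =
  cintegral P setT (fun w => fourier muinf (L w * xi) * fourier muinf (Rr w * xi)).
Proof.
have dE w x y (k k1 k2 k3 k4 : R -> R) :
    (forall u v, k (u + v) = k1 u * k2 v + k3 u * k4 v) ->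
    damped k xi (L w `^ alpha * x + Rr w `^ alpha * y) =
    damped k1 (L w * xi) x * damped k2 (Rr w * xi) y +
    damped k3 (L w * xi) x * damped k4 (Rr w * xi) y.
  move=> kE; rewrite /damped.
  have [-> ->] := scaleE xi (L0 w); have [-> ->] := scaleE xi (Rr0 w).
  set u := b * _ * _; set v := a * _.
  have -> : u * (L w `^ alpha * x + Rr w `^ alpha * y) =
    L w `^ alpha * u * x + Rr w `^ alpha * u * y by ring.
  have -> : - (v * (L w `^ alpha * x + Rr w `^ alpha * y)) =
    - (L w `^ alpha * v * x) + - (Rr w `^ alpha * v * y) by ring.
  by rewrite expRD kE; ring.
rewrite fE /cintegral; congr (_ +i* _)%C.
- rewrite (@mixing_int_bilinear (damped (@cos R) xi)
    (fun w => damped (@cos R) (L w * xi)) (fun w => damped (@cos R) (Rr w * xi))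
    (fun w => damped (fun x => - sin x) (L w * xi))
    (fun w => damped (@sin R) (Rr w * xi))) => //.
  + apply: int_ext => w; rewrite !fE /=; congr (_ + _).
    have -> : \int[nu]_m damped (fun x => - sin x) (L w * xi) (pos m) =
        \int[nu]_m (-1 * damped (@sin R) (L w * xi) (pos m)).
      by apply: int_ext => m; rewrite /damped mulrN mulN1r.
    by rewrite intZ ?mulN1r ?mulNr//; exact: bm_integrable.
  + move=> w; split => //.
    by have := bmN (bm_damped_sin (L w * xi)); under eq_fun do rewrite /damped -mulrN.
  + by move=> w x y _ _; apply: dE => u v; rewrite cosD mulNr.
- rewrite (@mixing_int_bilinear (damped (@sin R) xi)
    (fun w => damped (@cos R) (L w * xi)) (fun w => damped (@sin R) (Rr w * xi))
    (fun w => damped (@sin R) (L w * xi)) (fun w => damped (@cos R) (Rr w * xi))) => //.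
  + by apply: int_ext => w; rewrite !fE.
  + by move=> w x y _ _; apply: dE => u v; rewrite sinD addrC.
Qed.

End mixing_measure_is_a_fixed_point.

(** * Negativity of the rates *)

Section rates.
Context (R : realType) dO (Omega : measurableType dO) (P : probability Omega R).
Variables (L Rr : {RV P >-> R}) (alpha p : R).
Hypothesis alpha12 : 1 <= alpha < 2.
Hypothesis p2 : 2 < p.
Hypothesis L0 : forall w, 0 <= L w.
Hypothesis Rr0 : forall w, 0 <= Rr w.
Hypothesis Ealpha : ('E_P[fun w => (L w `^ alpha + Rr w `^ alpha)%R] = 1)%E.
Hypothesis Ep : ('E_P[fun w => (L w `^ p + Rr w `^ p)%R] < 1)%E.

Let mL : measurable_fun setT L.
Proof. by []. Qed.

Let mR : measurable_fun setT Rr.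
Proof. by []. Qed.

Let i_sum : integrableR P (fun w => L w `^ p + Rr w `^ p).
Proof.
apply: ge0_integrableR.
- by apply: measurable_funD; exact: measurable_powR_comp.
- by move=> w; rewrite addr_ge0// powR_ge0.
- by move: Ep; rewrite unlock => /lt_trans; apply; rewrite ltry.
Qed.

Lemma integrable_pth_left : integrableR P (fun w => L w `^ p).
Proof.
apply: integrableR_le i_sum _; first exact: measurable_powR_comp.
by move=> w; rewrite !ger0_norm ?addr_ge0 ?powR_ge0// lerDl powR_ge0.
Qed.

Lemma integrable_pth_right : integrableR P (fun w => Rr w `^ p).
Proof.
apply: integrableR_le i_sum _; first exact: measurable_powR_comp.
by move=> w; rewrite !ger0_norm ?addr_ge0 ?powR_ge0// lerDr powR_ge0.
Qed.

Lemma S_fun_loss r : 0 <= r <= p -> S_fun L Rr r = loss P L Rr r.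
Proof.
move=> hr; rewrite /S_fun unlock /loss; congr (_ - 1).
have i1 := integrable_lower_exponent mL L0 integrable_pth_left hr.
have i2 := integrable_lower_exponent mR Rr0 integrable_pth_right hr.
by rewrite -intD.
Qed.

Lemma S_fun_p_lt0 : S_fun L Rr p < 0.
Proof.
rewrite /S_fun subr_lt0; move: Ep; rewrite unlock.
have := EFin_int i_sum; rewrite /= => <-.
by rewrite lte_fin.
Qed.

(** Log-convexity in the exponent, from [1 + z <= exp z] at the two other
    exponents relative to 2. *)
Lemma powR_log_convex (x : R) : 0 <= x ->
  (p - alpha) * x `^ 2 <= (p - 2) * x `^ alpha + (2 - alpha) * x `^ p.
Proof.
have /andP[a1 a2] := alpha12; move: p2 => p2'.
rewrite le_eqVlt => /predU1P[<-|x0].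
  by rewrite !powR0 ?mulr0 ?addr0//; apply/eqP; lra.
rewrite /powR gt_eqF//; set y := ln x.
have -> : alpha * y = 2 * y + (alpha - 2) * y by ring.
have -> : p * y = 2 * y + (p - 2) * y by ring.
rewrite !expRD ![_ * (expR (2 * y) * _)]mulrCA -mulrDr mulrC.
apply: ler_wpM2l; first exact: expR_ge0.
have h1 := expR_ge1Dx ((alpha - 2) * y); have h2 := expR_ge1Dx ((p - 2) * y).
have b1 : 0 <= p - 2 by lra.
have b2 : 0 <= 2 - alpha by lra.
have := ler_wpM2l b1 h1; have := ler_wpM2l b2 h2; lra.
Qed.

(** [S] is convex, vanishes at [alpha] and is negative at [p], and 2 lies in
    between. *)
Lemma S_fun_2_lt0 : S_fun L Rr 2 < 0.
Proof.
have /andP[a1 a2] := alpha12; move: p2 => p2'.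
have ha : 0 <= alpha <= p by apply/andP; split; lra.
have h2 : 0 <= (2 : R) <= p by apply/andP; split; lra.
have hp : 0 <= p <= p by apply/andP; split; lra.
have Sa : S_fun L Rr alpha = 0 by rewrite /S_fun Ealpha subrr.
have := S_fun_p_lt0; rewrite !S_fun_loss// /loss in Sa *.
have i1 (X : Omega -> R) (mX : measurable_fun setT X) (X0 : forall w, 0 <= X w)
    (iX : integrableR P (fun w => X w `^ p)) :
    (p - alpha) * \int[P]_w X w `^ 2 <=
    (p - 2) * \int[P]_w X w `^ alpha + (2 - alpha) * \int[P]_w X w `^ p.
  have j2 := integrable_lower_exponent mX X0 iX h2.
  have ja := integrable_lower_exponent mX X0 iX ha.
  rewrite -!intZ// -intD; [|exact: integrableRZ..].
  apply: int_le; [exact: integrableRZ|by apply: integrableRD; exact: integrableRZ|].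
  by move=> w; exact: powR_log_convex.
have := i1 _ mL L0 integrable_pth_left; have := i1 _ mR Rr0 integrable_pth_right.
move: Sa; set u := \int[P]_w L w `^ alpha; set v := \int[P]_w Rr w `^ alpha.
set u2 := \int[P]_w L w `^ 2; set v2 := \int[P]_w Rr w `^ 2.
set up := \int[P]_w L w `^ p; set vp := \int[P]_w Rr w `^ p.
move=> uv h1 h3 h4.
have b2 : 0 < 2 - alpha by lra.
have b3 : 0 < p - alpha by lra.
have uv' : v = 1 - u by lra.
rewrite -(pmulr_rlt0 _ b3).
have : (2 - alpha) * (up + vp - 1) < 0 by rewrite pmulr_rlt0.
by move: h1 h3; rewrite uv'; lra.
Qed.

End rates.

Section steady_marginal.
Context (R : realType) dO (Omega : measurableType dO) (P : probability Omega R).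
Variables (L Rr : {RV P >-> R}) (alpha cp cm c gamma : R) (nu muinf mu0 : probR R).
Hypothesis alpha12 : 1 <= alpha < 2.
Hypothesis L0 : forall w, 0 <= L w.
Hypothesis Rr0 : forall w, 0 <= Rr w.
Hypothesis initial : initial_condition alpha cp cm c gamma mu0.
Hypothesis mixing : is_mixing_measure L Rr alpha nu.
Hypothesis steady : is_steady_state alpha cp cm c gamma nu muinf.

Lemma steady_fixed_point xi : fourier muinf xi =
  cintegral P setT (fun w => fourier muinf (L w * xi) * fourier muinf (Rr w * xi)).
Proof.
have /andP[a1 a2] := alpha12; have alpha0 : 0 < alpha by lra.
move: a1; rewrite le_eqVlt => /predU1P[a1|a1].
  have a1' := esym a1; have [c0 _ _ _] := initial.2 a1'.
  apply: (@steady_state_fixed_point _ _ _ _ _ _ _ nu L0 Rr0 mixing (c * pi) gamma) => //.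
    by rewrite mulr_ge0// pi_ge0.
  move=> z; rewrite (steady.2 a1') /cintegral a1' powRr1//.
  have reE (m : R) : m * - (c * pi * `|z|) - 0 * (gamma * z) = - (c * pi * `|z| * m).
    by ring.
  have imE (m : R) : m * (gamma * z) + 0 * - (c * pi * `|z|) =
      gamma * Num.sg z * `|z| * m.
    transitivity (gamma * (Num.sg z * `|z|) * m); last by ring.
    by rewrite -numEsg; ring.
  by congr (_ +i* _)%C; apply: eq_Rintegral => m _; rewrite /= reE imE.
have ha : 1 < alpha < 2 by rewrite a1.
apply: (@steady_state_fixed_point _ _ _ _ _ _ _ nu L0 Rr0 mixing
  (stable_lambda alpha cp cm)
  (stable_lambda alpha cp cm * (stable_beta cp cm * tan (pi * alpha / 2)))) => //.
  exact: stable_lambda_ge0 initial ha.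
move=> z; rewrite (steady.1 ha) /cintegral.
set lam := stable_lambda _ _ _; set k := stable_beta _ _ * _; set s := Num.sg z.
set r := `|z| `^ alpha.
have reE (m : R) : - (lam * m * r) * 1 - - 0 * - (k * s) = - (lam * r * m) by ring.
have imE (m : R) : - (lam * m * r) * - (k * s) + - 0 * 1 = lam * k * s * r * m by ring.
by congr (_ +i* _)%C; apply: eq_Rintegral => m _; rewrite /= reE imE.
Qed.

End steady_marginal.

(** * Coupled Wild sums *)

Section marginals.
Context (R : realType).
Local Notation T := (measurableTypeR R).

Lemma transform_id (m : probR R) (xi : R) : fourier m xi = @transform R _ T id m xi.
Proof. by rewrite fourierE. Qed.

Lemma law_of_transform d (Z : measurableType d) (m : probability Z R)
    (l : Z -> T) (mu : probR R) : measurable_fun setT l ->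
  (forall xi : R, @transform R _ Z l m xi = fourier mu xi) ->
  forall A, measurable A -> m (l @^-1` A) = mu A.
Proof.
move=> ml h A mA; have [lp lpE] := law_of_measurable m ml.
rewrite lpE//; apply: fourier_inj mA => xi; rewrite -h fourierE /transform.
by congr (_ +i* _)%C; apply: (int_marginal ml lpE);
  [apply: bm_cos|apply: bm_sin]; exact: measurable_funM.
Qed.

Lemma transform_of_law d (Z : measurableType d) (m : probability Z R)
    (l : Z -> T) (mu : probR R) (xi : R) : measurable_fun setT l ->
  (forall A, measurable A -> m (l @^-1` A) = mu A) ->
  @transform R _ Z l m xi = fourier mu xi.
Proof.
move=> ml hl; rewrite fourierE /transform.
by congr (_ +i* _)%C; apply/esym; apply: (int_marginal ml hl);
  [apply: bm_cos|apply: bm_sin]; exact: measurable_funM.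
Qed.

Context dO (Omega : measurableType dO) (P : probability Omega R).
Context d (Z : measurableType d) (op : {mfun (Omega * (Z * Z))%type >-> Z}).
Variables (L Rr : {RV P >-> R}) (l : Z -> R).
Hypothesis ml : measurable_fun setT l.
Hypothesis l_op : forall w z z', l (op (w, (z, z'))) = L w * l z + Rr w * l z'.
Variable m0 : probability Z R.

Let complexP (z z' : R[i]%C) : complex.Re z = complex.Re z' ->
  complex.Im z = complex.Im z' -> z = z'.
Proof. by case: z => a b; case: z' => a' b' /= -> ->. Qed.

Let bL m (xi : R) : cbounded (fun w => transform l m (L w * xi)).
Proof. by apply: cbounded_transform => //; exact: measurable_funM. Qed.

Let bR m (xi : R) : cbounded (fun w => transform l m (Rr w * xi)).
Proof. by apply: cbounded_transform => //; exact: measurable_funM. Qed.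

Lemma wild_sum_of_solution (mu0 : probR R) (mu : R -> probR R) (t xi : R) :
  is_kinetic_solution L Rr mu0 mu ->
  (forall xi, transform l m0 xi = fourier mu0 xi) -> 0 <= t ->
  transform l (wild_sum P op m0 t) xi = fourier (mu t) xi.
Proof.
move=> [init cvg0 ode] h0 t0.
have bf (n : probR R) (X : Omega -> R) z (mX : measurable_fun setT X) :
    cbounded (fun w => fourier n (X w * z)).
  under eq_fun do rewrite transform_id.
  by apply: cbounded_transform => //; exact: measurable_funM.
have [cr ci] := transform_wild_sum P op ml m0 xi t0.
have [] := @cvg_wild_expansion R _ _ P L Rr (fun t xi => fourier (mu t) xi)
  (fun n xi => transform l (wild P op m0 n) xi) _ _ _ _ _ _ _ _ _ _ t xi t0.
- by move=> s z; exact: bf.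
- by move=> s z; exact: bf.
- by move=> s z; rewrite transform_id; exact: normc_transform_le1.
- by move=> n z; exact: bL.
- by move=> n z; exact: bR.
- by move=> n z; exact: normc_transform_le1.
- by move=> n z; exact: transform_wildS.
- by move=> z; rewrite init -h0 wild0.
- by move=> z; exact: cvg0.
- by move=> s z s0; exact: ode.
move=> cr' ci'; apply: complexP.
- exact: cvg_unique cr cr'.
- exact: cvg_unique ci ci'.
Qed.

Lemma wild_of_fixed_point (mu : probR R) :
  (forall xi, fourier mu xi =
     cintegral P setT (fun w => fourier mu (L w * xi) * fourier mu (Rr w * xi))) ->
  (forall xi, transform l m0 xi = fourier mu xi) ->
  forall n xi, transform l (wild P op m0 n) xi = fourier mu xi.
Proof.
move=> fp h0 n; have [N] := ubnP n; elim: N n => // N IH [|n] nN xi.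
  by rewrite wild0.
have := transform_wildS P ml l_op m0 n xi.
rewrite (eq_bigr (fun=> fourier mu xi)); last first.
  move=> j _; rewrite [RHS]fp; apply: cintegral_ext => w.
  have j1 : (j < N)%N by rewrite (leq_trans (ltn_ord j)).
  have j2 : (n - j < N)%N by rewrite (leq_ltn_trans (leq_subr _ _)).
  by rewrite (IH _ j1) (IH _ j2).
rewrite sumr_const card_ord -[RHS]mulr_natl.
have -> : (n.+1%:R : R)%:C%C = n.+1%:R by rewrite rmorph_nat.
by apply: mulfI; rewrite pnatr_eq0.
Qed.

Lemma wild_sum_of_fixed_point (mu : probR R) (t xi : R) :
  (forall xi, fourier mu xi =
     cintegral P setT (fun w => fourier mu (L w * xi) * fourier mu (Rr w * xi))) ->
  (forall xi, transform l m0 xi = fourier mu xi) -> 0 <= t ->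
  transform l (wild_sum P op m0 t) xi = fourier mu xi.
Proof.
move=> fp h0 t0; have [cr ci] := transform_wild_sum P op ml m0 xi t0.
have [_ w1] := weights_wild t0.
have wc (x : R) : \sum_(n < N) wild_weight t n * x @[N --> \oo] --> x.
  have -> : (fun N => \sum_(n < N) wild_weight t n * x) =
      (fun N => series (wild_weight t) N * x).
    by apply/funext => N; rewrite /series/= big_mkord mulr_suml.
  by rewrite -[X in _ --> X]mul1r; apply: cvgM => //; exact: cvg_cst.
have wE n := wild_of_fixed_point fp h0 n xi.
apply: complexP.
- apply: (cvg_unique _ cr) => //.
  have -> : (fun N => \sum_(n < N) wild_weight t n *
      complex.Re (transform l (wild P op m0 n) xi)) =
    (fun N => \sum_(n < N) wild_weight t n * complex.Re (fourier mu xi)).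
    by apply/funext => N; apply: eq_bigr => n _; rewrite wE.
  exact: wc.
- apply: (cvg_unique _ ci) => //.
  have -> : (fun N => \sum_(n < N) wild_weight t n *
      complex.Im (transform l (wild P op m0 n) xi)) =
    (fun N => \sum_(n < N) wild_weight t n * complex.Im (fourier mu xi)).
    by apply/funext => N; apply: eq_bigr => n _; rewrite wE.
  exact: wc.
Qed.

End marginals.

Section plane_collision.
Context (R : realType) dO (Omega : measurableType dO).
Variables (L Rr : Omega -> R).
Hypothesis mL : measurable_fun setT L.
Hypothesis mR : measurable_fun setT Rr.
Local Notation T := (measurableTypeR R * measurableTypeR R)%type.

Definition plane_op (x : Omega * (T * T)) : T :=
  (L x.1 * x.2.1.1 + Rr x.1 * x.2.2.1, L x.1 * x.2.1.2 + Rr x.1 * x.2.2.2).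

Lemma measurable_plane_op : measurable_fun setT plane_op.
Proof.
have m1 : measurable_fun setT (fun x : Omega * (T * T) => x.2.1).
  exact: (measurableT_comp (f := fst) measurable_fst measurable_snd).
have m2 : measurable_fun setT (fun x : Omega * (T * T) => x.2.2).
  exact: (measurableT_comp (f := snd) measurable_snd measurable_snd).
have mL' : measurable_fun setT (fun x : Omega * (T * T) => L x.1).
  exact: (measurableT_comp mL measurable_fst).
have mR' : measurable_fun setT (fun x : Omega * (T * T) => Rr x.1).
  exact: (measurableT_comp mR measurable_fst).
apply/measurable_fun_pairP; split.
- apply: measurable_funD; apply: measurable_funM => //.
    exact: (measurableT_comp (f := fst) measurable_fst m1).
  exact: (measurableT_comp (f := fst) measurable_fst m2).
- apply: measurable_funD; apply: measurable_funM => //.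
    exact: (measurableT_comp (f := snd) measurable_snd m1).
  exact: (measurableT_comp (f := snd) measurable_snd m2).
Qed.

(** Both coordinates collide with the same coefficients [L] and [Rr]: the Wild
    sums of the two marginals are thereby coupled, and the displacement obeys
    the same linear recursion as its coordinates. *)
Definition plane_collision : {mfun (Omega * (T * T))%type >-> T} :=
  HB.pack plane_op (isMeasurableFun.Build _ _ _ _ _ measurable_plane_op).

Definition displacement (z : T) : R := z.1 - z.2.

Lemma measurable_displacement : measurable_fun setT displacement.
Proof. exact: measurable_funB. Qed.

Lemma displacement_collision w z z' : displacement (plane_collision (w, (z, z'))) =
  L w * displacement z + Rr w * displacement z'.
Proof. by rewrite /displacement /plane_collision /= /plane_op /=; ring. Qed.

End plane_collision.

Section coupled_wild_sums.
Context (R : realType) dO (Omega : measurableType dO) (P : probability Omega R).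
Variables (L Rr : {RV P >-> R}) (mu0 muinf : probR R) (mu : R -> probR R).
Local Notation T := (measurableTypeR R * measurableTypeR R)%type.

Hypothesis mL : measurable_fun setT L.
Hypothesis mR : measurable_fun setT Rr.

Lemma is_couplingP (m1 m2 : probR R) (m : probability T R) :
  is_coupling m1 m2 m <-> forall A : set (measurableTypeR R), measurable A ->
    m (fst @^-1` A) = m1 A /\ m (snd @^-1` A) = m2 A.
Proof.
have E1 (A : set (measurableTypeR R)) :
    A `*` [set: measurableTypeR R] = (fst : T -> measurableTypeR R) @^-1` A.
  by apply/seteqP; split => -[x y]/= => [[]|].
have E2 (A : set (measurableTypeR R)) :
    [set: measurableTypeR R] `*` A = (snd : T -> measurableTypeR R) @^-1` A.
  by apply/seteqP; split => -[x y]/= => [[]|].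
by split => h A mA; have := h A mA; rewrite E1 E2.
Qed.

Lemma wild_sum_coupling (m0 : probability T R) t :
  is_kinetic_solution L Rr mu0 mu ->
  (forall xi, fourier muinf xi = cintegral P setT
     (fun w => fourier muinf (L w * xi) * fourier muinf (Rr w * xi))) ->
  is_coupling mu0 muinf m0 -> 0 <= t ->
  is_coupling (mu t) muinf (wild_sum P (plane_collision mL mR) m0 t).
Proof.
move=> sol fp /is_couplingP hm0 t0; apply/is_couplingP => A mA.
have m1 : measurable_fun setT (fst : T -> R) by exact: measurable_fst.
have m2 : measurable_fun setT (snd : T -> R) by exact: measurable_snd.
have op1 w (z z' : T) : (plane_collision mL mR (w, (z, z'))).1 = L w * z.1 + Rr w * z'.1.
  by [].
have op2 w (z z' : T) : (plane_collision mL mR (w, (z, z'))).2 = L w * z.2 + Rr w * z'.2.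
  by [].
split.
- apply: (law_of_transform (l := fst) measurable_fst) => // xi.
  apply: (wild_sum_of_solution m1 op1 _ sol) => // z.
  apply: transform_of_law; first exact: measurable_fst.
  by move=> B /hm0[].
- apply: (law_of_transform (l := snd) measurable_snd) => // xi.
  apply: (wild_sum_of_fixed_point m2 op2 _ fp) => // z.
  apply: transform_of_law; first exact: measurable_snd.
  by move=> B /hm0[].
Qed.

End coupled_wild_sums.

(** * Convergence to the steady state *)

Lemma pth_root_le (R : realType) (p C x y e : R) : 0 < p -> 0 <= x -> 0 <= y ->
  x <= C * y `^ p * expR (p * e) -> x `^ p^-1 <= `|C| `^ p^-1 * y * expR e.
Proof.
move=> p0 x0 y0 h; have pi0 : 0 <= p^-1 by rewrite invr_ge0 ltW.
have B0 : 0 <= `|C| * y `^ p * expR (p * e).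
  by rewrite !mulr_ge0 ?powR_ge0 ?expR_ge0.
have h' : x <= `|C| * y `^ p * expR (p * e).
  apply: le_trans h _; apply: ler_wpM2r; first exact: expR_ge0.
  by apply: ler_wpM2r; [exact: powR_ge0|exact: ler_norm].
apply: (@le_trans _ _ ((`|C| * y `^ p * expR (p * e)) `^ p^-1)).
  by apply: ge0_ler_powR; rewrite ?nnegrE.
rewrite powRM ?mulr_ge0 ?powR_ge0 ?expR_ge0// powRM ?powR_ge0//.
rewrite -powRrM mulfV ?gt_eqF// powRr1// -expRM.
by rewrite [p * e]mulrC mulfK ?gt_eqF.
Qed.

Theorem theorem3p4 (R : realType) (alpha p : R)
  (d : measure_display) (Omega : measurableType d) (P : probability Omega R)
  (L Rr : {RV P >-> R}) (mu0 : probR R) (cp cm c gamma : R)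
  (mu : R -> probR R) (nu muinf : probR R) :
  1 <= alpha < 2 -> 2 < p ->
  (forall w, 0 <= L w) -> (forall w, 0 <= Rr w) ->
  (1 < P [set w | (0 < L w)%R] + P [set w | (0 < Rr w)%R])%E ->
  ('E_P[fun w => (L w `^ alpha + Rr w `^ alpha)%R] = 1)%E ->
  ('E_P[fun w => (L w `^ p + Rr w `^ p)%R] < 1)%E ->
  initial_condition alpha cp cm c gamma mu0 ->
  is_kinetic_solution L Rr mu0 mu ->
  is_mixing_measure L Rr alpha nu ->
  is_steady_state alpha cp cm c gamma nu muinf ->
  (wasserstein p mu0 muinf < +oo)%E ->
  let K2 := Num.max (phi L Rr 2) (phi L Rr p) in
  exists C : R, forall t : R, 0 <= t ->
    (wasserstein p (mu t) muinf <=
      ((if phi L Rr p != phi L Rr 2 then C * expR (- t * `|K2|)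
       else C * Num.max 1 t * expR (- t * `|K2|))%R)%:E)%E.
Proof.
move=> alpha12 p2 L0 Rr0 _ Ea Ep initial sol mixing steady Wfin K2.
have p0 : 0 < p by lra.
have iL := integrable_pth_left Ep; have iR := integrable_pth_right Ep.
have [nu1 nu_mean _] := mixing.
have pV : Num.min 1 p^-1 = p^-1 :> R.
  by rewrite min_r// invf_le1//; lra.
(* The hypothesis of finite distance provides a coupling of finite cost from
   which the coupled Wild sums start. *)
have [_ [m0 hm0 <-] cost0] := ereal_inf_lt Wfin.
have im0 : integrableR m0 (fun z => `|displacement z| `^ p).
  apply: ge0_integrableR; first exact: (measurable_abs_powR (@measurable_displacement R) p).
    by move=> z; exact: powR_ge0.
  rewrite ltNge; apply/negP; rewrite leye_eq => /eqP Ey.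
  by move: cost0; rewrite Ey pV poweRyr ?ltxx// gt_eqF ?invr_gt0.
have cm0 : centered (@displacement R) p m0.
  split => //; apply: (coupling_centered nu1 nu_mean steady initial alpha12 hm0).
  exact: (integrable_l (@measurable_displacement R) p2 im0).
have mL : measurable_fun setT L by [].
have mR : measurable_fun setT Rr by [].
pose m t := wild_sum P (plane_collision mL mR) m0 t.
have fp := steady_fixed_point alpha12 L0 Rr0 initial mixing steady.
have [C hC] := wild_cost mL mR L0 Rr0 (@measurable_displacement R)
  (displacement_collision mL mR) p2 iL iR cm0.
have hp : 0 <= p <= p by rewrite lexx ltW.
have h2 : 0 <= (2 : R) <= p by rewrite ler0n/= ltW.
have lossp : loss P L Rr p = p * phi L Rr p.
  by rewrite -(S_fun_loss L0 Rr0 Ep hp) /phi mulrC divfK// gt_eqF.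
have loss2 : p * loss P L Rr 2 / 2 = p * phi L Rr 2.
  by rewrite -(S_fun_loss L0 Rr0 Ep h2) /phi mulrA.
have phip_lt0 : phi L Rr p < 0.
  by rewrite /phi pmulr_llt0 ?invr_gt0//; exact: S_fun_p_lt0.
have phi2_lt0 : phi L Rr 2 < 0.
  rewrite /phi pmulr_llt0 ?invr_gt0//.
  exact: (S_fun_2_lt0 alpha12 p2 L0 Rr0 Ea Ep).
have K2_lt0 : K2 < 0 by rewrite /K2 gt_max phi2_lt0.
rewrite lossp loss2 (inj_eq (mulfI _)) in hC; last by rewrite gt_eqF.
exists (2 * `|C| `^ p^-1) => t t0.
have Ct : 0 <= `|C| `^ p^-1 by exact: powR_ge0.
have {hC} [hC im] := hC t t0.
have mom0 : 0 <= moment (@displacement R) (m t) p by apply: Rintegral_ge0 => z _; exact: powR_ge0.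
have -> : - t * `|K2| = K2 * t by rewrite ltr0_norm// mulrNN mulrC.
apply: (@le_trans _ _ ((moment (@displacement R) (m t) p `^ p^-1)%:E)).
  apply: ereal_inf_lbound; exists (m t); first exact: (wild_sum_coupling mL mR sol fp hm0 t0).
  by rewrite pV -poweR_EFin (EFin_int im).
rewrite lee_fin; case: ifPn => [ne|]; last first.
  rewrite negbK => e; rewrite e in hC.
  have K2E : K2 = phi L Rr p by rewrite /K2 -(eqP e) maxxx.
  have t1 : 0 <= 1 + t by lra.
  have y0 : 0 <= (1 + t) `^ (1 / 2) by exact: powR_ge0.
  have hy : moment (@displacement R) (m t) p <= C * ((1 + t) `^ (1 / 2)) `^ p * expR (p * (K2 * t)).
    rewrite -powRrM K2E mulrA.
    by have -> : 1 / 2 * p = p / 2 by field.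
  apply: le_trans (pth_root_le p0 mom0 y0 hy) _.
  apply: ler_wpM2r; first exact: expR_ge0.
  rewrite [2 * _]mulrC -mulrA; apply: ler_wpM2l => //.
  apply: (@le_trans _ _ (1 + t)).
    rewrite -[leRHS]powRr1//; apply: ler_powR; first by rewrite lerDl.
    by rewrite ler_pdivrMr// mul1r ler1n.
  have : 1 <= Num.max 1 t by rewrite le_max lexx.
  have : t <= Num.max 1 t by rewrite le_max lexx orbT.
  by lra.
have KE : Num.max (p * phi L Rr p) (p * phi L Rr 2) = p * K2.
  by rewrite maxr_pMr ?(ltW p0)// /K2 maxC.
rewrite (negbTE ne) KE in hC.
have hy : moment (@displacement R) (m t) p <= C * 1 `^ p * expR (p * (K2 * t)).
  by rewrite powR1 mulr1 mulrA.
apply: le_trans (pth_root_le p0 mom0 ler01 hy) _.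
apply: ler_wpM2r; first exact: expR_ge0.
by rewrite mulr1; lra.
Qed.
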